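(* Let $l_0=\lfloor\varepsilon^{-x}\rfloor$ with $x\in(0,\frac12)$. Let $(n^\varepsilon,w^\varepsilon)_{\varepsilon>0}$ be a family of rescaled curves of finite action on $[0,T]$ such that $\mathcal{J}^\varepsilon(n^\varepsilon)<\infty$ uniformly in $\varepsilon$ and such that $\nu_0^\varepsilon:=\Pi^\varepsilon_{\mathrm{mac}}n^\varepsilon(0)$ satisfies $\int_R^\infty\lambda\,\nu_0^\varepsilon(d\lambda)\to0$ as $R\to\infty$ uniformly in $\varepsilon$. Then the small clusters follow a quasistationary distribution dictated by $n_1^\varepsilon$: there is a constant $C$ independent of $\varepsilon$ such that (for all sufficiently small $\varepsilon$) $$\int_0^T\mathcal{H}_{\mathrm{mic}}\big(n^\varepsilon(t)\mid\omega(n_1^\varepsilon(t))\big)\,dt\le C\,\varepsilon^{\gamma+(1-x)(1-\alpha+\gamma)}\int_0^T\mathcal{D}^\varepsilon_{\mathrm{mic}}(n^\varepsilon(t))\,dt .$$ In particular, along a subsequence $\varepsilon\to0$ for which $\nu_t^\varepsilon:=\Pi^\varepsilon_{\mathrm{mac}}n^\varepsilon(t)\stackrel{*}{\rightharpoonup}\nu_t$ in $C_c^0(\mathbb{R}_+)^*$ for all $t\in[0,T]$, after possibly passing to a further subsequence, for a.e. $t\in(0,T)$ it holds $$\lim_{\varepsilon\to0}\mathcal{F}^\varepsilon_{\mathrm{mic}}(n^\varepsilon(t))=0\qquad\text{and}\qquad\lim_{\varepsilon\to0}\mathcal{F}^\varepsilon_{\mathrm{mac}}(\nu^\varepsilo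n_t)=E(\nu_t).$$
   Context: **Becker--Döring setting.** Fix $\alpha\in[0,1)$, $\gamma\in(0,1)$, $z_s,q>0$, and $a_l:=l^\alpha$, $b_l:=l^\alpha(z_s+ql^{-\gamma})$. Let $Q_1:=1$, $Q_l:=\prod_{j=1}^{l-1}a_j/b_{j+1}$, $\omega_l(z):=z^lQ_l$, $\omega_l:=\omega_l(z_s)$, $\varrho_s:=\sum_{l\ge1}l\omega_l\in(0,\infty)$. Fix $\varrho_0>\varrho_s$ and $\mathcal{M}:=\{n=(n_l)_{l\ge1}: n_l\ge0,\ \sum_{l}ln_l=\varrho_0\}$. With $\psi(a):=a\log a-a+1$, set $\mathcal{F}(n):=\sum_{l\ge1}\omega_l\psi(n_l/\omega_l)$. Set $k^l:=a_l\omega_1\omega_l=b_{l+1}\omega_{l+1}$, $\Lambda(a,b):=\int_0^1a^sb^{1-s}ds$, $\hat n_l^\omega:=\Lambda\big(\tfrac{n_1n_l}{\omega_1\omega_l},\tfrac{n_{l+1}}{\omega_{l+1}}\big)$. For $\phi\in\mathbb{R}^{\mathbb{N}}$ let $\nabla_l\phi:=\phi_{l+1}-\phi_l-\phi_1$ and, with $e^l$ the $l$-th unit vector, $$\mathcal{K}(n)\phi:=\sum_{l\ge1}k^l\hat n_l^\omega\big((e^1+e^l-e^{l+1})\cdot\phi\big)(e^1+e^l-e^{l+1}).$$ Cotangent vectors at $n$ are those $\phi$ for which $\mathcal{K}(n)\phi$ lies in the span of the vectors $e^1+e^l-e^{l+1}$, $l\in\mathbb{N}$ (convergent infinite combinations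 allowed). The dissipation is $\mathcal{D}(n):=\sum_{l\ge1}(a_ln_1n_l-b_{l+1}n_{l+1})(\log(a_ln_1n_l)-\log(b_{l+1}n_{l+1}))\in[0,\infty]$. **Rescaling.** For $\varepsilon>0$ let $\Pi^\varepsilon_{\mathrm{mac}}n:=\frac1\varepsilon\sum_{l\ge l_0}n_l\,\delta_{\varepsilon l}$, a measure on $\mathbb{R}_+=(0,\infty)$. A cotangent vector $\phi$ is represented by $w(\varepsilon l):=z_s\varepsilon^{-\gamma}\nabla_l\phi$, and $\mathcal{K}^\varepsilon(n)w:=\varepsilon^{-(1-\alpha+\gamma)}\mathcal{K}(n)\phi$. Set $$\mathcal{F}^\varepsilon:=z_s\varepsilon^{-\gamma}\mathcal{F},\quad \mathcal{A}^\varepsilon(n,w):=\frac{z_s}{\varepsilon^{1-\alpha+2\gamma}}\sum_{l\ge1}k^l\hat n_l^\omega|\nabla_l\phi|^2,\quad \mathcal{D}^\varepsilon(n):=\frac{z_s}{\varepsilon^{1-\alpha+2\gamma}}\mathcal{D}(n).$$ A family of *rescaled curves of finite action* is a family of pairs $t\mapsto(n^\varepsilon(t),w^\varepsilon_t)$ with $n^\varepsilon:[0,T]\to\mathcal{M}$ absolutely continuous and $w^\varepsilon_t$ representing cotangent vectors at $n^\varepsilon(t)$, solving $\dot n^\varepsilon_l=(\mathcal{K}^\varepsilon(n^\varepsilon)w^\varepsilon)_l$ for every $l$ weakly on $(0,T)$ (tested with $C_c^1((0,T))$), such that $\sup_{t\in[0,T]}\mathcal{F}^\varepsilon(n^\varepsilon(t))$,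 $\int_0^T\mathcal{A}^\varepsilon(n^\varepsilon(t),w^\varepsilon_t)dt$ and $\int_0^T\mathcal{D}^\varepsilon(n^\varepsilon(t))dt$ are finite, uniformly in $\varepsilon$. For such a curve $$\mathcal{J}^\varepsilon(n^\varepsilon):=\mathcal{F}^\varepsilon(n^\varepsilon(T))-\mathcal{F}^\varepsilon(n^\varepsilon(0))+\frac12\int_0^T\mathcal{D}^\varepsilon(n^\varepsilon(t))dt+\frac12\int_0^T\mathcal{A}^\varepsilon(n^\varepsilon(t),w^\varepsilon_t)dt .$$ **Microscopic and macroscopic parts.** $\mathcal{F}^\varepsilon_{\mathrm{mic}}$, $\mathcal{D}^\varepsilon_{\mathrm{mic}}$ are defined like $\mathcal{F}^\varepsilon$, $\mathcal{D}^\varepsilon$ with summation over $l$ restricted to $\{1,\dots,l_0-1\}$; $\mathcal{F}^\varepsilon_{\mathrm{mac}}(\nu^\varepsilon)$ for $\nu^\varepsilon=\Pi^\varepsilon_{\mathrm{mac}}n$ is $z_s\varepsilon^{-\gamma}\sum_{l\ge l_0}\omega_l\psi(n_l/\omega_l)$. Moreover $\mathcal{H}_{\mathrm{mic}}(n\mid\omega(z)):=\sum_{l=1}^{l_0-1}\omega_l(z)\,\psi\big(n_l/\omega_l(z)\big)$. The macroscopic energy is $E(\nu):=\frac{q}{1-\gamma}\int\lambda^{1-\gamma}\,d\nu$. *)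

(* Defs.v *)
From HB Require Import structures.
From mathcomp Require Import all_boot all_order all_algebra.
From mathcomp Require Import all_classical all_reals all_analysis.
From mathcomp Require Import ring.

Set Implicit Arguments.
Unset Strict Implicit.
Unset Printing Implicit Defensive.
Import Order.TTheory GRing.Theory Num.Theory.
Import numFieldNormedType.Exports.

Local Open Scope classical_set_scope.
Local Open Scope ring_scope.

(* Sequences (n_l)_{l >= 1} are functions [nat -> R] whose value at index 0 is
   never used: every sum starts at 1, every componentwise condition asks 1 <= l. *)

Section RealFunctions.
Context {R : realType}.
Implicit Types (f zeta : R -> R).

Definition abs_continuous_on (a b : R) f : Prop :=
  forall e : R, 0 < e -> exists2 d : R, 0 < d &
    forall (N : nat) (u v : nat -> R),
      (forall i, (i < N)%N -> [/\ a <= u i, u i <= v i & v i <= b]) ->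
      (forall i j, (i < j < N)%N -> v i <= u j) ->
      \sum_(i < N) (v i - u i) < d ->
      \sum_(i < N) `|f (v i) - f (u i)| < e.

Definition compact_support_in (U : set R) f : Prop :=
  let S := closure [set x | f x != 0] in compact S /\ S `<=` U.

Definition Cc0 (U : set R) f : Prop := continuous f /\ compact_support_in U f.

Definition Cc1 (U : set R) zeta : Prop :=
  [/\ forall t, derivable zeta t 1, continuous (derive1 zeta)
    & compact_support_in U zeta].

(* A positive functional on C_c^0((0,oo)) is a measure on the line that is
   finite on the compact subsets of (0,oo); what it does outside (0,oo) is
   irrelevant, as it is only ever integrated over (0,oo). *)
Definition radon_on_Rplus (nu : {measure set (measurableTypeR R) -> \bar R}) :=
  forall K : set R, compact K -> K `<=` `]0, +oo[ -> (nu K < +oo)%E.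

Definition psi (a : R) : R := a * ln a - a + 1.

(* w * psi (n / w), with its value at w = 0 fixed by lower semicontinuity. *)
Definition entropy (n w : R) : \bar R :=
  if w == 0 then (if n == 0 then 0%E else +oo%E) else (w * psi (n / w))%:E.

(* (x - y) (log x - log y) for x, y >= 0, with log 0 = -oo and value 0 at
   x = y = 0. *)
Definition log_dissipation (x y : R) : \bar R :=
  if (x == 0) && (y == 0) then 0%E
  else if (x == 0) || (y == 0) then +oo%E
  else ((x - y) * (ln x - ln y))%:E.

Definition Lambda (a b : R) : R :=
  \int[lebesgue_measure]_(s in `[0, 1]) (a `^ s * b `^ (1 - s)).

Definition nabla (phi : nat -> R) (l : nat) : R := phi l.+1 - phi l - phi 1%N.

(* m-th component of the reaction vector e^1 + e^l - e^{l+1}. *)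
Definition reaction (l m : nat) : R :=
  (m == 1%N)%:R + (m == l)%:R - (m == l.+1)%:R.

Definition reaction_dot (l : nat) (phi : nat -> R) : R :=
  phi 1%N + phi l - phi l.+1.

(* Infinite combinations converge componentwise. *)
Definition in_reaction_span (v : nat -> R) : Prop :=
  exists c : nat -> R, forall m, (1 <= m)%N ->
    (\sum_(1 <= l < N) c l * reaction l m) @[N --> \oo] --> v m.

Definition states (rho0 : R) (n : nat -> R) : Prop :=
  (forall l, (1 <= l)%N -> 0 <= n l) /\
  (\sum_(1 <= l <oo) (l%:R * n l)%:E = rho0%:E)%E.

End RealFunctions.

Section BeckerDoering.
Context {R : realType}.
Variables alpha gamma zs q : R.
Implicit Types (n phi : nat -> R) (eps x : R) (l : nat).

Definition rate_a l : R := l%:R `^ alpha.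
Definition rate_b l : R := l%:R `^ alpha * (zs + q * l%:R `^ (- gamma)).
Definition Q l : R := \prod_(1 <= j < l) (rate_a j / rate_b j.+1).
Definition omega (z : R) l : R := z ^+ l * Q l.
Definition rho_s : \bar R := (\sum_(1 <= l <oo) (l%:R * omega zs l)%:E)%E.

Definition k_eq l : R := rate_a l * omega zs 1 * omega zs l.
Definition n_hat n l : R :=
  Lambda (n 1%N * n l / (omega zs 1 * omega zs l)) (n l.+1 / omega zs l.+1).

Definition K_partial n phi (m N : nat) : R :=
  \sum_(1 <= l < N) k_eq l * n_hat n l * reaction_dot l phi * reaction l m.
Definition K n phi (m : nat) : R := limn (K_partial n phi m).

Definition cotangent n phi : Prop :=
  (forall m, (1 <= m)%N -> cvgn (K_partial n phi m)) /\
  in_reaction_span (K n phi).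

Definition energy_term n l : R := omega zs l * psi (n l / omega zs l).
Definition dissipation_term n l : \bar R :=
  log_dissipation (rate_a l * n 1%N * n l) (rate_b l.+1 * n l.+1).

Definition F n : \bar R := (\sum_(1 <= l <oo) (energy_term n l)%:E)%E.
Definition D n : \bar R := (\sum_(1 <= l <oo) dissipation_term n l)%E.

Definition F_scale eps : R := zs * eps `^ (- gamma).
Definition D_scale eps : R := zs / eps `^ (1 - alpha + 2 * gamma).

Definition F_eps eps n : \bar R := ((F_scale eps)%:E * F n)%E.
Definition D_eps eps n : \bar R := ((D_scale eps)%:E * D n)%E.

(* w : (0,oo) -> R is only evaluated on the grid eps * l, l >= 1. *)
Definition represents eps (w : R -> R) phi : Prop :=
  forall l, (1 <= l)%N -> w (eps * l%:R) = zs * eps `^ (- gamma) * nabla phi l.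

(* The representative phi of w with phi_1 = 0. The choice is harmless: two
   representatives have the same discrete gradient, which is all that K sees
   (lift_w_represents, represents_nabla, K_represents below). *)
Definition lift_w eps (w : R -> R) : nat -> R := fun l =>
  eps `^ gamma / zs * \sum_(1 <= j < l) w (eps * j%:R).

Definition K_eps eps n (w : R -> R) (l : nat) : R :=
  eps `^ (- (1 - alpha + gamma)) * K n (lift_w eps w) l.

Definition A_eps eps n (w : R -> R) : \bar R :=
  ((D_scale eps)%:E *
   \sum_(1 <= l <oo) (k_eq l * n_hat n l * `|nabla (lift_w eps w) l| ^+ 2)%:E)%E.

Definition l0 x eps : nat := Num.truncn (eps `^ (- x)).

(* [mscale] wants a nonnegative factor, whence the absolute value; on [states]
   and for eps > 0 it disappears (Pi_macE below). *)
Definition Pi_mac x eps n : {measure set (measurableTypeR R) -> \bar R} :=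
  mseries (fun l => mscale (NngNum (normr_ge0 (n l / eps)))
                      (dirac (eps * l%:R : measurableTypeR R))) (l0 x eps).

Definition F_mic x eps n : R :=
  F_scale eps * \sum_(1 <= l < l0 x eps) energy_term n l.
Definition F_mac x eps n : \bar R :=
  ((F_scale eps)%:E * \sum_(l0 x eps <= l <oo) (energy_term n l)%:E)%E.
Definition D_mic x eps n : \bar R :=
  ((D_scale eps)%:E * \sum_(1 <= l < l0 x eps) dissipation_term n l)%E.

Definition H_mic x eps n (z : R) : \bar R :=
  (\sum_(1 <= l < l0 x eps) entropy (n l) (omega z l))%E.

Definition E_mac (nu : {measure set (measurableTypeR R) -> \bar R}) : \bar R :=
  ((q / (1 - gamma))%:E *
   \int[nu]_(lam in `]0%R, +oo[) (lam `^ (1 - gamma))%:E)%E.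

(* Curves in the state space that solve the rescaled continuity equation weakly.
   Absolute continuity is asked of each component only, the weakest reading. *)
Definition rescaled_curve (rho0 T eps : R)
    (n : R -> nat -> R) (w : R -> R -> R) : Prop :=
  [/\ forall t, 0 <= t <= T -> states rho0 (n t),
      forall l, (1 <= l)%N -> abs_continuous_on 0 T (fun t => n t l),
      forall l, (1 <= l)%N ->
        measurable_fun `[0, T] (fun t => w t (eps * l%:R)),
      forall t, 0 <= t <= T -> cotangent (n t) (lift_w eps (w t)) &
      forall l, (1 <= l)%N -> forall zeta : R -> R, Cc1 `]0, T[ zeta ->
        \int[lebesgue_measure]_(t in `]0, T[) (derive1 zeta t * n t l) =
        - \int[lebesgue_measure]_(t in `]0, T[)
            (zeta t * K_eps eps (n t) (w t) l)].

Definition int_A (T eps : R) (n : R -> nat -> R) (w : R -> R -> R) : \bar R :=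
  (\int[lebesgue_measure]_(t in `[0%R, T]) A_eps eps (n t) (w t))%E.
Definition int_D (T eps : R) (n : R -> nat -> R) : \bar R :=
  (\int[lebesgue_measure]_(t in `[0%R, T]) D_eps eps (n t))%E.

Definition J_eps (T eps : R) (n : R -> nat -> R) (w : R -> R -> R) : \bar R :=
  (F_eps eps (n T) - F_eps eps (n 0%R)
   + (2^-1)%:E * int_D T eps n + (2^-1)%:E * int_A T eps n w)%E.

Definition finite_action_family (rho0 T epsbar : R)
    (n : R -> R -> nat -> R) (w : R -> R -> R -> R) : Prop :=
  (forall eps, 0 < eps <= epsbar -> rescaled_curve rho0 T eps (n eps) (w eps)) /\
  exists C : R, forall eps, 0 < eps <= epsbar ->
    [/\ forall t, 0 <= t <= T -> (F_eps eps (n eps t) <= C%:E)%E,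
        (int_A T eps (n eps) (w eps) <= C%:E)%E &
        (int_D T eps (n eps) <= C%:E)%E].

Lemma lift_w_represents eps (w : R -> R) : 0 < zs -> 0 < eps ->
  represents eps w (lift_w eps w).
Proof.
move=> zs0 eps0 l l1; rewrite /nabla /lift_w [in X in _ - X]big_geq// mulr0 subr0.
have pe : eps `^ gamma != 0 by rewrite gt_eqF// powR_gt0.
rewrite big_nat_recr//= powRN; have zs_neq0 : zs != 0 by rewrite gt_eqF.
by field; rewrite zs_neq0 pe.
Qed.

Lemma represents_nabla eps (w : R -> R) phi phi' : 0 < zs -> 0 < eps ->
  represents eps w phi -> represents eps w phi' ->
  forall l, (1 <= l)%N -> nabla phi l = nabla phi' l.
Proof.
move=> zs0 eps0 h h' l l1.
apply: (@mulfI _ (zs * eps `^ (- gamma))); last by rewrite -h// -h'.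
by rewrite mulf_neq0// gt_eqF// powR_gt0.
Qed.

Lemma K_represents eps (w : R -> R) n phi : 0 < zs -> 0 < eps ->
  represents eps w phi -> K n phi = K n (lift_w eps w).
Proof.
move=> zs0 eps0 h; apply/funext => m; congr (limn _); apply/funext => N.
apply: eq_big_nat => l /andP[l1 _]; congr (_ * _ * _).
have := @represents_nabla eps w phi (lift_w eps w) zs0 eps0 h (lift_w_represents w zs0 eps0) l l1.
have dotE p : reaction_dot l p = - nabla p l.
  by rewrite /nabla /reaction_dot; ring.
by rewrite !dotE => ->.
Qed.

Lemma Pi_macE x eps n A : 0 < eps -> (1 <= l0 x eps)%N ->
  (forall l, (1 <= l)%N -> 0 <= n l) ->
  (Pi_mac x eps n A =
   \sum_(l0 x eps <= l <oo) (n l / eps)%:E * @dirac _ (measurableTypeR R) (eps * l%:R)%R R A)%E.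
Proof.
move=> eps0 l01 n0; apply: congr_lim; apply/funext => N /=.
apply: eq_big_nat => l /andP[l0l _]; rewrite /mscale/= ger0_norm//.
by apply: divr_ge0; [apply: n0; exact: leq_trans l0l|exact: ltW].
Qed.

End BeckerDoering.

(* Main.v *)
(** Idea. Fix a state, let z = n_1 and u_l = sqrt (n_l / omega_l(z)), so that u_1 = 1.
    The dissipation dominates sum_l k_l (u_{l+1} - u_l)^2 with weights k_l = l^alpha
    omega_l(z). The energy bound gives |z - z_s| <= C eps^(gamma/2), which for x < 1/2 is
    small against l_0^(-gamma), hence k_{l+1} <= k_l (1 - c l^(-gamma)) for l < l_0. A
    discrete Hardy inequality for such weights then bounds the relative entropy of the
    small clusters by l_0^(1-alpha+gamma) times their dissipation, which is the first claim.

    For the second claim, a curve of finite action cannot carry mass to infinity: the weak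
    equation, tested with l -> min(l, 2P - l), propagates the tightness of the initial data.
    The excess mass rho_0 - rho_s thus stays at macroscopic sizes, where Hardy inequalities
    yield |n_1 - z_s| <= C eps^gamma sqrt(D^eps). Consequently F_mic is small wherever D^eps
    is bounded, the clusters with eps l <= r contribute at most C (eps + r^(1-alpha+gamma)
    D^eps) to the macroscopic energy, and those with eps l >= s at most s^(-gamma) rho_0; on
    the rest F_mac is asymptotic to E by the asymptotics of log omega_l. As D^eps is bounded
    in L^1(0,T) only, the subsequence is chosen such that D^(eps_j) grows at most like 2^j
    at almost every t, and the truncations r_j, s_j are adapted to this growth. *)

Require Import Defs.
From HB Require Import structures.
From mathcomp Require Import all_boot all_order all_algebra.
From mathcomp Require Import all_classical all_reals all_analysis.
From mathcomp Require Import measurable_realfun ring lra zify.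

Set Implicit Arguments.
Unset Strict Implicit.
Unset Printing Implicit Defensive.
Import Order.TTheory GRing.Theory Num.Theory.
Import numFieldNormedType.Exports.

Local Open Scope classical_set_scope.
Local Open Scope ring_scope.

(** * Entropy and Hardy inequalities *)

(** The energy bound alone is critical for F_mic. It gives n_1 - zs = O(eps^(gamma/2)) and, by
    duality, a mass defect of the small clusters of the same order; replacing the reference
    omega(n_1) by omega(zs) costs the product of the two, eps^gamma, which the factor eps^(-gamma)
    in F^eps turns into O(1). Hence the better rate for n_1. It comes from playing mass against
    dissipation: the excess mass sits at sizes of order 1/eps, so the sum of l^alpha n_l there is at
    least c eps^(1-alpha), whereas a Hardy inequality bounds (n_1 - zs)^2 times that sum by the
    dissipation, which is at most of order M eps^(1-alpha+2 gamma) when D^eps <= M. Without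
    tightness the sum of l^alpha n_l has no lower bound. The same rate keeps the Hardy inequality of
    the small clusters valid beyond l_0, up to sizes r/eps with r independent of eps. At a fixed
    time the bound on D^eps becomes known only after the subsequence has been chosen. Therefore the
    pointwise estimates have thresholds in eps that depend neither on M nor on the truncations r and
    s. *)

Ltac nneg := repeat first
  [ assumption | exact: powR_ge0 | exact: ler0n | exact: sqr_ge0 | exact: ltW
  | exact: expR_ge0 | exact: normr_ge0 | exact: sqrtr_ge0 | apply: mulr_ge0
  | apply: addr_ge0 | rewrite invr_ge0 | apply: exprn_ge0 | by [] ].

Ltac posi := repeat first
  [ assumption | exact: expR_gt0 | apply: divr_gt0 | apply: mulr_gt0
  | apply: exprn_gt0 | apply: powR_gt0 | apply: addr_gt0 | by [] ].

Section Scalar.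
Context {R : realType}.
Implicit Types a b s u x y z : R.

Lemma ln_le_subr1 x : 0 < x -> ln x <= x - 1.
Proof.
by move=> x0; have := @le_ln1Dx R (x - 1); rewrite (addrC 1) subrK; apply; lra.
Qed.

(** With a = u^2 the two sides differ by 2 u (u ln u - u + 1), nonnegative by [ln_le_subr1] at 1/u.
    This turns the energy bound into a bound on sqrt(n_1 / zs) - 1. *)
Lemma psi_ge a : 0 <= a -> (Num.sqrt a - 1) ^+ 2 <= psi a.
Proof.
rewrite le_eqVlt => /predU1P[<-|a0]; first by rewrite /psi sqrtr0; lra.
set u := Num.sqrt a; have u0 : 0 < u by rewrite sqrtr_gt0.
have au : a = u ^+ 2 by rewrite sqr_sqrtr// ltW.
have : ln u^-1 <= u^-1 - 1 by rewrite ln_le_subr1// invr_gt0.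
rewrite lnV ?posrE// -(ler_pM2l u0) mulrBr divff ?gt_eqF// => h.
rewrite /psi au lnXn// mulr2n -subr_ge0.
have -> : u ^+ 2 * (ln u + ln u) - u ^+ 2 + 1 - (u - 1) ^+ 2 =
  2 * u * (u * ln u - u + 1) by ring.
by apply: mulr_ge0; lra.
Qed.

Lemma psi_ge0 a : 0 <= a -> 0 <= psi a.
Proof. by move=> a0; apply: le_trans (psi_ge a0); exact: sqr_ge0. Qed.

(** Entropy is quadratic near u = 1 and exceeds the square by only a logarithm for large u, whence
    the bound [b] on [ln u]. Up to 4, [ln u <= u - 1] gives the factor 2 u + 1 <= 9; beyond 4, u^2
    <= 2 (u - 1)^2 gives 4 b. *)
Lemma psi_sqr_le u b : 0 <= u -> 0 <= b -> (0 < u -> ln u <= b) ->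
  psi (u ^+ 2) <= (u - 1) ^+ 2 * (9 + 4 * b).
Proof.
rewrite le_eqVlt => /predU1P[<- b0 _|u0 b0 /(_ u0) ub]; first by rewrite /psi; nra.
have l1 := ln_le_subr1 u0.
rewrite /psi lnXn// mulr2n; have [u4|u4] := leP u 4.
  have : u ^+ 2 * (ln u + ln u) <= u ^+ 2 * (u - 1 + (u - 1)).
    by apply: ler_wpM2l; [exact: sqr_ge0|lra].
  have : 0 <= (u - 1) ^+ 2 * (8 - 2 * u + 4 * b).
    by apply: mulr_ge0; [exact: sqr_ge0|lra].
  by rewrite !expr2; nra.
have : u ^+ 2 * (ln u + ln u) <= u ^+ 2 * (b + b).
  by apply: ler_wpM2l; [exact: sqr_ge0|lra].
have : 0 <= (4 * (u - 1) ^+ 2 - 2 * u ^+ 2) * b.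
  by apply: mulr_ge0 => //; rewrite !expr2; nra.
have : 0 <= (u - 1) ^+ 2 by exact: sqr_ge0.
by rewrite !expr2; nra.
Qed.

Lemma expR_ge_tangent x y : expR x * (1 + (y - x)) <= expR y.
Proof.
have -> : expR y = expR x * expR (y - x) by rewrite -expRD addrC subrK.
by rewrite ler_pM2l ?expR_gt0// expR_ge1Dx.
Qed.

(* [expR s - 1] is the Legendre transform of [psi]. *)
Lemma psi_young s a : 0 <= a -> s * (a - 1) <= psi a + (expR s - 1 - s).
Proof.
rewrite le_eqVlt => /predU1P[<-|a0]; first by rewrite /psi; have := expR_gt0 s; lra.
have := @expR_ge_tangent (ln a) s; rewrite lnK ?posrE// /psi; nra.
Qed.

Lemma expR_taylor2_ge0 s : 0 <= expR s - 1 - s.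
Proof. by have := expR_ge1Dx s; lra. Qed.

Lemma expR_taylor2_le s : expR s - 1 - s <= s ^+ 2 * expR `|s|.
Proof.
have e1 : expR s - 1 <= s * expR s by have := @expR_ge_tangent s 0; rewrite expR0; lra.
have e2 := expR_ge1Dx s; have [s0|s0] := leP 0 s.
  have : s * (s * expR s - (expR s - 1)) >= 0 by apply: mulr_ge0; lra.
  by rewrite ger0_norm// !expr2; nra.
rewrite ltr0_norm//; have e3 : 1 <= expR (- s) by rewrite -expR0 ler_expR; lra.
have : s ^+ 2 * 1 <= s ^+ 2 * expR (- s) by apply: ler_wpM2l => //; exact: sqr_ge0.
by rewrite !expr2; nra.
Qed.

(** Convexity of the exponential between 0 and [ln y]. *)
Lemma powR_le_tangent y s : 0 < y -> 0 <= s <= 1 -> y `^ s <= 1 + s * (y - 1).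
Proof.
move=> y0 /andP[s0 s1]; rewrite /powR gt_eqF//; set L := ln y.
have yL : y = expR L by rewrite lnK.
have := ler_wpM2l s0 (expR_ge_tangent (s * L) L).
have s1' : 0 <= 1 - s by lra.
have := ler_wpM2l s1' (expR_ge_tangent (s * L) 0); rewrite expR0 -yL; nra.
Qed.

(** The defect is the square ((1 - s) x - y)^2 / (1 - s). This is one link of the discrete Hardy
    inequalities: [s] is the fraction of x^2 that is kept, at the price of a slightly larger
    fraction of y^2. *)
Lemma sqr_subM_ge x y s : 0 <= s <= 2^-1 ->
  s * x ^+ 2 - s / (1 - s) * y ^+ 2 <= (x - y) ^+ 2.
Proof.
move=> /andP[s0 s1]; have t0 : 0 < 1 - s by lra.
have -> : (x - y) ^+ 2 =
    s * x ^+ 2 - s / (1 - s) * y ^+ 2 + ((1 - s) * x - y) ^+ 2 / (1 - s).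
  by field; rewrite gt_eqF.
by rewrite lerDl divr_ge0 ?sqr_ge0// ltW.
Qed.

(** With u >= v the square roots, u - v <= u (ln u - ln v), and ln x - ln y is twice ln u - ln v.
    The constant 1 is not optimal, but constants do not matter later. *)
Lemma log_dissipation_ge x y : 0 <= x -> 0 <= y ->
  (((Num.sqrt x - Num.sqrt y) ^+ 2)%:E <= log_dissipation x y)%E.
Proof.
move=> x0 y0; rewrite /log_dissipation.
case: ifPn => [/andP[/eqP-> /eqP->]|_]; first by rewrite subrr expr0n.
case: ifPn => [_|]; first exact: leey.
rewrite negb_or => /andP[xn yn]; rewrite lee_fin.
have {x0 xn} x0 : 0 < x by rewrite lt_neqAle eq_sym xn.
have {y0 yn} y0 : 0 < y by rewrite lt_neqAle eq_sym yn.
wlog xy : x y x0 y0 / y <= x => [hw|].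
  have [/hw|/ltW xy] := leP y x; first exact.
  have := hw _ _ y0 x0 xy; rewrite -sqrrN opprB => /le_trans; apply.
  by rewrite le_eqVlt; apply/orP; left; apply/eqP; ring.
set u := Num.sqrt x; set v := Num.sqrt y.
have u0 : 0 < u by rewrite sqrtr_gt0.
have v0 : 0 < v by rewrite sqrtr_gt0.
have uv : v <= u by exact: ler_wsqrtr.
have -> : x = u ^+ 2 by rewrite sqr_sqrtr// ltW.
have -> : y = v ^+ 2 by rewrite sqr_sqrtr// ltW.
rewrite !lnXn// !mulr2n.
have h : 1 - v / u <= ln u - ln v.
  by have := ln_le_subr1 (divr_gt0 v0 u0); rewrite ln_div ?posrE//; lra.
have {h} h : u - v <= u * (ln u - ln v).
  by have := ler_wpM2l (ltW u0) h; rewrite mulrBr mulr1 mulrCA divff ?gt_eqF// mulr1.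
have l0 : 0 <= ln u - ln v by rewrite subr_ge0 ler_ln.
have h2 := ler_wpM2l (_ : 0 <= u - v) h.
have : 0 <= (u - v) * v * (ln u - ln v) by rewrite !mulr_ge0//; lra.
have /h2 : 0 <= u - v by lra.
by rewrite !expr2; nra.
Qed.

Lemma log_dissipation_ge0 x y : 0 <= x -> 0 <= y -> (0 <= log_dissipation x y)%E.
Proof.
move=> x0 y0; apply: le_trans (log_dissipation_ge x0 y0).
by rewrite lee_fin sqr_ge0.
Qed.

(* Summing [sqr_subM_ge] with [x = v l.+1], [y = v l] and [s = d l.+1]: the decay
   of [k] and the monotonicity of [d] absorb the negative terms. *)
Lemma hardy_decreasing (k d v : nat -> R) (N : nat) :
  (forall l, (1 <= l)%N -> 0 <= k l) -> v 1%N = 0 ->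
  (forall l, 0 <= d l <= 2^-1) -> (forall l, (1 <= l)%N -> d l.+1 <= d l) ->
  (forall l, (1 <= l)%N -> (l < N)%N -> k l.+1 <= k l * (1 - 2 * d l.+1)) ->
  \sum_(1 <= l < N) k l * d l.+1 ^+ 2 * v l.+1 ^+ 2 <=
  \sum_(1 <= l < N) k l * (v l.+1 - v l) ^+ 2.
Proof.
move=> k0 v1 d01 dd; case: N => [|N kk]; first by rewrite !big_geq.
(* The induction keeps the part d - d^2 of the last square that the claim does not use: it pays for
   the negative term of the next application of [sqr_subM_ge]. *)
suff : \sum_(1 <= l < N.+1) k l * d l.+1 ^+ 2 * v l.+1 ^+ 2 +
    k N * (d N.+1 - d N.+1 ^+ 2) * v N.+1 ^+ 2 <=
    \sum_(1 <= l < N.+1) k l * (v l.+1 - v l) ^+ 2 by case: N kk => [|N] kk h;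
  [rewrite !big_geq | apply: le_trans h; rewrite lerDl mulr_ge0 ?sqr_ge0// mulr_ge0 ?k0//;
   have := d01 N.+2; rewrite expr2; nra].
elim: N kk => [|N IH] kk; first by rewrite !big_geq// v1 expr0n/= mulr0 addr0.
have {}IH : _ := IH (fun l l1 lN => kk l l1 (leqW lN)).
rewrite !(@big_nat_recr _ _ _ N.+1)//=.
have := sqr_subM_ge (v N.+2) (v N.+1) (d01 N.+2).
move/(ler_wpM2l (k0 N.+1 isT)) => h.
suff : k N.+1 * (d N.+2 / (1 - d N.+2)) * v N.+1 ^+ 2 <=
    k N * (d N.+1 - d N.+1 ^+ 2) * v N.+1 ^+ 2 by move: IH h; nra.
case: N kk {IH h} => [|N] kk; first by rewrite v1 expr0n/= !mulr0.
apply: ler_wpM2r; first exact: sqr_ge0.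
have /andP[a0 a1] := d01 N.+2; have /andP[b0 b1] := d01 N.+3.
have ab : d N.+3 <= d N.+2 by exact: dd.
have c0 : 0 < 1 - d N.+3 by lra.
have kN := kk N.+1 isT (leqnSn _); have kN0 := k0 N.+1 isT.
have kN10 := k0 N.+2 isT.
apply: (@le_trans _ _ (k N.+2 * (d N.+2 / (1 - d N.+2)))).
  apply: ler_wpM2l => //; rewrite ler_pdivrMr// mulrAC ler_pdivlMr; last lra.
  by nra.
have c1 : 0 < 1 - d N.+2 by lra.
rewrite mulrA ler_pdivrMr//.
apply: (@le_trans _ _ (k N.+1 * (1 - 2 * d N.+2) * d N.+2)); first exact: ler_wpM2r.
rewrite -!mulrA; apply: ler_wpM2l => //; rewrite expr2.
have : 0 <= d N.+2 * d N.+2 * d N.+2 by rewrite !mulr_ge0.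
by nra.
Qed.

(** The negative term that [sqr_subM_ge] produces at l is absorbed by the positive one at l+1,
    because [r] stays below [p] there by the factor 1 - 2 d. Only [d * p N] is left at the far end;
    for states it can be made arbitrarily small, as l n_l tends to 0. *)
Lemma hardy_increasing (p r : nat -> R) (d : R) (m N : nat) :
  (forall l, 0 <= p l) -> (forall l, 0 <= r l) -> 0 <= d <= 2^-1 ->
  (forall l, (m <= l)%N -> r l.+1 <= p l.+1 * (1 - 2 * d)) -> (m <= N)%N ->
  \sum_(m <= l < N) d ^+ 2 * p l <=
  \sum_(m <= l < N) (Num.sqrt (p l) - Num.sqrt (r l.+1)) ^+ 2 + d * p N.
Proof.
move=> p0 r0 d01 rp; have /andP[d0 d1] := d01.
suff h M : \sum_(m <= l < M + m) d ^+ 2 * p l <=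
    \sum_(m <= l < M + m) (Num.sqrt (p l) - Num.sqrt (r l.+1)) ^+ 2 +
    (d - d ^+ 2) * p (M + m)%N.
  move=> mN; have := h (N - m)%N; rewrite subnK// => /le_trans; apply.
  by rewrite lerD2l ler_wpM2r// lerBlDr lerDl sqr_ge0.
elim: M => [|M IH].
  by rewrite add0n !big_geq// add0r mulr_ge0// expr2; nra.
rewrite addSn !big_nat_recr ?leq_addl//=.
have := sqr_subM_ge (Num.sqrt (p (M + m)%N)) (Num.sqrt (r (M + m).+1)) d01.
rewrite !sqr_sqrtr//.
have : d / (1 - d) * r (M + m).+1 <= (d - d ^+ 2) * p (M + m).+1.
  have c0 : 0 < 1 - d by lra.
  rewrite mulrAC ler_pdivrMr//.
  apply: (@le_trans _ _ (d * (p (M + m).+1 * (1 - 2 * d)))).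
    by apply: ler_wpM2l => //; apply: rp; exact: leq_addl.
  have := mulr_ge0 (mulr_ge0 d0 (mulr_ge0 d0 d0)) (p0 (M + m).+1).
  by rewrite !expr2; nra.
by move: IH; nra.
Qed.

End Scalar.

(** * Powers and logarithms of cluster sizes *)

Section Powers.
Context {R : realType}.
Implicit Types (s c C g : R) (l : nat).

Lemma powR_nat_large s C : 0 < s ->
  exists2 L : nat, (0 < L)%N & forall l, (L <= l)%N -> C <= l%:R `^ s.
Proof.
move=> s0; set B : R := Num.max 1 C.
have B0 : 0 < B by rewrite lt_max ltr01.
exists (Num.truncn (B `^ s^-1)).+1 => // l Ll.
apply: (@le_trans _ _ B); first by rewrite le_max lexx orbT.
have -> : B = (B `^ s^-1) `^ s by rewrite -powRrM mulVf ?gt_eqF// powRr1// ltW.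
apply: ge0_ler_powR; rewrite ?nnegrE ?powR_ge0//; first exact: ltW.
have := truncnS_gt (B `^ s^-1) => /ltW/le_trans; apply.
by rewrite ler_nat.
Qed.

Lemma powR_small s c : 0 < s -> 0 < c ->
  exists2 e1 : R, 0 < e1 & forall e, 0 < e < e1 -> e `^ s <= c.
Proof.
move=> s0 c0; exists (c `^ s^-1); first exact: powR_gt0.
move=> e /andP[e0 ee1].
have -> : c = (c `^ s^-1) `^ s by rewrite -powRrM mulVf ?gt_eqF// powRr1// ltW.
by apply: ge0_ler_powR; rewrite ?nnegrE ?powR_ge0// ltW.
Qed.

Lemma powRN_le1 s l : 0 <= s -> (0 < l)%N -> l%:R `^ (- s) <= 1 :> R.
Proof.
move=> s0 l0; rewrite powRN invf_le1 ?powR_gt0 ?ltr0n//.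
by rewrite -[leLHS](powRr0 l%:R) ler_powR ?ler1n.
Qed.

Lemma powRN_nonincreasing s l m : 0 <= s -> (0 < l)%N -> (l <= m)%N ->
  m%:R `^ (- s) <= l%:R `^ (- s) :> R.
Proof.
move=> s0 l0 lm; rewrite !powRN lef_pV2 ?posrE ?powR_gt0 ?ltr0n//.
  by apply: ge0_ler_powR; rewrite ?nnegrE ?ler0n// ler_nat.
exact: leq_trans lm.
Qed.

Lemma ln_le_powR s x : 0 < s -> 0 < x -> ln x <= x `^ s / s.
Proof.
move=> s0 x0; rewrite ler_pdivlMr// mulrC -ln_powR.
by have := ln_le_subr1 (powR_gt0 s x0); lra.
Qed.

Lemma ln_nat_ge0 l : (0 < l)%N -> 0 <= ln (l%:R : R).
Proof. by move=> l0; apply: ln_ge0; rewrite ler1n. Qed.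

Lemma ln_nat_small s c : 0 < s -> 0 < c ->
  exists2 L : nat, (0 < L)%N & forall l, (L <= l)%N -> ln l%:R <= c * l%:R `^ s.
Proof.
move=> s0 c0; have s20 : 0 < s / 2 by lra.
have [L L0 hL] := powR_nat_large (c * (s / 2))^-1 s20.
exists L => // l Ll; have l0 : 0 < l%:R :> R by rewrite ltr0n (leq_trans L0).
apply: le_trans (ln_le_powR s20 l0) _.
have -> : l%:R `^ s = l%:R `^ (s / 2) * l%:R `^ (s / 2) :> R.
  rewrite -powRD; first by congr (_ `^ _); field.
  by apply/implyP => _; rewrite gt_eqF.
have := hL _ Ll; rewrite -(ler_pM2l (mulr_gt0 c0 s20)) divff ?gt_eqF ?mulr_gt0// => h.
have p0 := powR_ge0 (l%:R : R) (s / 2).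
rewrite ler_pdivrMr//.
by have := ler_wpM2r p0 h; lra.
Qed.

Lemma bernoulli_le m (x : R) : 0 <= x <= 1 -> 1 - m%:R * x <= (1 - x) ^+ m.
Proof.
move=> /andP[x0 x1]; elim: m => [|m IH]; first by rewrite expr0; lra.
rewrite exprS; have : (1 - x) * (1 - m%:R * x) <= (1 - x) * (1 - x) ^+ m.
  by apply: ler_wpM2l => //; lra.
apply: le_trans; rewrite -natr1.
by have := mulr_ge0 (ler0n R m) (mulr_ge0 x0 x0); lra.
Qed.

Variable g : R.
Hypothesis g01 : 0 < g < 1.

Lemma natr_powR1B l : (0 < l)%N -> l%:R `^ (1 - g) = l%:R * l%:R `^ (- g) :> R.
Proof.
move=> l0; rewrite powRD; last by rewrite pnatr_eq0 -lt0n l0 implybT.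
by rewrite powRr1.
Qed.

Let powR_divK x y s : 0 <= x -> 0 < y -> (x / y) `^ s * y `^ s = x `^ s.
Proof.
move=> x0 y0; rewrite -powRM; first by rewrite divfK// gt_eqF.
  by apply: divr_ge0 => //; exact: ltW.
exact: ltW.
Qed.

Let succ_div (a b : R) : 0 < a -> 0 < b -> b = a + 1 ->
  a / b - 1 = - b^-1 /\ b / a - 1 = a^-1.
Proof. by move=> a0 b0 ->; split; field; lra. Qed.

(** Concavity of the power, through [powR_le_tangent] at the ratio of l and l+1. Together with
    [powR_increment_le] it lets sums of l^(-g) telescope into l^(1-g). *)
Lemma powR_increment_ge l :
  (1 - g) * l.+1%:R `^ (- g) <= l.+1%:R `^ (1 - g) - l%:R `^ (1 - g) :> R.
Proof.
have /andP[g0 g1] := g01; case: l => [|l].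
  by rewrite powR0 ?gt_eqF ?subr_gt0// !powR1; lra.
have L0 : 0 < l.+2%:R :> R by rewrite ltr0n.
have y0 : 0 < l.+1%:R / l.+2%:R :> R by rewrite divr_gt0 ?ltr0n.
have := @powR_le_tangent R _ (1 - g) y0; have -> : 0 <= 1 - g <= 1 by lra.
move/(_ isT)/(ler_wpM2r (powR_ge0 l.+2%:R (1 - g))); rewrite powR_divK//.
have [-> _] := @succ_div l.+1%:R l.+2%:R ltac:(by rewrite ltr0n) L0 ltac:(by rewrite natr1).
rewrite (@natr_powR1B l.+2)//.
have -> : (1 + (1 - g) * - l.+2%:R^-1) * (l.+2%:R * l.+2%:R `^ (- g)) =
   l.+2%:R * l.+2%:R `^ (- g) - (1 - g) * l.+2%:R `^ (- g).
  by field; rewrite gt_eqF.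
by lra.
Qed.

Lemma powR_increment_le l : (0 < l)%N ->
  l.+1%:R `^ (1 - g) - l%:R `^ (1 - g) <= (1 - g) * l%:R `^ (- g) :> R.
Proof.
have /andP[g0 g1] := g01; move=> l0.
have L0 : 0 < l%:R :> R by rewrite ltr0n.
have y0 : 0 < l.+1%:R / l%:R :> R by rewrite divr_gt0 ?ltr0n.
have := @powR_le_tangent R _ (1 - g) y0; have -> : 0 <= 1 - g <= 1 by lra.
move/(_ isT)/(ler_wpM2r (powR_ge0 l%:R (1 - g))); rewrite powR_divK//.
have [_ ->] := @succ_div l%:R l.+1%:R L0 ltac:(by rewrite ltr0n) ltac:(by rewrite natr1).
rewrite (@natr_powR1B l)//.
have -> : (1 + (1 - g) * l%:R^-1) * (l%:R * l%:R `^ (- g)) =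
   l%:R * l%:R `^ (- g) + (1 - g) * l%:R `^ (- g).
  by field; rewrite gt_eqF.
by lra.
Qed.

(** (l+1)^(-g) is l^(-g) times a power of l/(l+1) with exponent g <= 1, hence at least l^(-g) times
    l/(l+1). The error 1/(l+1) is of lower order than l^(-g). *)
Lemma powRN_decrement_le l : (0 < l)%N ->
  l%:R `^ (- g) - l.+1%:R `^ (- g) <= l.+1%:R^-1 :> R.
Proof.
have /andP[g0 g1] := g01; move=> l0.
have L0 : 0 < l.+1%:R :> R by rewrite ltr0n.
have y0 : 0 < l%:R / l.+1%:R :> R by rewrite divr_gt0 ?ltr0n.
have y1 : l%:R / l.+1%:R <= 1 :> R by rewrite ler_pdivrMr// mul1r ler_nat.
have -> : l.+1%:R `^ (- g) = (l%:R / l.+1%:R) `^ g * l%:R `^ (- g) :> R.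
  by rewrite !powRN -(@powR_divK l%:R l.+1%:R g)// invfM mulrA divff ?mul1r ?gt_eqF ?powR_gt0.
have : l%:R / l.+1%:R <= (l%:R / l.+1%:R) `^ g :> R.
  rewrite -{1}(powRr1 (ltW y0)).
  by apply: ger_powR; [rewrite y0|exact: ltW].
have : l%:R `^ (- g) <= 1 :> R by rewrite powRN_le1// ltW.
have : 0 <= l%:R `^ (- g) :> R by exact: powR_ge0.
have -> : l%:R / l.+1%:R = 1 - l.+1%:R^-1 :> R.
  have [h _] := @succ_div l%:R l.+1%:R ltac:(by rewrite ltr0n) L0 ltac:(by rewrite natr1).
  by rewrite -h; ring.
have : 0 < l.+1%:R^-1 :> R by rewrite invr_gt0.
move: (l.+1%:R^-1) (l%:R `^ (- g)) => i p i0 p0 p1 qi.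
have := mulr_ge0 p0 (_ : 0 <= (1 - i) `^ g - (1 - i)); rewrite subr_ge0 => /(_ qi).
have := mulr_ge0 (_ : 0 <= 1 - p) (ltW i0); rewrite subr_ge0 => /(_ p1).
by lra.
Qed.

End Powers.

(** * Equilibrium weights *)

Section Weights.
Context {R : realType}.
Variables alpha gamma zs q : R.
Hypotheses (halpha : 0 <= alpha < 1) (hgamma : 0 < gamma < 1).
Hypotheses (hzs : 0 < zs) (hq : 0 < q).
Implicit Types (z c y : R) (l m N : nat).

Let gt0 : 0 < gamma. Proof. by case/andP: hgamma. Qed.
Let glt1 : gamma < 1. Proof. by case/andP: hgamma. Qed.
Let alpha_ge0 : 0 <= alpha. Proof. by case/andP: halpha. Qed.

Local Notation omega := (omega alpha gamma zs q).
Local Notation beta l := (zs + q * l%:R `^ (- gamma)).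
Local Notation weight z l := (l%:R `^ alpha * omega z l).

Lemma beta_gt0 l : 0 < beta l.
Proof. by rewrite ltr_pwDl// mulr_ge0 ?powR_ge0// ltW. Qed.

Lemma beta_le l : (0 < l)%N -> beta l <= zs + q.
Proof.
by move=> l0; have := powRN_le1 (ltW gt0) l0 : _ <= (1 : R); have := hq; nra.
Qed.

Lemma rate_a_gt0 l : (0 < l)%N -> 0 < rate_a alpha l.
Proof. by move=> l0; rewrite powR_gt0// ltr0n. Qed.

Lemma rate_a_ge1 l : (0 < l)%N -> 1 <= rate_a alpha l.
Proof.
move=> l0; rewrite /rate_a -[leLHS](powRr0 l%:R).
by rewrite ler_powR ?ler1n.
Qed.

Lemma rate_b_gt0 l : (0 < l)%N -> 0 < rate_b alpha gamma zs q l.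
Proof. by move=> l0; rewrite mulr_gt0 ?beta_gt0// powR_gt0 ?ltr0n. Qed.

Lemma omega1 z : omega z 1 = z.
Proof. by rewrite /Defs.omega /Q big_geq// mulr1. Qed.

Lemma weight1 z : weight z 1 = z.
Proof. by rewrite powR1 mul1r omega1. Qed.

Lemma omega_gt0 z l : 0 < z -> (0 < l)%N -> 0 < omega z l.
Proof.
move=> z0 l0; rewrite mulr_gt0 ?exprn_gt0// /Q big_nat prodr_gt0// => j /andP[j0 _].
by rewrite divr_gt0 ?rate_a_gt0 ?rate_b_gt0.
Qed.

Lemma weight_gt0 z l : 0 < z -> (0 < l)%N -> 0 < weight z l.
Proof. by move=> z0 l0; rewrite mulr_gt0 ?omega_gt0 ?rate_a_gt0. Qed.

Lemma weightS z l : (0 < l)%N -> weight z l.+1 * beta l.+1 = weight z l * z.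
Proof.
move=> l0; have := rate_b_gt0 (ltn0Sn l); rewrite /Defs.omega /Q big_nat_recr//= exprS.
rewrite /rate_b /rate_a => b0.
have [u v] : l.+1%:R `^ alpha != 0 /\ beta l.+1 != 0.
  by split; rewrite gt_eqF ?beta_gt0// powR_gt0 ?ltr0n.
by field; rewrite u v.
Qed.

Lemma omega_le_weight z l : 0 < z -> (0 < l)%N -> omega z l <= weight z l.
Proof.
by move=> z0 l0; rewrite ler_peMl ?rate_a_ge1// ltW// omega_gt0.
Qed.

Lemma omega_zexp s z l : omega (z * expR s) l = omega z l * expR (s * l%:R).
Proof. by rewrite /Defs.omega exprMn -expRM_natr; ring. Qed.

(* [1 - gap * l^-gamma] bounds the ratio of consecutive weights as long as [z]
   exceeds [zs] by at most half of [q l^-gamma]. *)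
Definition gap : R := q / 2 / (zs + q).

Lemma gap_gt0 : 0 < gap.
Proof. by rewrite !divr_gt0// addr_gt0. Qed.

Lemma gap_le : gap <= 2^-1.
Proof. by rewrite ler_pdivrMr ?addr_gt0//; have := hzs; lra. Qed.

(** By [weightS] the ratio is z / (zs + q (l+1)^(-gamma)). Since l < N, the excess of z over zs uses
    up at most half of q (l+1)^(-gamma). *)
Lemma weight_ratio z l N : 0 < z -> (0 < l)%N -> (l < N)%N ->
  z <= zs + q / 2 * N%:R `^ (- gamma) ->
  weight z l.+1 <= weight z l * (1 - gap * l.+1%:R `^ (- gamma)).
Proof.
move=> z0 l0 lN zN; rewrite -(ler_pM2r (beta_gt0 l.+1)) weightS// -(mulrA (weight z l)).
rewrite ler_pM2l ?weight_gt0//; apply: (le_trans zN).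
have h1 : N%:R `^ (- gamma) <= l.+1%:R `^ (- gamma) :> R.
  by rewrite powRN_nonincreasing// ltW.
have h2 : gap * beta l.+1 <= q / 2.
  apply: le_trans (ler_wpM2l (ltW gap_gt0) (beta_le (ltn0Sn l))) _.
  by rewrite /gap divfK// gt_eqF// addr_gt0.
move: (powR_ge0 (l.+1%:R : R) (- gamma)) h1 h2; set p := _ `^ _ => p0 h1 h2.
have := ler_wpM2r p0 h2.
have : q / 2 * N%:R `^ (- gamma) <= q / 2 * p by rewrite ler_wpM2l// divr_ge0// ltW.
by lra.
Qed.

Lemma weight_ratio_const z l : 0 < z -> z <= zs -> (0 < l)%N ->
  weight z l.+1 <= weight z l * (1 - (zs - z) / (zs + q)).
Proof.
move=> z0 zzs l0; rewrite -(ler_pM2r (beta_gt0 l.+1)) weightS// -(mulrA (weight z l)).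
rewrite ler_pM2l ?weight_gt0//.
have h2 : (zs - z) / (zs + q) * beta l.+1 <= zs - z.
  rewrite mulrAC ler_pdivrMr ?addr_gt0//; apply: ler_wpM2l; first lra.
  exact: beta_le.
have : 0 <= q * l.+1%:R `^ (- gamma) by rewrite mulr_ge0 ?powR_ge0 ?ltW.
by move: h2; lra.
Qed.

(** From one size to the next l^m gains a factor 1 + O(m/l) and the weight loses a factor 1 - gap
    l^(-gamma), which wins once l^(1-gamma) >= m / gap. The constant is uniform in z and N: z may
    exceed zs a little as long as only sizes up to N matter. *)
Lemma weight_decay m : exists2 C : R, 0 < C & forall N z, 0 < z ->
  z <= zs + q / 2 * N%:R `^ (- gamma) ->
  forall l, (0 < l <= N)%N -> l%:R ^+ m * weight z l <= C.
Proof.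
have [L L0 hL] := @powR_nat_large R (1 - gamma) (m%:R / gap) ltac:(by rewrite subr_gt0).
exists ((zs + q) * L%:R ^+ m) => [|N z z0 zN l lN].
  by rewrite mulr_gt0 ?addr_gt0// exprn_gt0 ?ltr0n.
(* The bound of the weight itself by zs + q handles the sizes up to L, before the product starts to
   decrease. *)
suff : l%:R ^+ m * weight z l <= (zs + q) * L%:R ^+ m /\ weight z l <= zs + q by case.
elim: l lN => [//|l IH] /andP[_ lN]; case: l => [|l] in IH lN *.
  rewrite weight1 expr1n mul1r.
  have zq : z <= zs + q.
    apply: le_trans zN _; have N0 : (0 < N)%N by [].
    by have := powRN_le1 (ltW gt0) N0 : _ <= (1 : R); have := hq; nra.
  split => //; apply: le_trans zq _; apply: ler_peMr; first by rewrite addr_ge0 ?ltW.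
  by rewrite exprn_ege1// ler1n.
have [IH1 IH2] := IH (ltnW lN).
have r := weight_ratio z0 (ltn0Sn l) lN zN.
have w0 := weight_gt0 z0 (ltn0Sn l).
have g0 : 0 <= gap * l.+2%:R `^ (- gamma) by rewrite mulr_ge0 ?powR_ge0// ltW// gap_gt0.
have wle : weight z l.+2 <= zs + q.
  by apply: le_trans r (le_trans _ IH2); apply: ler_piMr; [exact: ltW|rewrite lerBlDr lerDl].
split => //; have [lL|lL] := leqP l.+2 L.
  rewrite mulrC; apply: ler_pM => //.
  - by rewrite ltW// weight_gt0.
  - by rewrite lerXn2r ?nnegrE ?ler0n// ler_nat.
apply: le_trans IH1.
have l20 : 0 < l.+2%:R :> R by rewrite ltr0n.
have hm : m%:R / l.+2%:R <= gap * l.+2%:R `^ (- gamma).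
  have := hL _ (ltnW lL); rewrite natr_powR1B// ler_pdivrMr ?gap_gt0// ler_pdivrMr//.
  by lra.
have x01 : 0 <= (l.+2%:R : R)^-1 <= 1 by rewrite invr_ge0 ler0n invf_le1// ler1n.
have e1 : l.+1%:R = l.+2%:R * (1 - l.+2%:R^-1) :> R.
  by rewrite mulrBr divff ?gt_eqF// mulr1 -(natr1 l.+1) addrK.
have -> : l.+1%:R ^+ m = l.+2%:R ^+ m * (1 - l.+2%:R^-1) ^+ m :> R.
  by rewrite -exprMn -e1.
rewrite -[leRHS]mulrA; apply: ler_wpM2l; first exact: exprn_ge0.
apply: le_trans r _; rewrite mulrC; apply: ler_wpM2r; first exact: ltW.
by apply: le_trans (bernoulli_le m x01); rewrite lerD2l lerN2.
Qed.

Lemma omega_decay m : exists2 C : R, 0 < C & forall N z, 0 < z ->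
  z <= zs + q / 2 * N%:R `^ (- gamma) ->
  forall l, (0 < l <= N)%N -> omega z l <= C / l%:R ^+ m.
Proof.
have [C C0 hC] := weight_decay m; exists C => // N z z0 zN l lN.
have /andP[l0 _] := lN; rewrite ler_pdivlMr ?exprn_gt0 ?ltr0n// mulrC.
apply: le_trans (hC _ _ z0 zN _ lN); rewrite ler_wpM2l ?exprn_ge0//.
exact: omega_le_weight.
Qed.

Lemma omega_zs_decay m : exists2 C : R, 0 < C & forall l, (0 < l)%N ->
  omega zs l <= C / l%:R ^+ m.
Proof.
have [C C0 hC] := omega_decay m; exists C => // l l0.
apply: (hC l) => //; last by rewrite l0 leqnn.
by rewrite lerDl mulr_ge0 ?powR_ge0// divr_ge0 ?ltW.
Qed.

(** Each factor of the weight has -ln at most a constant times l^(-gamma), because z is at least zs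
    - N^(-gamma), and these bounds telescope into l^(1-gamma). The summand 1/(1-gamma) of the
    constant pays for the factor l^alpha. *)
Lemma ln_omega_ge : exists2 C : R, 0 < C & forall N z, zs / 2 <= z ->
  zs - N%:R `^ (- gamma) <= z ->
  forall l, (0 < l <= N)%N -> - ln (omega z l) <= C * l%:R `^ (1 - gamma).
Proof.
have g1 : 0 < 1 - gamma by rewrite subr_gt0.
set C1 := Num.max (- ln (zs / 2)) (2 / zs * (q + 1) / (1 - gamma)).
exists (C1 + (1 - gamma)^-1) => [|N z zz zN l /andP[l0 lN]].
  rewrite addr_gt0 ?invr_gt0// lt_max; apply/orP; right.
  by rewrite divr_gt0// mulr_gt0 ?divr_gt0// addr_gt0.
have z0 : 0 < z by apply: lt_le_trans zz; rewrite divr_gt0.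
suff h : - ln (weight z l) <= C1 * l%:R `^ (1 - gamma).
  move: h; rewrite lnM ?posrE ?omega_gt0 ?rate_a_gt0// ln_powR.
  have l0R : 0 < l%:R :> R by rewrite ltr0n.
  have := ln_le_powR g1 l0R; have := @ln_nat_ge0 R _ l0.
  have /andP[_ a1] := halpha.
  move=> n0 n1 h; have : alpha * ln l%:R <= ln l%:R by rewrite ler_piMl// ltW.
  by rewrite mulrDl [_^-1 * _]mulrC; lra.
elim: l l0 lN => [//|l IH] _ lN; case: l => [|l] in IH lN *.
  rewrite weight1 powR1 mulr1 le_max; apply/orP; left.
  by rewrite lerN2 ler_ln ?posrE// divr_gt0.
have {}IH := IH isT (ltnW lN).
have b0 := beta_gt0 l.+2; have w0 := weight_gt0 z0 (ltn0Sn l).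
have -> : weight z l.+2 = weight z l.+1 * (z / beta l.+2).
  by rewrite mulrA -weightS// mulfK// gt_eqF.
rewrite lnM ?posrE ?divr_gt0// opprD.
have h1 : - ln (z / beta l.+2) <= 2 / zs * (q + 1) * l.+2%:R `^ (- gamma).
  rewrite -lnV ?posrE ?divr_gt0// invf_div.
  apply: le_trans (ln_le_subr1 (divr_gt0 b0 z0)) _.
  have NN : N%:R `^ (- gamma) <= l.+2%:R `^ (- gamma) :> R.
    by rewrite powRN_nonincreasing// ltW.
  set p := l.+2%:R `^ _ in NN *; have p0 : 0 <= p by exact: powR_ge0.
  have c0 : 0 <= 2 / zs * (q + 1) * p.
    by nneg.
  have c1 : zs / 2 * (2 / zs * (q + 1) * p) = (q + 1) * p by field; rewrite gt_eqF.
  have := ler_wpM2r c0 zz; rewrite c1 => h.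
  by rewrite lerBlDr ler_pdivrMr// mulrDl mul1r [_ * z]mulrC; lra.
have := @powR_increment_ge R _ hgamma l.+1.
move/(ler_wpM2l (_ : 0 <= 2 / zs * (q + 1) / (1 - gamma))) => h2.
have {}h2 : 2 / zs * (q + 1) * l.+2%:R `^ (- gamma) <=
   C1 * (l.+2%:R `^ (1 - gamma) - l.+1%:R `^ (1 - gamma)).
  apply: le_trans (_ : _ <= 2 / zs * (q + 1) / (1 - gamma) *
     (l.+2%:R `^ (1 - gamma) - l.+1%:R `^ (1 - gamma))) _.
    apply: le_trans (h2 _).
      by rewrite le_eqVlt; apply/orP; left; apply/eqP; field; rewrite !gt_eqF.
    by nneg.
  apply: ler_wpM2r; last by rewrite le_max lexx orbT.
  apply: le_trans (@powR_increment_ge R _ hgamma l.+1).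
  by rewrite mulr_ge0 ?powR_ge0 ?ltW.
by move: IH h1 h2; rewrite mulrBr; lra.
Qed.

End Weights.

(** * Asymptotics of the weights and of the energy of large clusters *)

Section Asymptotics.
Context {R : realType}.
Variables alpha gamma zs q : R.
Hypotheses (halpha : 0 <= alpha < 1) (hgamma : 0 < gamma < 1).
Hypotheses (hzs : 0 < zs) (hq : 0 < q).
Implicit Types (z c y eta : R) (l m N : nat).

Let gt0 : 0 < gamma. Proof. by case/andP: hgamma. Qed.
Let glt1 : gamma < 1. Proof. by case/andP: hgamma. Qed.
Let g1 : 0 < 1 - gamma. Proof. by rewrite subr_gt0. Qed.

Local Notation omega := (omega alpha gamma zs q).
Local Notation beta l := (zs + q * l%:R `^ (- gamma)).
Local Notation weight z l := (l%:R `^ alpha * omega z l).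
Local Notation kappa := (q / (zs * (1 - gamma))).

Let kappa_gt0 : 0 < kappa. Proof. by rewrite divr_gt0// mulr_gt0. Qed.

Let ln_weightS l : (0 < l)%N ->
  - ln (weight zs l.+1) = - ln (weight zs l) + ln (1 + q / zs * l.+1%:R `^ (- gamma)).
Proof.
move=> l0; have b0 := @beta_gt0 R gamma _ _ hzs hq l.+1.
have w0 := @weight_gt0 R alpha gamma _ _ hzs hq _ _ hzs l0.
have -> : weight zs l.+1 = weight zs l / (beta l.+1 / zs).
  apply: (mulIf (lt0r_neq0 b0)); rewrite weightS//.
  by rewrite invf_div -(mulrA (weight zs l)) divfK// gt_eqF.
rewrite ln_div ?posrE// ?divr_gt0// opprB addrC; congr (_ + ln _).
by rewrite mulrDl divff ?gt_eqF// mulrAC.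
Qed.

(** -ln of the weight is -ln zs plus the sum of ln(1 + r j^(-gamma)) with r = q / zs, and kappa
    l^(1-gamma) is the integral of r y^(-gamma). Upper bound: ln(1 + y) <= y. Lower bound: the
    quadratic error of the logarithm and the error of the sum are both o(j^(-gamma)). *)
Lemma ln_weight_asymptotics eta : 0 < eta -> exists2 L : nat, (0 < L)%N &
  forall l, (L <= l)%N ->
    `|- ln (weight zs l) - kappa * l%:R `^ (1 - gamma)| <= eta * l%:R `^ (1 - gamma).
Proof.
move=> eta0; pose r := q / zs; have r0 : 0 < r by rewrite divr_gt0.
have kr : kappa * (1 - gamma) = r by rewrite /r; field; rewrite !gt_eqF.
move: (kappa) kappa_gt0 kr => ka ka0 kr.
have up l : (0 < l)%N ->
    - ln (weight zs l) <= - ln zs + ka * l%:R `^ (1 - gamma).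
  elim: l => [//|[|l] IH _].
    by rewrite weight1 powR1 mulr1; move: ka0; lra.
  rewrite ln_weightS//; have {}IH := IH isT.
  have h1 : ln (1 + r * l.+2%:R `^ (- gamma)) <= r * l.+2%:R `^ (- gamma).
    by apply: le_ln1Dx; apply: lt_le_trans (_ : 0 <= _); [lra|nneg].
  have := ler_wpM2l (ltW ka0) (@powR_increment_ge R _ hgamma l.+1).
  by rewrite mulrA kr mulrBr; move: IH h1; rewrite /r; lra.
(* [C] dominates both errors, r/j and r^2 j^(-2 gamma). As 2 e2 = (eta/2) (1 - gamma), two errors of
   size e2 j^(-gamma) fit into one increment of (eta/2) l^(1-gamma). *)
pose C := r + r ^+ 2; have C0 : 0 < C by rewrite addr_gt0// exprn_gt0.
pose e2 := eta / 2 * (1 - gamma) / 2.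
have e20 : 0 < e2 by rewrite /e2 !(mulr_gt0, divr_gt0).
have [L1 L10 hL1] := powR_nat_large (C / e2) gt0.
have [L2 L20 hL2] := powR_nat_large (C / e2) g1.
pose L := maxn L1 L2; have L0 : (0 < L)%N by rewrite leq_max L10.
(* The discrepancy at the starting size L; the other half of [eta] absorbs it for large l. *)
pose B := Num.max 0 (ka * L%:R `^ (1 - gamma) + ln (weight zs L)).
have lo l : (L <= l)%N ->
    ka * l%:R `^ (1 - gamma) + ln (weight zs l) <= B + eta / 2 * l%:R `^ (1 - gamma).
  move=> Ll; rewrite -(subnK Ll); elim: (l - L)%N => [|k IH].
    rewrite add0n ler_wpDr//; first by nneg; apply: divr_ge0; nneg.
    by rewrite le_max lexx orbT.
  rewrite addSn; set j := (k + L)%N in IH *.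
  have j0 : (0 < j)%N by rewrite /j addn_gt0 L0 orbT.
  have := ln_weightS j0; rewrite -/r; set p := j.+1%:R `^ (- gamma).
  have p0 : 0 < p by rewrite powR_gt0.
  have rp0 : 0 < r * p by rewrite mulr_gt0.
  have h1 : r * p - (r * p) ^+ 2 <= ln (1 + r * p).
    have y0 : 0 < 1 + r * p by lra.
    have := ln_le_subr1 (_ : 0 < (1 + r * p)^-1); rewrite invr_gt0 => /(_ y0).
    rewrite lnV ?posrE// => h; apply: le_trans (_ : 1 - (1 + r * p)^-1 <= _); last lra.
    have -> : 1 - (1 + r * p)^-1 = r * p / (1 + r * p) by field; rewrite gt_eqF.
    by rewrite ler_pdivlMr//; rewrite expr2; have := mulr_ge0 (mulr_ge0 (ltW rp0) (ltW rp0)) (ltW rp0); lra.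
  have h2 := ler_wpM2l (ltW ka0) (@powR_increment_le R _ hgamma _ j0).
  have h3 := ler_wpM2l (ltW r0) (@powRN_decrement_le R _ hgamma _ j0).
  have h4 := ler_wpM2l (ltW (divr_gt0 eta0 (ltr0Sn R 1))) (@powR_increment_ge R _ hgamma j).
  have j1 : (L1 <= j.+1)%N by apply: leqW; rewrite /j (leq_trans _ (leq_addl _ _))// leq_maxl.
  have j2 : (L2 <= j.+1)%N by apply: leqW; rewrite /j (leq_trans _ (leq_addl _ _))// leq_maxr.
  have h5 : C * p <= e2.
    have := hL1 _ j1; rewrite ler_pdivrMr// /p powRN => h.
    by rewrite ler_pdivrMr ?powR_gt0// mulrC.
  have h6 : C * j.+1%:R^-1 <= e2 * p.
    have J0 : 0 < j.+1%:R :> R by rewrite ltr0n.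
    by have := hL2 _ j2; rewrite natr_powR1B// ler_pdivrMr// -/p ler_pdivrMr//; lra.
  have h7 : C * p * p <= e2 * p by rewrite ler_wpM2r// ltW.
  move: IH h2 h3 h4 h6 h7; rewrite -/p !mulrBr [ka * (_ * _)]mulrA kr.
  move: (j.+1%:R^-1) (invr_ge0 (j.+1%:R : R)); rewrite ler0n => i i0.
  rewrite /C expr2 in h1 *; move: i0 => i0.
  have e2E : 2 * e2 = eta / 2 * (1 - gamma) by rewrite /e2; field.
  have e2Ep : 2 * (e2 * p) = eta / 2 * ((1 - gamma) * p) by rewrite mulrA e2E mulrA.
  have i1 : 0 <= r ^+ 2 * i by nneg; rewrite i0.
  have i2 : 0 <= r * (p * p) by nneg.
  by rewrite expr2 in i1 *; move: i1 i2 h1 e2Ep; lra.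
have e0 : 0 < eta / 2 by rewrite divr_gt0.
have [L3 L30 hL3] := powR_nat_large (B / (eta / 2)) g1.
have [L4 L40 hL4] := powR_nat_large (- ln zs / (eta / 2)) g1.
exists (maxn L (maxn L3 L4)) => [|l]; first by rewrite leq_max L0.
rewrite geq_max => /andP[lL]; rewrite geq_max => /andP[lL3 lL4].
have := lo _ lL; have := up _ (leq_trans L0 lL).
have := hL3 _ lL3; have := hL4 _ lL4; rewrite !ler_pdivrMr// ler_norml.
have := powR_ge0 (l%:R : R) (1 - gamma).
have ep : 0 <= eta / 2 * l%:R `^ (1 - gamma) by nneg; exact: ltW.
by move: ep; move: (l%:R `^ (1 - gamma)) => p; lra.
Qed.

Lemma ln_omega_asymptotics eta : 0 < eta -> exists2 L : nat, (0 < L)%N &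
  forall l, (L <= l)%N ->
    `|- ln (omega zs l) - kappa * l%:R `^ (1 - gamma)| <= eta * l%:R `^ (1 - gamma).
Proof.
move=> eta0; have e0 : 0 < eta / 2 by rewrite divr_gt0.
have [L1 L10 hL1] := ln_weight_asymptotics e0.
have [L2 L20 hL2] := ln_nat_small g1 e0.
exists (maxn L1 L2) => [|l]; first by rewrite leq_max L10.
rewrite geq_max => /andP[l1 l2]; have l0 := leq_trans L10 l1.
have := hL1 _ l1; have := hL2 _ l2.
rewrite lnM ?posrE ?powR_gt0 ?omega_gt0 ?ltr0n// ln_powR.
have /andP[a0 a1] := halpha; have n0 := @ln_nat_ge0 R _ l0.
have : alpha * ln l%:R <= ln l%:R by rewrite ler_piMl// ltW.
have : 0 <= alpha * ln l%:R by exact: mulr_ge0.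
by rewrite !ler_norml; lra.
Qed.

Lemma energyE l y : (0 < l)%N ->
  omega zs l * psi (y / omega zs l) =
  y * (ln (y / omega zs l) - 1) + omega zs l.
Proof.
by move=> l0; rewrite /psi; field; rewrite gt_eqF// omega_gt0.
Qed.

(** Up to y ln y, y and omega_l, the energy is -y ln omega_l, which behaves like kappa l^(1-gamma)
    y. The additive remainder is there because y ln y is not small relative to y when y is tiny; any
    power of l can be had for it. *)
Lemma energy_asymptotics rho0 m eta : 0 < eta ->
  exists C : R, exists2 L : nat, (0 < L)%N & forall l y, (L <= l)%N -> 0 <= y <= rho0 ->
    `|omega zs l * psi (y / omega zs l) - kappa * l%:R `^ (1 - gamma) * y| <=
    eta * l%:R `^ (1 - gamma) * y + C / l%:R ^+ m.
Proof.
move=> eta0; have e0 : 0 < eta / 3 by rewrite divr_gt0.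
have [C C0 hC] := @omega_zs_decay R alpha gamma zs q halpha hgamma hzs hq m.
have [L1 L10 hL1] := ln_omega_asymptotics e0.
have m1 : 0 < eta / 3 / (2 * m%:R + 1).
  by rewrite divr_gt0//; have := ler0n R m; lra.
have [L2 L20 hL2] := ln_nat_small g1 m1.
have [L3 L30 hL3] := powR_nat_large (1 / (eta / 3)) g1.
have [L4 L40 hL4] := powR_nat_large (ln rho0 / (eta / 3)) g1.
exists (C + 2), (maxn (maxn L1 L2) (maxn L3 L4)) => [|l y].
  by rewrite !leq_max L10.
rewrite !geq_max => /andP[/andP[l1 l2] /andP[l3 l4]] /andP[y0 yrho].
have l0 := leq_trans L10 l1; have l0R : 0 < l%:R :> R by rewrite ltr0n.
have w0 := @omega_gt0 R alpha gamma _ _ hzs hq _ _ hzs l0.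
have wC := hC _ l0; rewrite energyE//.
have lm0 : 0 < (l%:R : R) ^+ m by rewrite exprn_gt0.
have lmi0 : 0 < ((l%:R : R) ^+ m)^-1 by rewrite invr_gt0.
set P := l%:R `^ (1 - gamma); have P0 : 0 <= P by exact: powR_ge0.
rewrite mulrDl; move: y0; rewrite le_eqVlt => /predU1P[<-|y0].
  rewrite !mulr0 mul0r !add0r subr0 gtr0_norm//.
  have : 0 < 2 / (l%:R : R) ^+ m by rewrite divr_gt0.
  by move: wC; move: (_ / _) => a; move: (_ / _) => b; lra.
have lnyw : ln (y / omega zs l) = ln y - ln (omega zs l) by rewrite ln_div ?posrE.
(* Three regimes: for y >= 1, ln y is at most ln rho0; for l^(-2m) <= y < 1, |ln y| is at most 2 m
   ln l; below l^(-2m), with v = sqrt y, v |ln v| <= 1 gives |y ln y| <= 2 v <= 2 l^(-m). *)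
have hy : `|y * ln y| <= eta / 3 * P * y + 2 / l%:R ^+ m.
  have r2 : 0 <= 2 / (l%:R : R) ^+ m by nneg.
  have [y1|y1] := leP 1 y.
    have lny0 : 0 <= ln y by exact: ln_ge0.
    rewrite ger0_norm; last by rewrite mulr_ge0// ltW.
    rewrite mulrC.
    have := hL4 _ l4; rewrite ler_pdivrMr// => h.
    have lny : ln y <= ln rho0 by rewrite ler_ln ?posrE//; lra.
    apply: ler_wpDr => //; apply: ler_wpM2r; first exact: ltW.
    by move: h lny; rewrite -/P; lra.
  have lny0 : ln y < 0 by apply: ln_lt0; rewrite y0.
  rewrite normrM gtr0_norm// ltr0_norm//.
  have [ym|ym] := leP (((l%:R : R) ^+ (2 * m))^-1) y.
    apply: ler_wpDr => //; rewrite mulrC; apply: ler_wpM2r; first exact: ltW.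
    have : - ln y <= ln ((l%:R : R) ^+ (2 * m)).
      have lx : 0 < (l%:R : R) ^+ (2 * m) by rewrite exprn_gt0.
      rewrite -lnV ?posrE// ler_ln ?posrE ?invr_gt0//.
      by rewrite -[leRHS]invrK lef_pV2 ?posrE ?invr_gt0.
    rewrite lnXn// -[ln _ *+ _]mulr_natl natrM => /le_trans; apply.
    have := hL2 _ l2; have n0 := @ln_nat_ge0 R _ l0.
    have mm : 0 < 2 * m%:R + 1 :> R by have := ler0n R m; lra.
    rewrite -/P mulrAC ler_pdivlMr// => h.
    by apply: le_trans h; rewrite [leRHS]mulrC ler_wpM2r//; lra.
  apply: ler_wpDl; first by nneg; exact: ltW.
  set v := Num.sqrt y; have v0 : 0 < v by rewrite sqrtr_gt0.
  have yv : y = v ^+ 2 by rewrite sqr_sqrtr// ltW.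
  have vm : v <= ((l%:R : R) ^+ m)^-1.
    have -> : ((l%:R : R) ^+ m)^-1 = Num.sqrt (((l%:R : R) ^+ (2 * m))^-1).
      by rewrite mulnC exprM -[X in Num.sqrt X]exprVn sqrtr_sqr ger0_norm// ltW.
    by apply: ler_wsqrtr; exact: ltW.
  have := ln_le_subr1 (_ : 0 < v^-1); rewrite invr_gt0 lnV ?posrE// => /(_ v0) h.
  have {}h : v * - ln v <= 1.
    have := ler_wpM2l (ltW v0) h; rewrite mulrBr divff ?gt_eqF// mulr1; lra.
  rewrite yv lnXn// mulr2n expr2.
  have := ler_wpM2l (ltW v0) h.
  by move: vm; move: (_ ^-1) => i; lra.
have hw : y * `|- ln (omega zs l) - kappa * P| <= y * (eta / 3 * P).
  by apply: ler_wpM2l (hL1 _ l1); exact: ltW.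
have h1 : y <= eta / 3 * P * y.
  have := hL3 _ l3; rewrite ler_pdivrMr// -/P => h.
  by have := ler_wpM2r (ltW y0) h; lra.
rewrite lnyw.
have -> : y * (ln y - ln (omega zs l) - 1) + omega zs l - kappa * P * y =
  y * ln y + y * (- ln (omega zs l) - kappa * P) - y + omega zs l by ring.
rewrite -(ger0_norm (ltW y0)) -normrM (ger0_norm (ltW y0)) in hw.
move: hy hw; rewrite !ler_norml; move: wC lmi0.
move: ((_ ^+ m)^-1) => i wC i0 hy hw; move: w0 h1 wC i0 hy hw.
by move: (omega zs l) => w0; lra.
Qed.

End Asymptotics.

(** * States and the critical size *)

Section Sums.
Context {R : realType}.
Implicit Types (l m N : nat).

(** Telescoping, from 1/j^2 <= 2/j - 2/(j+1). *)
Lemma sum_inv_sqr_le a b : (0 < a)%N ->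
  \sum_(a <= l < b) ((l%:R : R) ^+ 2)^-1 <= 2 / a%:R.
Proof.
move=> a0; have [ab|ba] := leqP a b; last first.
  by rewrite (big_geq (ltnW ba)); apply: divr_ge0.
suff : \sum_(a <= l < b) ((l%:R : R) ^+ 2)^-1 <= 2 / a%:R - 2 / b%:R.
  by move/le_trans; apply; rewrite lerBlDr lerDl; apply: divr_ge0.
rewrite -(subnK ab); elim: (b - a)%N => [|k IH]; first by rewrite add0n big_geq// subrr.
rewrite addSn big_nat_recr ?leq_addl//=.
set j := (k + a)%N in IH *; have j0 : 0 < j%:R :> R by rewrite ltr0n /j addn_gt0 a0 orbT.
have : ((j%:R : R) ^+ 2)^-1 <= 2 / j%:R - 2 / j.+1%:R.
  rewrite -(natr1 j); have j1 : 1 <= j%:R :> R by rewrite ler1n -(ltr0n R).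
  have -> : 2 / j%:R - 2 / (j%:R + 1) = 2 / (j%:R * (j%:R + 1)) :> R by field; lra.
  move: (j%:R) j0 j1 => y y0 y1.
  have -> : (y ^+ 2)^-1 = 2 / (2 * y ^+ 2) by field; rewrite gt_eqF.
  apply: ler_wpM2l => //; rewrite lef_pV2 ?posrE ?mulr_gt0 ?exprn_gt0//; last lra.
  by rewrite expr2; have := ler_wpM2l (ltW y0) y1; lra.
by move: IH; move: (2 / j%:R) (2 / j.+1%:R) => u v; lra.
Qed.

Lemma sum_nat_nonneg_le (f : nat -> R) a b c : (forall l, (a <= l)%N -> 0 <= f l) ->
  (b <= c)%N -> \sum_(a <= l < b) f l <= \sum_(a <= l < c) f l.
Proof.
move=> f0 bc; have [ab|ba] := leqP a b; last first.
  rewrite (big_geq (ltnW ba)) big_nat; apply: sumr_ge0 => i /andP[ai _]; exact: f0.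
rewrite (big_cat_nat ab bc)//= lerDl big_nat; apply: sumr_ge0 => i /andP[bi _].
by apply: f0; exact: leq_trans bi.
Qed.

Lemma sum_nat_nonneg_ge (f : nat -> R) a b c : (forall l, (a <= l)%N -> 0 <= f l) ->
  (a <= b)%N -> \sum_(b <= l < c) f l <= \sum_(a <= l < c) f l.
Proof.
move=> f0 ab; have [bc|cb] := leqP b c; last first.
  rewrite (big_geq (ltnW cb)) big_nat; apply: sumr_ge0 => i /andP[ai _]; exact: f0.
rewrite (big_cat_nat ab bc)//= lerDr big_nat; apply: sumr_ge0 => i /andP[bi _].
exact: f0.
Qed.

Lemma nneseries_partial_le (f : nat -> \bar R) a N (c : \bar R) :
  (forall l, (a <= l)%N -> (0 <= f l)%E) ->
  (\sum_(a <= l <oo) f l <= c)%E -> (\sum_(a <= l < N) f l <= c)%E.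
Proof.
by move=> f0; apply: le_trans; apply: nneseries_lim_ge => l al _; exact: f0.
Qed.

Lemma nneseriesr_partial_le (f : nat -> R) a N (c : R) :
  (forall l, (a <= l)%N -> 0 <= f l) ->
  (\sum_(a <= l <oo) (f l)%:E <= c%:E)%E -> \sum_(a <= l < N) f l <= c.
Proof.
move=> f0 /(@nneseries_partial_le _ _ N) h.
by rewrite -lee_fin -sumEFin; apply: h => l al; rewrite lee_fin f0.
Qed.

Lemma states_ge0 rho0 (n : nat -> R) l : states rho0 n -> (0 < l)%N -> 0 <= n l.
Proof. by case=> + _; apply. Qed.

Lemma states_mass_ge0 rho0 (n : nat -> R) : states rho0 n ->
  forall l, (1 <= l)%N -> 0 <= l%:R * n l.
Proof. by move=> hn l l0; rewrite mulr_ge0// (states_ge0 hn). Qed.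

Lemma states_partial_le rho0 (n : nat -> R) N : states rho0 n ->
  \sum_(1 <= l < N) l%:R * n l <= rho0.
Proof.
move=> hn; apply: nneseriesr_partial_le; first exact: states_mass_ge0 hn.
by case: hn => _ ->.
Qed.

Lemma states_mass_le rho0 (n : nat -> R) l : states rho0 n -> (0 < l)%N ->
  l%:R * n l <= rho0.
Proof.
move=> hn l0; apply: le_trans (states_partial_le l.+1 hn).
rewrite big_nat_recr//= lerDr big_nat; apply: sumr_ge0 => i /andP[i0 _].
exact: (states_mass_ge0 hn).
Qed.

Lemma states_le rho0 (n : nat -> R) l : states rho0 n -> (0 < l)%N -> n l <= rho0.
Proof.
move=> hn l0; apply: le_trans (states_mass_le hn l0).
by rewrite ler_peMl ?ler1n// (states_ge0 hn).
Qed.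

Lemma states_cvg rho0 (n : nat -> R) : states rho0 n ->
  (\sum_(1 <= l < N) l%:R * n l) @[N --> \oo] --> rho0.
Proof.
move=> hn; have h : ((\sum_(1 <= l < N) (l%:R * n l)%:E)%E @[N --> \oo] --> rho0%:E)%E.
  case: (hn) => _ <-; apply: is_cvg_nneseries => l l1 _.
  by rewrite lee_fin (states_mass_ge0 hn).
have /fine_cvgP[_] := h; apply: cvg_trans; apply: near_eq_cvg; near=> N.
by rewrite /= sumEFin.
Unshelve. all: by end_near. Qed.

Lemma states_exhaust rho0 (n : nat -> R) e : states rho0 n -> 0 < e ->
  exists N0 : nat, forall N, (N0 <= N)%N -> rho0 - e <= \sum_(1 <= l < N) l%:R * n l.
Proof.
move=> hn e0; have /cvgrPdist_le/(_ e e0) [N0 _ h] := states_cvg hn.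
by exists N0 => N NN; have := h N NN; rewrite /= ler_norml; lra.
Qed.

Lemma states_mass_cvg0 rho0 (n : nat -> R) e : states rho0 n -> 0 < e ->
  exists N0 : nat, forall N, (N0 <= N)%N -> N%:R * n N <= e.
Proof.
move=> hn e0; have [N0 h] := states_exhaust hn e0.
exists N0.+1 => -[//|N NN]; have := h _ (ltnW NN).
by have := states_partial_le N.+2 hn; rewrite (big_nat_recr N.+1)//=; lra.
Qed.

End Sums.

(** * The size separating small from large clusters *)

Section CutoffSize.
Context {R : realType}.
Variable x : R.
Hypothesis x0 : 0 < x.
Implicit Types (eps K s : R).

Local Notation l0 := (l0 x).

Lemma powRNx_ge1 eps : 0 < eps <= 1 -> 1 <= eps `^ (- x).
Proof.
move=> /andP[e0 e1]; rewrite powRN invf_ge1 ?powR_gt0//.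
rewrite -[leRHS](powRr0 eps); apply: ger_powR; first by rewrite e0.
exact: ltW.
Qed.

Lemma l0_gt0 eps : 0 < eps <= 1 -> (0 < l0 eps)%N.
Proof. by move=> e01; rewrite truncn_gt0 powRNx_ge1. Qed.

Lemma l0_le eps : (l0 eps)%:R <= eps `^ (- x).
Proof. by rewrite truncn_le powR_ge0. Qed.

Lemma l0_ge eps : 0 < eps <= 1 -> eps `^ (- x) / 2 <= (l0 eps)%:R.
Proof.
move=> e01; have := truncnS_gt (eps `^ (- x)); rewrite -/(l0 eps) -natr1.
have : 1 <= (l0 eps)%:R :> R by rewrite ler1n l0_gt0.
by lra.
Qed.

Lemma l0_powRN eps s : 0 < eps <= 1 -> 0 <= s ->
  eps `^ (x * s) <= (l0 eps)%:R `^ (- s).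
Proof.
move=> e01 s0; have [e0 _] := andP e01.
have lR : 0 < (l0 eps)%:R :> R by rewrite ltr0n l0_gt0.
have -> : eps `^ (x * s) = (eps `^ (- x)) `^ (- s).
  by rewrite -powRrM mulrNN.
rewrite !(powRN _ s) lef_pV2 ?posrE ?powR_gt0//.
by apply: ge0_ler_powR; rewrite ?nnegrE ?powR_ge0 ?ler0n// l0_le.
Qed.

Lemma l0_large (L : nat) :
  exists2 e1 : R, 0 < e1 & forall eps, 0 < eps < e1 -> eps <= 1 -> (L <= l0 eps)%N.
Proof.
have L0 : 0 < ((L%:R : R) + 1)^-1 by rewrite invr_gt0; have := ler0n R L; lra.
have [e1 e10 h] := powR_small x0 L0; exists e1 => // eps ee1 e1'.
have [e0 _] := andP ee1; rewrite truncn_ge_nat ?powR_ge0//.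
have L1 : 0 < (L%:R : R) + 1 by have := ler0n R L; lra.
have le : L%:R + 1 <= eps `^ (- x).
  by rewrite powRN -[leLHS]invrK lef_pV2 ?posrE ?powR_gt0 ?invr_gt0//; exact: h.
by apply: le_trans le; rewrite lerDl.
Qed.

(* Summing fast decaying terms over [l >= l0] costs nothing: this beats any
   power of [1 / eps]. *)
Lemma tail_sum_small K : exists m : nat, exists2 C : R, 0 < C &
  forall eps, 0 < eps <= 1 -> forall N,
    \sum_(l0 eps <= l < N) ((l%:R : R) ^+ m)^-1 <= C * eps `^ K.
Proof.
(* x M >= K makes l0^(-M) at most a constant times eps^K; the two further powers in [M.+2] make the
   sum over l converge. *)
pose M := (Num.truncn (`|K| / x)).+1.
have KM : K <= x * M%:R.
  rewrite mulrC -ler_pdivrMr//; have := truncnS_gt (`|K| / x); rewrite -/M => /ltW.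
  by apply: le_trans; rewrite ler_wpM2r ?invr_ge0 ?(ltW x0)// ler_norm.
exists M.+2, (2 ^+ M * 2) => [|eps e01 N]; first by rewrite mulr_gt0// exprn_gt0.
have [e0 e1] := andP e01; have L0 := l0_gt0 e01.
have LR : 0 < (l0 eps)%:R :> R by rewrite ltr0n.
have step : (((l0 eps)%:R : R) ^+ M)^-1 <= 2 ^+ M * eps `^ K.
  apply: (@le_trans _ _ ((eps `^ (- x) / 2) ^- M)).
    rewrite lef_pV2 ?posrE ?exprn_gt0 ?divr_gt0 ?powR_gt0//.
    by rewrite lerXn2r ?nnegrE ?divr_ge0 ?powR_ge0// l0_ge.
  rewrite expr_div_n invf_div; apply: ler_wpM2l; first exact: exprn_ge0.
  rewrite powRN exprVn invrK -powR_mulrn ?powR_ge0// -powRrM.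
  by apply: ger_powR => //; rewrite e0.
apply: (@le_trans _ _ (\sum_(l0 eps <= l < N)
    2 ^+ M * eps `^ K * ((l%:R : R) ^+ 2)^-1)).
  rewrite !big_nat; apply: ler_sum => l /andP[Ll _].
  rewrite -[M.+2]addn2 exprD invfM; apply: ler_wpM2r; first by nneg.
  apply: le_trans step; have lR : 0 < l%:R :> R by rewrite ltr0n (leq_trans L0).
  by rewrite lef_pV2 ?posrE ?exprn_gt0// lerXn2r ?nnegrE ?ler0n// ler_nat.
rewrite -mulr_sumr [leRHS]mulrAC; apply: ler_wpM2l; first by nneg.
apply: le_trans (sum_inv_sqr_le _ L0) _.
by rewrite ler_pdivrMr// ler_peMr// ler1n.
Qed.

End CutoffSize.

(** * Hardy inequalities for the dissipation *)

Section Pointwise.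
Context {R : realType}.
Variables alpha gamma zs q : R.
Hypotheses (halpha : 0 <= alpha < 1) (hgamma : 0 < gamma < 1).
Hypotheses (hzs : 0 < zs) (hq : 0 < q).
Implicit Types (z c eps S M : R) (n : nat -> R) (l N : nat).

Let gt0 : 0 < gamma. Proof. by case/andP: hgamma. Qed.

Local Notation omega := (omega alpha gamma zs q).
Local Notation weight z l := (l%:R `^ alpha * omega z l).
Local Notation diss := (dissipation_term alpha gamma zs q).
Local Notation gap := (gap zs q).

Definition nonneg n := forall l, (0 < l)%N -> 0 <= n l.

Definition density n l : R := Num.sqrt (n l / omega (n 1%N) l).

Lemma density_sqr n l : nonneg n -> 0 < n 1%N -> (0 < l)%N ->
  n l = omega (n 1%N) l * density n l ^+ 2.
Proof.
move=> n0 z0 lp; have w0 := @omega_gt0 R alpha gamma _ _ hzs hq _ _ z0 lp.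
rewrite sqr_sqrtr; last by rewrite divr_ge0 ?n0// ltW.
by rewrite mulrC divfK// gt_eqF.
Qed.

Lemma density1 n : 0 < n 1%N -> density n 1 = 1.
Proof. by move=> z0; rewrite /density omega1 divff ?gt_eqF// sqrtr1. Qed.

(** omega(n_1) satisfies detailed balance with monomer density n_1 ([weightS]), so the forward and
    backward fluxes carry the same factor n_1 l^alpha omega_l(n_1), times the squares of the
    densities at l and l+1. Then [log_dissipation_ge] applies. *)
Lemma diss_ge n l : nonneg n -> 0 < n 1%N -> (0 < l)%N ->
  ((n 1%N * weight (n 1%N) l * (density n l.+1 - density n l) ^+ 2)%:E <= diss n l)%E.
Proof.
move=> n0 z0 lp; set z := n 1%N in z0 *.
have k0 : 0 <= z * weight z l by rewrite mulr_ge0 ?(ltW z0)// ltW// weight_gt0.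
rewrite /dissipation_term -/z.
have -> : rate_a alpha l * z * n l = (Num.sqrt (z * weight z l) * density n l) ^+ 2.
  rewrite exprMn sqr_sqrtr// /density [in LHS](density_sqr n0 z0 lp) /rate_a -/z.
  by rewrite /density; ring.
have -> : rate_b alpha gamma zs q l.+1 * n l.+1 =
    (Num.sqrt (z * weight z l) * density n l.+1) ^+ 2.
  rewrite exprMn sqr_sqrtr// /density [in LHS](density_sqr n0 z0 (ltn0Sn l)) -/z.
  rewrite [z * _]mulrC -weightS// /rate_b /density.
  by ring.
have d0 k : 0 <= Num.sqrt (z * weight z l) * density n k by nneg.
apply: le_trans (log_dissipation_ge (sqr_ge0 _) (sqr_ge0 _)).
rewrite !sqrtr_sqr !ger0_norm// lee_fin -mulrBr exprMn sqr_sqrtr//.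
by rewrite -[in leRHS]sqrrN opprB.
Qed.

Lemma diss_ge0 n l : nonneg n -> (0 < l)%N -> (0 <= diss n l)%E.
Proof.
move=> n0 lp; apply: log_dissipation_ge0; apply: mulr_ge0; rewrite ?n0//.
  by apply: mulr_ge0; rewrite ?n0// ltW// rate_a_gt0.
by rewrite ltW// rate_b_gt0.
Qed.

Lemma hardy_diss n (d : nat -> R) N : nonneg n -> 0 < n 1%N ->
  (forall l, 0 <= d l <= 2^-1) -> (forall l, (1 <= l)%N -> d l.+1 <= d l) ->
  (forall l, (1 <= l)%N -> (l < N)%N ->
     weight (n 1%N) l.+1 <= weight (n 1%N) l * (1 - 2 * d l.+1)) ->
  ((n 1%N * \sum_(1 <= l < N.+1) weight (n 1%N) l * d l ^+ 2 * (density n l - 1) ^+ 2)%:E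
    <= \sum_(1 <= l < N) diss n l)%E.
Proof.
move=> n0 z0 d01 dd dw; set z := n 1%N in z0 dw *.
have [->|Np] := posnP N; first by rewrite !big_geq// mulr0.
have W l : (0 < l)%N -> 0 < weight z l by move=> lp; rewrite weight_gt0.
pose k l := if l is 0 then 0 else z * weight z l.
have k0 l : (1 <= l)%N -> 0 <= k l by case: l => // l _; rewrite mulr_ge0 ?ltW// W.
have h := @hardy_decreasing R k d (fun l => density n l - 1) N k0.
have {}h := h ltac:(by rewrite /= density1// subrr) d01 dd.
have {}h : _ := h ltac:(by case=> // l l1 lN; rewrite /k -(mulrA z) ler_pM2l// dw).
apply: (@le_trans _ _ (\sum_(1 <= l < N) k l * (density n l.+1 - density n l) ^+ 2)%:E).
  rewrite lee_fin; have -> : \sum_(1 <= l < N) k l * (density n l.+1 - density n l) ^+ 2 =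
    \sum_(1 <= l < N) k l * (density n l.+1 - 1 - (density n l - 1)) ^+ 2.
    by apply: eq_bigr => l _; congr (_ * _ ^+ 2); ring.
  (* The term l = 1 vanishes since the density there is 1. In the others the weight at l+1 is
     bounded by the one at l, which is the index the Hardy inequality produces. *)
  apply: le_trans h; have sq0 : (0 : R) ^+ 2 = 0 by rewrite expr0n.
  rewrite big_ltn// density1// subrr sq0 mulr0 add0r.
  rewrite big_add1 mulr_sumr !big_nat; apply: ler_sum => -[//|l] /andP[_ lN].
  apply: (@le_trans _ _ (z * (weight z l.+1 * d l.+2 ^+ 2 * (density n l.+2 - 1) ^+ 2))).
    rewrite ler_pM2l//; do 2 apply: (ler_wpM2r (sqr_ge0 _)).
    apply: (le_trans (dw l.+1 isT lN)).
    by rewrite ler_piMr//; [rewrite ltW// W|have := d01 l.+2; lra].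
  by rewrite /k le_eqVlt; apply/orP; left; apply/eqP; ring.
rewrite -sumEFin !big_nat; apply: lee_sum => -[//|l] /andP[_ lN].
exact: diss_ge.
Qed.

Let halfgap l := gap / 2 * (if l is 0 then 1 else l%:R `^ (- gamma)).

Lemma hardy_diss_gap n N : nonneg n -> 0 < n 1%N ->
  n 1%N <= zs + q / 2 * N%:R `^ (- gamma) ->
  ((n 1%N * (gap / 2) ^+ 2 * \sum_(1 <= l < N.+1)
      weight (n 1%N) l * (l%:R `^ (- gamma)) ^+ 2 * (density n l - 1) ^+ 2)%:E
    <= \sum_(1 <= l < N) diss n l)%E.
Proof.
move=> n0 z0 zN; have gp := @gap_gt0 R _ _ hzs hq.
have h := @hardy_diss n halfgap N n0 z0.
have /h{}h : forall l, 0 <= halfgap l <= 2^-1.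
  move=> l; have gl := @gap_le R _ _ hzs hq; rewrite /halfgap; case: l => [|l].
    by rewrite mulr1; lra.
  have := powRN_le1 (ltW gt0) (ltn0Sn l) : _ <= (1 : R).
  move: (powR_ge0 (l.+1%:R : R) (- gamma)); set p := _ `^ _ => p0 p1.
  by apply/andP; split; [nneg; exact: ltW|nra].
have /h{}h : forall l, (1 <= l)%N -> halfgap l.+1 <= halfgap l.
  case=> // l _; rewrite /halfgap ler_pM2l; last exact: divr_gt0.
  by rewrite powRN_nonincreasing// ltW.
have /h{}h : forall l, (1 <= l)%N -> (l < N)%N ->
    weight (n 1%N) l.+1 <= weight (n 1%N) l * (1 - 2 * halfgap l.+1).
  move=> l l1 lN.
  apply: (le_trans (@weight_ratio R alpha gamma zs q hgamma hzs hq _ _ _ z0 l1 lN zN)).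
  rewrite ler_pM2l; last by rewrite weight_gt0.
  by rewrite /halfgap lerD2l lerN2 mulrA mulrCA divff// mulr1.
apply: le_trans h; rewrite lee_fin -mulrA ler_pM2l// mulr_sumr !big_nat le_eqVlt; apply/orP; left.
apply/eqP; apply: eq_bigr => -[//|l] _; rewrite /halfgap.
by ring.
Qed.

(** For n_1 below zs the weights decay geometrically at a rate independent of l. Hence there is no
    loss l^(-2 gamma), and the constant is quadratic in zs - n_1; this square is what
    [n1_rate_below] extracts. *)
Lemma hardy_diss_below n N : nonneg n -> 0 < n 1%N -> n 1%N <= zs ->
  ((n 1%N * ((zs - n 1%N) / (zs + q) / 2) ^+ 2 * \sum_(1 <= l < N.+1)
      weight (n 1%N) l * (density n l - 1) ^+ 2)%:E
    <= \sum_(1 <= l < N) diss n l)%E.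
Proof.
move=> n0 z0 zzs; have zq : 0 < zs + q by rewrite addr_gt0.
have h := @hardy_diss n (fun=> (zs - n 1%N) / (zs + q) / 2) N n0 z0.
have /h{}h : forall l : nat, 0 <= (zs - n 1%N) / (zs + q) / 2 <= 2^-1.
  move=> _; apply/andP; split.
    by apply: divr_ge0 => //; apply: divr_ge0; [rewrite subr_ge0|exact: ltW].
  rewrite ler_pdivrMr// mulVf// ler_pdivrMr//; clear h; have := hq; have := hzs; lra.
have /h{}h : forall l : nat, (1 <= l)%N -> (zs - n 1%N) / (zs + q) / 2 <= (zs - n 1%N) / (zs + q) / 2.
  by [].
have /h{}h : forall l, (1 <= l)%N -> (l < N)%N ->
    weight (n 1%N) l.+1 <= weight (n 1%N) l * (1 - 2 * ((zs - n 1%N) / (zs + q) / 2)).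
  move=> l l1 lN.
  apply: (le_trans (@weight_ratio_const R alpha gamma zs q hgamma hzs hq _ _ z0 zzs l1)).
  by rewrite [2 * _]mulrC divfK.
apply: le_trans h; rewrite lee_fin -mulrA ler_pM2l// mulr_sumr !big_nat le_eqVlt; apply/orP; left.
by apply/eqP; apply: eq_bigr => l _; ring.
Qed.

(* Above [zs] the weights grow at a geometric rate, and the dissipation
   controls the large clusters instead of their distance to equilibrium. *)
Lemma hardy_diss_above n (del : R) m N : nonneg n -> 0 < del -> del <= zs ->
  zs + del <= n 1%N -> (0 < m)%N -> q * m%:R `^ (- gamma) <= del / 2 -> (m <= N)%N ->
  ((del ^+ 2 / (8 * zs) ^+ 2 * \sum_(m <= l < N) n 1%N * l%:R `^ alpha * n l)%:E <=
   \sum_(m <= l < N) diss n l + (n 1%N * (N%:R * n N))%:E)%E.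
Proof.
move=> n0 del0 delzs zdel mp qm mN.
pose z := n 1%N; have z0 : 0 < z by apply: lt_le_trans zdel; rewrite addr_gt0.
pose p l := if l is 0 then 0 else rate_a alpha l * z * n l.
pose r l := if l is 0 then 0 else rate_b alpha gamma zs q l * n l.
(* Since del <= zs, this choice gives (zs + del) (1 - 2 d) >= zs + del/2, which leaves del/2 for the
   term q l^(-gamma). *)
pose d := del / (8 * zs); have zs8 : 0 < 8 * zs by rewrite mulr_gt0.
have d0 : 0 < d by rewrite divr_gt0.
have d8 : d <= 8^-1 by rewrite /d ler_pdivrMr// mulrA mulVf// mul1r.
have p0 l : 0 <= p l.
  by case: l => // l; rewrite /p mulr_ge0 ?n0// mulr_ge0 ?ltW// rate_a_gt0.
have r0 l : 0 <= r l by case: l => // l; rewrite /r mulr_ge0 ?n0// ltW// rate_b_gt0.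
have d01 : 0 <= d <= 2^-1 by apply/andP; split; [exact: ltW|move: d8; lra].
have h := @hardy_increasing R p r d m N p0 r0 d01.
have {}h : _ := h _ mN.
have /h{}h : forall l, (m <= l)%N -> r l.+1 <= p l.+1 * (1 - 2 * d).
  move=> l ml; rewrite /r /p /rate_b -/(rate_a alpha l.+1).
  have -> : rate_a alpha l.+1 * z * n l.+1 * (1 - 2 * d) =
    rate_a alpha l.+1 * (z * (1 - 2 * d)) * n l.+1 by ring.
  apply: ler_wpM2r; first exact: n0.
  rewrite ler_pM2l ?rate_a_gt0//.
  have : q * l.+1%:R `^ (- gamma) <= del / 2.
    apply: le_trans qm; rewrite ler_pM2l// powRN_nonincreasing//; first exact: ltW.
    exact: leqW.
  have dE : d * (8 * zs) = del by rewrite /d divfK// gt_eqF.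
  have z1 : (zs + del) * (1 - 2 * d) <= z * (1 - 2 * d) by apply: ler_wpM2r => //; lra.
  have dd : d * del <= d * zs by rewrite ler_pM2l.
  by move: z1; move: (q * _) => y z1 hy; lra.
apply: (@le_trans _ _ (\sum_(m <= l < N) (Num.sqrt (p l) - Num.sqrt (r l.+1)) ^+ 2 + d * p N)%:E).
  rewrite lee_fin; apply: le_trans h; rewrite -exprVn -exprMn -/d mulr_sumr.
  rewrite !big_nat le_eqVlt; apply/orP; left; apply/eqP; apply: eq_bigr => -[|l].
    by rewrite leqn0 => /andP[/eqP m0]; rewrite m0 in mp.
  by move=> _; rewrite /p /rate_a; congr (_ * (_ * _)); rewrite mulrC.
rewrite EFinD leeD//.
  rewrite -sumEFin !big_nat; apply: lee_sum => -[|l] /andP[ml _].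
    by move: ml; rewrite leqn0 => /eqP m0; rewrite m0 in mp.
  exact: log_dissipation_ge (p0 l.+1) (r0 l.+2).
have N0 : (0 < N)%N by exact: leq_trans mN.
rewrite lee_fin; case: N N0 {h mN} => // N _.
(* Sublinear growth of the rates, l^alpha <= l, bounds the boundary flux by the mass in the last
   size. *)
have pN : p N.+1 <= z * (N.+1%:R * n N.+1).
  rewrite /p -mulrA mulrCA ler_pM2l// ler_wpM2r ?n0//.
  rewrite /rate_a -[leRHS]powRr1// ler_powR ?ler1n//.
  by have /andP[_] := halpha => /ltW.
apply: le_trans pN; rewrite ler_piMl//; move: d8; lra.
Qed.

End Pointwise.

(** * Quasistationarity of the small clusters *)

Section Small.
Context {R : realType}.
Implicit Types P Q : R -> Prop.

Definition small P := exists2 e1 : R, 0 < e1 & forall eps, 0 < eps < e1 -> P eps.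

Lemma small_and P Q : small P -> small Q -> small (fun e => P e /\ Q e).
Proof.
move=> [a a0 ha] [b b0 hb]; exists (Num.min a b); first by rewrite lt_min a0.
move=> e; rewrite lt_min => /and3P[e0 ea eb].
by split; [apply: ha|apply: hb]; rewrite e0.
Qed.

Lemma small_mono P Q : (forall e, 0 < e -> P e -> Q e) -> small P -> small Q.
Proof.
move=> PQ [a a0 ha]; exists a => // e ea; apply: (PQ _ _ (ha _ ea)).
by case/andP: ea.
Qed.

Lemma small_le1 : small (fun e => e <= 1).
Proof. by exists 1 => // e /andP[_ /ltW]. Qed.

Lemma small_powR s c : 0 < s -> 0 < c -> small (fun e => e `^ s <= c).
Proof. by move=> s0 c0; have [e1 e10 h] := powR_small s0 c0; exists e1. Qed.

Lemma small_l0_large x (L : nat) : 0 < x -> small (fun e => (L <= l0 x e)%N).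
Proof.
move=> x0; have [e1 e10 h] := l0_large x0 L.
apply: (small_mono _ (small_and small_le1 (_ : small (fun e => 0 < e < e1)))).
  by move=> e _ [e1' he]; exact: h.
by exists e1.
Qed.

Lemma norm_le_of_sqr (a b : R) : 0 <= b -> a ^+ 2 <= b ^+ 2 -> `|a| <= b.
Proof.
by move=> b0; rewrite -[a ^+ 2]real_normK ?num_real// ler_sqr ?nnegrE.
Qed.

Lemma powR_half_sqr (e g : R) : 0 < e -> (e `^ (g / 2)) ^+ 2 = e `^ g.
Proof.
move=> e0; rewrite expr2 -powRD; first by congr (_ `^ _); field.
by apply/implyP => _; rewrite gt_eqF.
Qed.

Lemma powRD_pos (e a b : R) : 0 < e -> e `^ (a + b) = e `^ a * e `^ b.
Proof. by move=> e0; rewrite powRD//; apply/implyP => _; rewrite gt_eqF. Qed.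

Lemma powR_invl (e a : R) : 0 < e -> e^-1 `^ a = (e `^ a)^-1.
Proof. by move=> e0; rewrite -powR_inv1 ?ltW// -powRrM mulN1r powRN. Qed.

End Small.

Section GoodStates.
Context {R : realType}.
Variables alpha gamma zs q rho0 x CF : R.
Hypotheses (halpha : 0 <= alpha < 1) (hgamma : 0 < gamma < 1).
Hypotheses (hzs : 0 < zs) (hq : 0 < q) (hx : 0 < x < 2^-1).
Implicit Types (z c eps S M : R) (n : nat -> R) (l N : nat).

Let gt0 : 0 < gamma. Proof. by case/andP: hgamma. Qed.
Let glt1 : gamma < 1. Proof. by case/andP: hgamma. Qed.
Let x0 : 0 < x. Proof. by case/andP: hx. Qed.

Local Notation omega := (omega alpha gamma zs q).
Local Notation weight z l := (l%:R `^ alpha * omega z l).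
Local Notation diss := (dissipation_term alpha gamma zs q).
Local Notation term := (energy_term alpha gamma zs q).
Local Notation gap := (gap zs q).
Local Notation density := (density alpha gamma zs q).
Local Notation l0 := (l0 x).

Definition low_energy eps n := states rho0 n /\
  (F_eps alpha gamma zs q eps n <= CF%:E)%E.

Lemma low_energy_nonneg eps n : low_energy eps n -> nonneg n.
Proof. by move=> [hn _] l lp; exact: states_ge0 hn lp. Qed.

Lemma term_ge0 n l : nonneg n -> (0 < l)%N -> 0 <= term n l.
Proof.
move=> n0 lp; have w0 := @omega_gt0 R alpha gamma _ _ hzs hq _ _ hzs lp.
by rewrite mulr_ge0 ?(ltW w0)// psi_ge0// divr_ge0 ?n0// ltW.
Qed.

Lemma low_energy_sum eps n a N : 0 < eps -> low_energy eps n -> (0 < a)%N ->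
  \sum_(a <= l < N) term n l <= `|CF| / zs * eps `^ gamma.
Proof.
move=> e0 hn ap; have n0 := low_energy_nonneg hn.
apply: (@le_trans _ _ (\sum_(1 <= l < N) term n l)).
  by apply: sum_nat_nonneg_ge => // l lp; exact: term_ge0.
have s0 : 0 < F_scale gamma zs eps by rewrite mulr_gt0// powR_gt0.
have : ((F_scale gamma zs eps * \sum_(1 <= l < N) term n l)%:E <= CF%:E)%E.
  case: hn => _; apply: le_trans; rewrite EFinM /F_eps.
  apply: lee_wpmul2l; first by rewrite lee_fin ltW.
  rewrite -sumEFin; apply: nneseries_lim_ge => l lp _.
  by rewrite lee_fin term_ge0.
rewrite lee_fin /F_scale -ler_pdivlMl// => /le_trans; apply.
rewrite invfM -powRN opprK mulrC mulrA; apply: ler_wpM2r; first exact: powR_ge0.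
by apply: ler_wpM2r; [rewrite invr_ge0 ltW|exact: ler_norm].
Qed.

(** The term l = 1 of the energy suffices: psi(n_1 / zs) is of order eps^gamma and bounds the square
    of sqrt(n_1 / zs) - 1. *)
Lemma n1_near : exists2 C, 0 < C & forall eps n, 0 < eps <= 1 -> low_energy eps n ->
  `|n 1%N - zs| <= C * eps `^ (gamma / 2).
Proof.
set c := Num.sqrt (`|CF| / zs ^+ 2); have c0 : 0 <= c by exact: sqrtr_ge0.
exists (zs * c * (2 + c) + 1) => [|eps n /andP[e0 e1] hn]; first by apply: ltr_wpDl => //; nneg; exact: ltW.
have n0 := low_energy_nonneg hn; set a := n 1%N / zs.
have a0 : 0 <= a by rewrite divr_ge0 ?n0// ltW.
have h : (Num.sqrt a - 1) ^+ 2 <= (c * eps `^ (gamma / 2)) ^+ 2.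
  apply: (le_trans (psi_ge a0)).
  rewrite exprMn sqr_sqrtr ?divr_ge0 ?exprn_ge0 ?(ltW hzs)// powR_half_sqr//.
  have := low_energy_sum 2 e0 hn (ltn0Sn 0); rewrite big_nat1 /energy_term omega1.
  rewrite -ler_pdivlMl// => /le_trans; apply.
  by rewrite le_eqVlt; apply/orP; left; apply/eqP; field; rewrite gt_eqF.
have p0 : 0 <= eps `^ (gamma / 2) by exact: powR_ge0.
have {}h := norm_le_of_sqr (mulr_ge0 c0 p0) h.
have p1 : eps `^ (gamma / 2) <= 1.
  by rewrite -[leRHS](powRr0 eps); apply: ger_powR; rewrite ?e0//; apply: divr_ge0 => //; exact: ltW.
have -> : n 1%N - zs = zs * ((Num.sqrt a - 1) * (Num.sqrt a + 1)).
  rewrite -subr_sqr sqr_sqrtr// expr1n /a mulrBr mulr1 mulrC divfK// gt_eqF//.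
rewrite normrM gtr0_norm// normrM.
have h2 : `|Num.sqrt a + 1| <= 2 + c.
  rewrite ger0_norm; last by have := sqrtr_ge0 a; lra.
  by move: h; rewrite ler_norml => /andP[_]; have := ler_wpM2l c0 p1; lra.
have := ler_pM (normr_ge0 _) (normr_ge0 _) h h2.
move/(ler_wpM2l (ltW hzs)) => h3; apply: (le_trans h3).
by move: p0; lra.
Qed.

(** The three bounds serve division by n_1, the decay of the weights ([weight_ratio]) and their
    lower bound ([ln_omega_ge]). *)
Lemma n1_window : small (fun eps => forall n, low_energy eps n ->
  [/\ zs / 2 <= n 1%N, n 1%N <= zs + q / 2 * (l0 eps)%:R `^ (- gamma)
    & zs - (l0 eps)%:R `^ (- gamma) <= n 1%N]).
Proof.
have [C C0 hC] := n1_near; set c := Num.min 1 (Num.min (q / 2) (zs / 2)) / C.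
have c0 : 0 < c.
  by rewrite divr_gt0// !lt_min ltr01/=; apply/andP; split; rewrite divr_gt0.
have s0 : 0 < gamma / 2 - x * gamma.
  rewrite [gamma / 2]mulrC -mulrBl; apply: mulr_gt0 => //.
  by have /andP[_] := hx; lra.
apply: (small_mono _ (small_and small_le1 (small_powR s0 c0))).
move=> eps e0 [e1 he] n hn.
have e01 : 0 < eps <= 1 by rewrite e0.
have := hC _ _ e01 hn; set p := (l0 eps)%:R `^ (- gamma).
have pp : C * eps `^ (gamma / 2) <= Num.min 1 (Num.min (q / 2) (zs / 2)) * p.
  rewrite (_ : gamma / 2 = gamma / 2 - x * gamma + x * gamma); last by ring.
  rewrite powRD_pos ?e0// mulrA; apply: ler_pM; rewrite ?powR_ge0//.
  - by rewrite mulr_ge0 ?powR_ge0// ltW.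
  - by rewrite mulrC -ler_pdivlMr.
  - by apply: l0_powRN => //; exact: ltW.
have p0 : 0 <= p by exact: powR_ge0.
have p1 : p <= 1 by apply: powRN_le1; [exact: ltW|exact: l0_gt0].
have m1 : Num.min 1 (Num.min (q / 2) (zs / 2)) <= 1 by rewrite ge_min lexx.
have m2 : Num.min 1 (Num.min (q / 2) (zs / 2)) <= q / 2 by rewrite !ge_min lexx !orbT.
have m3 : Num.min 1 (Num.min (q / 2) (zs / 2)) <= zs / 2 by rewrite !ge_min lexx !orbT.
have := ler_wpM2r p0 m1; have := ler_wpM2r p0 m2; have := ler_wpM2r p0 m3.
have := ler_wpM2l (ltW hzs) p1.
by rewrite ler_norml => a1 a2 a3 a4 /andP[a5 a6]; split; move: pp; lra.
Qed.

(** As n_l <= rho0, the density is large only where the weight is small, and [ln_omega_ge] limits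
    how small it gets. This is the [b] of [psi_sqr_le]. *)
Lemma ln_density_le : exists2 B, 0 < B & small (fun eps => forall n, low_energy eps n ->
  forall l, (0 < l < l0 eps)%N -> 0 < density n l ->
    ln (density n l) <= B * l%:R `^ (1 - gamma)).
Proof.
have [C C0 hC] := @ln_omega_ge R alpha gamma zs q halpha hgamma hzs hq.
exists (`|ln rho0| + C); first by rewrite ltr_wpDl.
apply: small_mono n1_window => eps e0 h n hn l /andP[lp ll] u0.
have [z1 z2 z3] := h _ hn; have n0 := low_energy_nonneg hn.
have z0 : 0 < n 1%N by apply: lt_le_trans z1; rewrite divr_gt0.
have w0 := @omega_gt0 R alpha gamma _ _ hzs hq _ _ z0 lp.
have E := density_sqr alpha gamma hzs hq n0 z0 lp.
have nl0 : 0 < n l by rewrite E mulr_gt0// exprn_gt0.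
have : ln (n l) = ln (omega (n 1%N) l) + ln (density n l) *+ 2.
  by rewrite E lnM ?posrE ?exprn_gt0// lnXn.
have := hC _ _ z1 z3 l; rewrite lp (ltnW ll) => /(_ isT).
have : ln (n l) <= `|ln rho0| * l%:R `^ (1 - gamma).
  apply: (@le_trans _ _ (ln rho0)).
    have nr := states_le hn.1 lp.
    have r0 := lt_le_trans nl0 nr.
    by rewrite ler_ln ?posrE.
  apply: (le_trans (ler_norm _)); rewrite ler_peMr//.
  by rewrite -[leLHS](powRr0 l%:R) ler_powR ?ler1n// subr_ge0 ltW.
have : 0 <= (`|ln rho0| + C) * l%:R `^ (1 - gamma) by nneg; exact: ltW.
by rewrite mulrDl mulr2n; lra.
Qed.

(** By [psi_sqr_le] the entropy at l is at most a constant times omega_l l^(1-gamma) (u_l - 1)^2,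
    whereas the Hardy inequality controls l^alpha omega_l l^(-2 gamma) (u_l - 1)^2. The quotient
    l^(1-alpha+gamma) is largest at l0. *)
Lemma H_mic_bound : exists2 C, 0 < C & small (fun eps => forall n, low_energy eps n ->
  (H_mic alpha gamma zs q x eps n (n 1%N) <=
   (C * eps `^ (- (x * (1 - alpha + gamma))))%:E * \sum_(1 <= l < l0 eps) diss n l)%E).
Proof.
have [B B0 hB] := ln_density_le.
have gp := @gap_gt0 R _ _ hzs hq.
set c := zs / 2 * (gap / 2) ^+ 2.
have c0 : 0 < c by apply: mulr_gt0; [|apply: exprn_gt0]; exact: divr_gt0.
exists ((9 + 4 * B) / c); first by apply: divr_gt0 => //; move: B0; lra.
apply: (small_mono _ (small_and small_le1 (small_and n1_window hB))) => eps e0 [e1 [h hb]] n hn.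
have [z1 z2 z3] := h _ hn; have n0 := low_energy_nonneg hn.
have z0 : 0 < n 1%N by apply: lt_le_trans z1; rewrite divr_gt0.
set E := eps `^ _; have E0 : 0 <= E by exact: powR_ge0.
set S := \sum_(1 <= l < (l0 eps).+1)
      weight (n 1%N) l * (l%:R `^ (- gamma)) ^+ 2 * (density n l - 1) ^+ 2.
have S0 l : 0 <= weight (n 1%N) l * (l%:R `^ (- gamma)) ^+ 2 * (density n l - 1) ^+ 2.
  case: l => [|l]; last first.
    by do 2 (apply: mulr_ge0; last exact: sqr_ge0); rewrite ltW// weight_gt0.
  have [->|a0] := eqVneq alpha 0; last by rewrite powR0// !mul0r.
  rewrite powRr0 mul1r; do 2 (apply: mulr_ge0; last exact: sqr_ge0).
  by rewrite /Defs.omega expr0 mul1r /Q big_geq.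
have hS : ((c * S)%:E <= \sum_(1 <= l < l0 eps) diss n l)%E.
  apply: le_trans (hardy_diss_gap alpha hgamma hzs hq n0 z0 z2); rewrite lee_fin.
  apply: ler_wpM2r; first by apply: sumr_ge0 => l _; exact: S0.
  by apply: ler_wpM2r => //; exact: sqr_ge0.
apply: (@le_trans _ _ ((9 + 4 * B) * E * S)%:E); last first.
  rewrite (_ : (9 + 4 * B) * E * S = (9 + 4 * B) / c * E * (c * S)); last first.
    by field; rewrite gt_eqF.
  rewrite [in leLHS]EFinM; apply: lee_wpmul2l => //.
  by rewrite lee_fin mulr_ge0// divr_ge0 ?(ltW c0)// addr_ge0// mulr_ge0// ltW.
apply: (@le_trans _ _ (\sum_(1 <= l < l0 eps) (9 + 4 * B) * E *
    (weight (n 1%N) l * (l%:R `^ (- gamma)) ^+ 2 * (density n l - 1) ^+ 2))%:E); last first.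
  rewrite lee_fin -mulr_sumr; apply: ler_wpM2l.
    by rewrite mulr_ge0// addr_ge0// mulr_ge0// ltW.
  by apply: sum_nat_nonneg_le => [l _|//]; exact: S0.
rewrite -sumEFin /H_mic !big_nat; apply: lee_sum => l ll.
have /andP[lp lL] := ll; have lR : 0 < l%:R :> R by rewrite ltr0n.
have w0 := @omega_gt0 R alpha gamma _ _ hzs hq _ _ z0 lp.
rewrite /entropy gt_eqF// lee_fin.
have -> : n l / omega (n 1%N) l = density n l ^+ 2.
  by rewrite [in LHS](density_sqr alpha gamma hzs hq n0 z0 lp) mulrC mulKf// gt_eqF.
have P1 : 1 <= l%:R `^ (1 - gamma) :> R.
  by rewrite -[leLHS](powRr0 l%:R) ler_powR ?ler1n// subr_ge0 ltW.
have b0 : 0 <= B * l%:R `^ (1 - gamma) by nneg; exact: ltW.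
have := psi_sqr_le (sqrtr_ge0 _) b0 (hb _ hn _ ll).
move/(ler_wpM2l (ltW w0)) => hpsi; apply: (le_trans hpsi).
set v := (density n l - 1) ^+ 2; have v0 : 0 <= v by exact: sqr_ge0.
apply: (@le_trans _ _ ((9 + 4 * B) * v * (omega (n 1%N) l * l%:R `^ (1 - gamma)))).
  have := ler_wpM2l (mulr_ge0 (ltW w0) v0) P1.
  by rewrite /v; move: (l%:R `^ (1 - gamma)) => p; lra.
have -> : omega (n 1%N) l * l%:R `^ (1 - gamma) =
    weight (n 1%N) l * (l%:R `^ (- gamma)) ^+ 2 * l%:R `^ (1 - alpha + gamma).
  have -> : 1 - gamma = alpha + (- gamma + (- gamma + (1 - alpha + gamma))) by ring.
  by rewrite !(powRD_pos _ _ lR); ring.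
have LE : l%:R `^ (1 - alpha + gamma) <= E.
  rewrite /E -mulNr powRrM; apply: ge0_ler_powR; rewrite ?nnegrE ?powR_ge0//.
    by have /andP[_ a1] := halpha; move: gt0; lra.
  by apply: le_trans (l0_le _ _); rewrite ler_nat ltnW.
have W0 : 0 <= (9 + 4 * B) * v * (weight (n 1%N) l * (l%:R `^ (- gamma)) ^+ 2).
  apply: mulr_ge0; first by apply: mulr_ge0 => //; move: B0; lra.
  by apply: mulr_ge0; [rewrite ltW// weight_gt0|exact: sqr_ge0].
have := ler_wpM2l W0 LE; rewrite -/v.
by move: (weight _ _) (_ ^+ 2) => *; lra.
Qed.

End GoodStates.

(** * Mass and energy of the large clusters *)

Section MacroStates.
Context {R : realType}.
Variables alpha gamma zs q rho0 x CF : R.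
Hypotheses (halpha : 0 <= alpha < 1) (hgamma : 0 < gamma < 1).
Hypotheses (hzs : 0 < zs) (hq : 0 < q) (hx : 0 < x < 2^-1).
Implicit Types (z c eps S M : R) (n : nat -> R) (l N : nat).

Let gt0 : 0 < gamma. Proof. by case/andP: hgamma. Qed.
Let glt1 : gamma < 1. Proof. by case/andP: hgamma. Qed.
Let x0 : 0 < x. Proof. by case/andP: hx. Qed.

Local Notation omega := (omega alpha gamma zs q).
Local Notation term := (energy_term alpha gamma zs q).
Local Notation gap := (gap zs q).
Local Notation density := (density alpha gamma zs q).
Local Notation l0 := (l0 x).
Local Notation low_energy := (low_energy alpha gamma zs q rho0 CF).
Local Notation kappa := (q / (zs * (1 - gamma))).

Let omega_pos z l : 0 < z -> (0 < l)%N -> 0 < omega z l.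
Proof. by move=> z0 lp; apply: omega_gt0. Qed.

(** Young's inequality [psi_young] with slope s theta l, where s is 1 or -1 and theta =
    eps^(gamma/2): the energy is O(theta^2), and so is the sum of omega_l times the quadratic Taylor
    remainder of the exponential; dividing by theta gives the bound. *)
Lemma micro_mass : exists2 C, 0 < C & small (fun eps => forall n, low_energy eps n ->
  `|\sum_(1 <= l < l0 eps) l%:R * (n l - omega zs l)| <= C * eps `^ (gamma / 2)).
Proof.
(* Decay of order 4: the Taylor remainder costs l^2, and a summable l^(-2) has to remain. *)
have [C4 C40 hC4] := @omega_decay R alpha gamma zs q halpha hgamma hzs hq 4.
have s0 : 0 < gamma / 2 - x * gamma.
  by rewrite [gamma / 2]mulrC -mulrBl; apply: mulr_gt0 => //; have /andP[_] := hx; lra.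
have c0 : 0 < q / 2 / (zs * expR 1).
  by apply: divr_gt0; [exact: divr_gt0|apply: mulr_gt0 => //; exact: expR_gt0].
exists (`|CF| / zs + C4 * 2); first by apply: ltr_wpDl; [nneg; exact: ltW|exact: mulr_gt0].
apply: (small_mono _ (small_and small_le1 (small_powR s0 c0))) => eps e0 [e1 he] n hn.
have n0 := low_energy_nonneg hn; have e01 : 0 < eps <= 1 by rewrite e0.
set th := eps `^ (gamma / 2); have th0 : 0 < th by exact: powR_gt0.
have th1 : th <= 1.
  rewrite /th -[leRHS](powRr0 eps); apply: ger_powR; rewrite ?e0//.
  by apply: divr_ge0 => //; exact: ltW.
(* The factor exp(theta l) of the Taylor bound tilts the weights to omega(zs exp(theta)); by x < 1/2
   they still decay up to l0. *)
have zth : zs * expR th <= zs + q / 2 * (l0 eps)%:R `^ (- gamma).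
  have := @expR_ge_tangent R th 0; rewrite expR0 => h1.
  have h2 : expR th <= expR 1 by rewrite ler_expR.
  have h3 : zs * expR 1 * th <= q / 2 * eps `^ (x * gamma).
    have -> : th = eps `^ (gamma / 2 - x * gamma) * eps `^ (x * gamma).
      by rewrite -powRD_pos//; congr (_ `^ _); ring.
    rewrite mulrA; apply: ler_wpM2r; first exact: powR_ge0.
    by rewrite mulrC -ler_pdivlMr// mulr_gt0// expR_gt0.
  have h4 : eps `^ (x * gamma) <= (l0 eps)%:R `^ (- gamma) by apply: l0_powRN => //; exact: ltW.
  have h5 : th * expR th <= th * expR 1 by rewrite ler_pM2l.
  have h6 : expR th - 1 <= th * expR 1 by move: h1 h5; lra.
  have h7 : q / 2 * eps `^ (x * gamma) <= q / 2 * (l0 eps)%:R `^ (- gamma).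
    by apply: ler_wpM2l => //; exact: ltW (divr_gt0 _ _).
  by have := ler_wpM2l (ltW hzs) h6; move: h3 h7; lra.
have zth0 : 0 < zs * expR th by rewrite mulr_gt0// expR_gt0.
suff main (s : R) : `|s| = 1 ->
    s * th * \sum_(1 <= l < l0 eps) l%:R * (n l - omega zs l) <=
    (`|CF| / zs + C4 * 2) * th ^+ 2.
  have m1 := main 1 (normr1 _); have := main (-1); rewrite normrN1 => /(_ erefl) m2.
  rewrite ler_norml -(ler_pM2l th0) -[X in _ && X](ler_pM2l th0).
  by move: m1 m2; rewrite expr2 -/th; move: (\sum_(_ <= _ < _) _) => S m1 m2; apply/andP; split; lra.
move=> s1.
apply: (@le_trans _ _ (\sum_(1 <= l < l0 eps) term n l +
   \sum_(1 <= l < l0 eps) C4 * th ^+ 2 * ((l%:R : R) ^+ 2)^-1)); last first.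
  rewrite mulrDl; apply: lerD.
    by rewrite /th powR_half_sqr//; apply: low_energy_sum hn _.
  rewrite -mulr_sumr -[leRHS]mulrA [2 * _]mulrC [leRHS]mulrA; apply: ler_wpM2l.
    by nneg; exact: ltW.
  by have := @sum_inv_sqr_le R 1 (l0 eps) isT; rewrite (_ : 1%:R = 1 :> R)// divr1.
rewrite -big_split/= mulr_sumr !big_nat; apply: ler_sum => l /andP[lp lL].
have w0 := omega_pos hzs lp; have lR : 0 < l%:R :> R by rewrite ltr0n.
have a0 : 0 <= n l / omega zs l by rewrite divr_ge0 ?n0// ltW.
have := psi_young (s * th * l%:R) a0; move/(ler_wpM2l (ltW w0)).
have -> : omega zs l * (s * th * l%:R * (n l / omega zs l - 1)) =
    s * th * (l%:R * (n l - omega zs l)) by field; rewrite gt_eqF.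
rewrite [omega zs l * (psi _ + _)]mulrDr => /le_trans; apply; rewrite lerD2l.
have := expR_taylor2_le (s * th * l%:R); move/(ler_wpM2l (ltW w0)) => /le_trans; apply.
have -> : `|s * th * l%:R| = th * l%:R.
  by rewrite !normrM s1 mul1r !ger0_norm// ltW.
have s2 : s ^+ 2 = 1 by rewrite -[s ^+ 2]real_normK ?num_real// s1 expr1n.
have -> : omega zs l * ((s * th * l%:R) ^+ 2 * expR (th * l%:R)) =
   th ^+ 2 * l%:R ^+ 2 * omega (zs * expR th) l.
  by rewrite omega_zexp !exprMn s2; ring.
have := hC4 _ _ zth0 zth l; rewrite lp (ltnW lL) => /(_ isT).
have tl : 0 <= th ^+ 2 * (l%:R : R) ^+ 2 by nneg.
move/(ler_wpM2l tl) => /le_trans; apply.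
rewrite le_eqVlt; apply/orP; left; apply/eqP; field.
by rewrite pnatr_eq0 -lt0n.
Qed.

(** [energy_asymptotics] with half of kappa makes the energy coercive; the power m is chosen so that
    the remainders sum to O(eps^gamma). *)
Lemma macro_energy : exists2 C, 0 < C & small (fun eps => forall n, low_energy eps n ->
  forall N, \sum_(l0 eps <= l < N) l%:R `^ (1 - gamma) * n l <= C * eps `^ gamma).
Proof.
have k0 : 0 < kappa by apply: divr_gt0 => //; apply: mulr_gt0 => //; rewrite subr_gt0.
have [m [C1 C10 hC1]] := tail_sum_small x0 gamma.
have k20 : 0 < kappa / 2 by exact: divr_gt0.
have [C2 [L _ hL]] := @energy_asymptotics R alpha gamma zs q halpha hgamma hzs hq rho0 m _ k20.
exists ((`|CF| / zs + `|C2| * C1) / (kappa / 2) + 1).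
  by apply: ltr_wpDl => //; apply: divr_ge0; [nneg; exact: ltW|exact: ltW].
apply: (small_mono _ (small_and small_le1 (small_l0_large L x0))) => eps e0 [e1 hl] n hn N.
have n0 := low_energy_nonneg hn; have e01 : 0 < eps <= 1 by rewrite e0.
have g0 : 0 < eps `^ gamma by exact: powR_gt0.
have lp := l0_gt0 x0 e01.
rewrite mulrDl mul1r; apply: ler_wpDr; first exact: ltW.
rewrite mulrAC ler_pdivlMr// mulrC mulrDl.
have h1 := low_energy_sum hzs hq N e0 hn lp.
have h2 := ler_wpM2l (normr_ge0 C2) (hC1 _ e01 N); rewrite mulrA in h2.
apply: le_trans (lerD h1 h2).
rewrite !mulr_sumr -big_split/= !big_nat; apply: ler_sum => l /andP[ll _].
have lp' := leq_trans lp ll.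
have nl : 0 <= n l <= rho0 by rewrite n0//= (states_le hn.1).
have := hL _ _ (leq_trans hl ll) nl; rewrite ler_norml => /andP[+ _].
have : C2 / l%:R ^+ m <= `|C2| / l%:R ^+ m.
  by apply: ler_wpM2r (ler_norm _); nneg.
rewrite -/(term n l).
by move: (C2 / _) (`|C2| / _) (l%:R `^ _) (kappa) => u v p k; lra.
Qed.

End MacroStates.

(** * Macroscopic energy density and the rate of convergence of the monomers *)

Section Rates.
Context {R : realType}.
Variables alpha gamma zs q rho0 x CF : R.
Hypotheses (halpha : 0 <= alpha < 1) (hgamma : 0 < gamma < 1).
Hypotheses (hzs : 0 < zs) (hq : 0 < q) (hx : 0 < x < 2^-1).
Implicit Types (z c eps S M r : R) (n : nat -> R) (l N : nat).

Let gt0 : 0 < gamma. Proof. by case/andP: hgamma. Qed.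
Let glt1 : gamma < 1. Proof. by case/andP: hgamma. Qed.
Let x0 : 0 < x. Proof. by case/andP: hx. Qed.
Let a_ge0 : 0 <= alpha. Proof. by case/andP: halpha. Qed.
Let alt1 : alpha < 1. Proof. by case/andP: halpha. Qed.

Local Notation omega := (omega alpha gamma zs q).
Local Notation weight z l := (l%:R `^ alpha * omega z l).
Local Notation diss := (dissipation_term alpha gamma zs q).
Local Notation term := (energy_term alpha gamma zs q).
Local Notation gap := (gap zs q).
Local Notation density := (density alpha gamma zs q).
Local Notation l0 := (l0 x).
Local Notation low_energy := (low_energy alpha gamma zs q rho0 CF).
Local Notation kappa := (q / (zs * (1 - gamma))).

(** The relative error is summed by [macro_energy], which matches the scale eps^(-gamma) exactly;
    the additive remainders sum to O(eps^(gamma+1)), one power of eps to spare. *)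
Lemma F_mac_approx eta : 0 < eta -> small (fun eps => forall n, low_energy eps n ->
  forall N, `|zs * eps `^ (- gamma) * \sum_(l0 eps <= l < N) term n l -
    q / (1 - gamma) * eps `^ (- gamma) *
      \sum_(l0 eps <= l < N) l%:R `^ (1 - gamma) * n l| <= eta).
Proof.
move=> eta0.
have [Cm Cm0 hCm] := @macro_energy R alpha gamma zs q rho0 x CF halpha hgamma hzs hq hx.
have [m [C1 C10 hC1]] := tail_sum_small x0 (gamma + 1).
have e20 : 0 < eta / 2 / (zs * Cm) by rewrite !divr_gt0// mulr_gt0.
have [C2 [L _ hL]] := @energy_asymptotics R alpha gamma zs q halpha hgamma hzs hq rho0 m _ e20.
have e30 : 0 < eta / 2 / (zs * (`|C2| * C1) + 1).
  apply: divr_gt0; first exact: divr_gt0.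
  by apply: ltr_wpDl => //; nneg; exact: ltW.
apply: (small_mono _ (small_and small_le1 (small_and (small_l0_large L x0)
  (small_and hCm (small_powR ltr01 e30))))) => eps e0 [e1 [hl [hm he]]] n hn N.
have n0 := low_energy_nonneg hn; have e01 : 0 < eps <= 1 by rewrite e0.
have lp := l0_gt0 x0 e01.
have p0 : 0 < eps `^ (- gamma) by exact: powR_gt0.
have -> : q / (1 - gamma) * eps `^ (- gamma) =
    zs * eps `^ (- gamma) * kappa by field; rewrite !gt_eqF// subr_gt0.
rewrite -(mulrA (zs * eps `^ (- gamma))) -mulrBr normrM ger0_norm; last by nneg; exact: ltW.
rewrite mulr_sumr -sumrB; apply: (@le_trans _ _ (zs * eps `^ (- gamma) *
   (eta / 2 / (zs * Cm) * \sum_(l0 eps <= l < N) l%:R `^ (1 - gamma) * n l +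
    `|C2| * \sum_(l0 eps <= l < N) ((l%:R : R) ^+ m)^-1))).
  apply: ler_wpM2l; first by nneg; exact: ltW.
  apply: (le_trans (ler_norm_sum _ _ _)).
  rewrite !mulr_sumr -big_split/= !big_nat; apply: ler_sum => l /andP[ll _].
  have lp' := leq_trans lp ll.
  have nl : 0 <= n l <= rho0 by rewrite n0//= (states_le hn.1).
  have := hL _ _ (leq_trans hl ll) nl; rewrite -/(term n l) mulrA => /le_trans; apply.
  rewrite [leRHS]addrC mulrA [leRHS]addrC lerD2l; apply: ler_wpM2r; last exact: ler_norm.
  by nneg.
have h1 := hm _ hn N; have h2 := hC1 _ e01 N.
rewrite powRD_pos ?e0// powRr1 ?(ltW e0)// in h2.
have pp : eps `^ (- gamma) * eps `^ gamma = 1.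
  by rewrite -powRD_pos// addrC subrr powRr0.
have h1' : zs * eps `^ (- gamma) * (eta / 2 / (zs * Cm) *
   \sum_(l0 eps <= l < N) l%:R `^ (1 - gamma) * n l) <= eta / 2.
  have P : 0 <= zs * eps `^ (- gamma) * (eta / 2 / (zs * Cm)).
    by apply: mulr_ge0; [nneg; exact: ltW|exact: ltW].
  rewrite [leLHS]mulrA; apply: (le_trans (ler_wpM2l P h1)).
  rewrite le_eqVlt; apply/orP; left; apply/eqP.
  transitivity (eta / 2 * (eps `^ (- gamma) * eps `^ gamma)); last by rewrite pp mulr1.
  by field; rewrite !gt_eqF.
have h2' : zs * eps `^ (- gamma) * (`|C2| * \sum_(l0 eps <= l < N) ((l%:R : R) ^+ m)^-1) <= eta / 2.
  have P : 0 <= zs * eps `^ (- gamma) * `|C2| by nneg; exact: ltW.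
  rewrite [leLHS]mulrA; apply: (le_trans (ler_wpM2l P h2)).
  have -> : zs * eps `^ (- gamma) * `|C2| * (C1 * (eps `^ gamma * eps)) =
    zs * (`|C2| * C1) * eps * (eps `^ (- gamma) * eps `^ gamma) by ring.
  rewrite pp mulr1; rewrite powRr1 ?(ltW e0)// in he.
  move: he; rewrite ler_pdivlMr; last by apply: ltr_wpDl => //; nneg; exact: ltW.
  by move: e0; lra.
by rewrite mulrDr; lra.
Qed.

Lemma D_eps_partial eps n M a N : 0 < eps -> nonneg n ->
  (D_eps alpha gamma zs q eps n <= M%:E)%E -> (0 < a)%N ->
  (\sum_(a <= l < N) diss n l <= (M / zs * eps `^ (1 - alpha + 2 * gamma))%:E)%E.
Proof.
move=> e0 n0 hM ap.
have p0 : 0 < eps `^ (1 - alpha + 2 * gamma) by exact: powR_gt0.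
have s0 : 0 < D_scale alpha gamma zs eps by exact: divr_gt0.
have d0 l : (1 <= l)%N -> (0 <= diss n l)%E by move=> lp; apply: diss_ge0.
have h : (\sum_(a <= l < N) diss n l <= \sum_(1 <= l <oo) diss n l)%E.
  apply: (@le_trans _ _ (\sum_(1 <= l < N) diss n l)%E); last first.
    by apply: nneseries_lim_ge => l lp _; exact: d0.
  have [aN|Na] := leqP a N; last first.
    rewrite big_geq; last exact: ltnW.
    by rewrite big_nat; apply: sume_ge0 => l /andP[lp _]; exact: d0.
  rewrite (big_cat_nat ap aN)/=; apply: leeDr.
  by rewrite big_nat; apply: sume_ge0 => l /andP[lp _]; exact: d0.
apply: (le_trans h); move: hM; rewrite /D_eps => hM.
have -> : M / zs * eps `^ (1 - alpha + 2 * gamma) = (D_scale alpha gamma zs eps)^-1 * M.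
  by rewrite /D_scale; field; rewrite !gt_eqF.
rewrite EFinM -[leLHS]mul1e -(_ : ((D_scale alpha gamma zs eps)^-1 * D_scale alpha gamma zs eps)%:E = 1%E).
  by rewrite EFinM -muleA; apply: lee_wpmul2l => //; rewrite lee_fin invr_ge0 ltW.
by rewrite mulVf// gt_eqF.
Qed.

Variables rs Rt : R.
Hypothesis hrs : forall N, \sum_(1 <= l < N) l%:R * omega zs l <= rs.
Hypothesis hrho : rs < rho0.
Hypothesis hRt : 0 < Rt.

(* All but a quarter of the excess mass sits below the macroscopic size [Rt]. *)
Definition tight eps n := exists2 N, N%:R <= Rt / eps &
  rho0 - (rho0 - rs) / 4 <= \sum_(1 <= l < N) l%:R * n l.

Local Notation c := ((rho0 - rs) / 4).
Let c0 : 0 < c. Proof. by apply: divr_gt0 => //; rewrite subr_gt0. Qed.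

(** The excess mass is 4 c. By [micro_mass] the clusters below l0 carry at most rs + c, and at most
    c is missing by assumption, so 2 c is left. *)
Lemma macro_mass : small (fun eps => forall n, low_energy eps n -> forall N,
  rho0 - c <= \sum_(1 <= l < N) l%:R * n l ->
  2 * c <= \sum_(l0 eps <= l < N) l%:R * n l).
Proof.
have [C C0 hC] := @micro_mass R alpha gamma zs q rho0 x CF halpha hgamma hzs hq hx.
have g20 : 0 < gamma / 2 by exact: divr_gt0.
apply: (small_mono _ (small_and small_le1 (small_and hC (small_powR g20 (divr_gt0 c0 C0)))))
   => eps e0 [e1 [hm he]] n hn N hN.
have n0 := low_energy_nonneg hn; have e01 : 0 < eps <= 1 by rewrite e0.
have lp := l0_gt0 x0 e01.
have := hm _ hn; rewrite ler_norml => /andP[_].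
have -> : \sum_(1 <= l < l0 eps) l%:R * (n l - omega zs l) =
  \sum_(1 <= l < l0 eps) l%:R * n l - \sum_(1 <= l < l0 eps) l%:R * omega zs l.
  by rewrite -sumrB; apply: eq_bigr => l _; rewrite mulrBr.
have := hrs (l0 eps).
have : C * eps `^ (gamma / 2) <= c by rewrite mulrC -ler_pdivlMr.
have : \sum_(1 <= l < N) l%:R * n l <= \sum_(1 <= l < l0 eps) l%:R * n l +
    \sum_(l0 eps <= l < N) l%:R * n l.
  have [lN|Nl] := leqP (l0 eps) N; first by rewrite -(big_cat_nat lp lN).
  rewrite [X in _ + X]big_geq; last exact: ltnW.
  rewrite addr0; apply: sum_nat_nonneg_le; last exact: ltnW.
  by move=> l l1; exact: states_mass_ge0 hn.1 _ l1.
by move: hN c0; lra.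
Qed.

(** Passing from the mass to l^alpha n_l costs l^(alpha-1), which is bounded below only for sizes
    bounded above: here tightness enters. *)
Lemma alpha_mass_ge eps n a N : 0 < eps -> nonneg n -> (0 < a)%N -> N%:R <= Rt / eps ->
  (Rt / eps) `^ (alpha - 1) * \sum_(a <= l < N) l%:R * n l <=
  \sum_(a <= l < N) l%:R `^ alpha * n l.
Proof.
move=> e0 n0 ap NR; rewrite mulr_sumr !big_nat; apply: ler_sum => l /andP[al lN].
have lp := leq_trans ap al; have lR : 0 < l%:R :> R by rewrite ltr0n.
rewrite mulrA; apply: ler_wpM2r; first exact: n0.
have -> : l%:R `^ alpha = l%:R `^ (alpha - 1) * l%:R :> R.
  by rewrite -[X in _ * X]powRr1// -powRD_pos// subrK.
apply: ler_wpM2r => //.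
have -> : alpha - 1 = - (1 - alpha) by ring.
rewrite !powRN lef_pV2 ?posrE ?powR_gt0 ?divr_gt0//.
apply: ge0_ler_powR; rewrite ?nnegrE ?ler0n//.
- by rewrite subr_ge0 ltW.
- exact: ltW (divr_gt0 _ _).
by apply: le_trans NR; rewrite ler_nat ltnW.
Qed.

Lemma tight_scale eps : 0 < eps -> (Rt / eps) `^ (alpha - 1) =
  Rt `^ (alpha - 1) * eps `^ (1 - alpha).
Proof.
move=> e0; rewrite powRM ?invr_ge0 ?(ltW e0) ?(ltW hRt)//; congr (_ * _).
by rewrite -powR_inv1 ?(ltW e0)// -powRrM; congr (_ `^ _); ring.
Qed.

(** The equilibrium weights beyond l0 are negligible, so the macroscopic mass makes the sum of
    l^alpha omega_l (u_l - 1)^2 at least of order eps^(1-alpha). [hardy_diss_below] compares it with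
    a dissipation of order M eps^(1-alpha+2 gamma). *)
Lemma n1_rate_below : exists2 C, 0 < C & small (fun eps => forall n M, low_energy eps n ->
  tight eps n -> (D_eps alpha gamma zs q eps n <= M%:E)%E -> n 1%N <= zs ->
  (n 1%N - zs) ^+ 2 <= C * M * eps `^ (2 * gamma)).
Proof.
have [m [C1 C10 hC1]] := tail_sum_small x0 2.
have [C2 C20 hC2] := @weight_decay R alpha gamma zs q hgamma hzs hq m.
set A := Rt `^ (alpha - 1) * c; have A0 : 0 < A by apply: mulr_gt0 => //; exact: powR_gt0.
have zq : 0 < zs + q by exact: addr_gt0.
have d0 : 0 < zs / 2 * A by apply: mulr_gt0 => //; exact: divr_gt0.
exists (2 * (2 * (4 * (zs + q) ^+ 2)) / (zs * A) / zs).
  by posi.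
have sA : 0 < A / (2 * (C2 * C1)) by posi.
apply: (small_mono _ (small_and small_le1 (small_and (small_powR ltr01 sA) (small_and macro_mass
  (@n1_window R alpha gamma zs q rho0 x CF hgamma hzs hq hx))))).
move=> eps e0 [e1 [he [hm hw]]] n M hn [N NR hN] hD zzs.
have n0 := low_energy_nonneg hn; have e01 : 0 < eps <= 1 by rewrite e0.
have lp := l0_gt0 x0 e01; have [z1 _ _] := hw _ hn.
have z0 : 0 < n 1%N by apply: lt_le_trans z1; exact: divr_gt0.
set del := zs - n 1%N; set z := n 1%N in z0 z1 zzs del *.
have m1 := hm _ hn _ hN.
have m2 := alpha_mass_ge e0 n0 lp NR.
rewrite tight_scale// in m2.
set E := eps `^ (1 - alpha) in m2; have E0 : 0 < E by exact: powR_gt0.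
set X := \sum_(l0 eps <= l < N) weight z l * (density n l - 1) ^+ 2.
have m3 : \sum_(l0 eps <= l < N) l%:R `^ alpha * n l <=
    2 * (C2 * (C1 * eps `^ 2)) + 2 * X.
  have := hC1 _ e01 N; move/(ler_wpM2l (ltW C20))/(ler_wpM2l (ler0n R 2)) => h.
  apply: le_trans (lerD h (lexx _)); rewrite !mulr_sumr -big_split/= !big_nat.
  apply: ler_sum => l /andP[ll lN]; have lp' := leq_trans lp ll.
  have lR : 0 < l%:R :> R by rewrite ltr0n.
  rewrite [in leLHS](density_sqr alpha gamma hzs hq n0 z0 lp') -/z mulrA.
  have w0 := @weight_gt0 R alpha gamma _ _ hzs hq _ _ z0 lp'.
  have : weight z l <= C2 * ((l%:R : R) ^+ m)^-1.
    rewrite ler_pdivlMr ?exprn_gt0// mulrC; apply: (hC2 l) => //; last by rewrite lp' leqnn.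
    by apply: ler_wpDr => //; nneg; exact: ltW.
  move: (weight z l) w0 (_ ^-1) => W W0 v hv.
  (* This is u^2 <= 2 + 2 (u - 1)^2. *)
  have : 0 <= W * (density n l - 2) ^+ 2 by nneg; exact: ltW.
  by rewrite !expr2; move: hv; lra.
have m4 : A * E <= 2 * X.
  have h1 := ler_wpM2l (ltW (mulr_gt0 (powR_gt0 (alpha - 1) hRt) E0)) m1.
  have h2 : 2 * (C2 * (C1 * eps `^ 2)) <= A * E.
    have -> : eps `^ 2 = eps `^ (1 + alpha) * E by rewrite -powRD_pos//; congr (_ `^ _); ring.
    rewrite !mulrA; apply: ler_wpM2r; first exact: ltW.
    have h3 : eps `^ (1 + alpha) <= eps `^ 1.
      by apply: ger_powR; [rewrite e0|rewrite lerDl].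
    have := le_trans h3 he; rewrite ler_pdivlMr; last by posi.
    by move: (eps `^ _) => p; lra.
  move: h1 m2 m3 h2; rewrite /A; move: (\sum_(_ <= _ < _) _) (\sum_(_ <= _ < _) _) => u v; lra.
have hd : 0 <= (del / (zs + q) / 2) ^+ 2 by exact: sqr_ge0.
have hX : z * (del / (zs + q) / 2) ^+ 2 * X <= M / zs * eps `^ (1 - alpha + 2 * gamma).
  rewrite -lee_fin; apply: le_trans (D_eps_partial N e0 n0 hD (ltn0Sn 0)).
  apply: le_trans (hardy_diss_below alpha hgamma hzs hq N n0 z0 zzs); rewrite lee_fin.
  apply: ler_wpM2l; first by apply: mulr_ge0 => //; exact: ltW.
  have W0 l : (1 <= l)%N -> 0 <= weight z l * (density n l - 1) ^+ 2.
    by move=> l1; apply: mulr_ge0; [rewrite ltW// weight_gt0|exact: sqr_ge0].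
  apply: (@le_trans _ _ (\sum_(1 <= l < N) weight z l * (density n l - 1) ^+ 2)).
    exact: sum_nat_nonneg_ge.
  exact: sum_nat_nonneg_le.
have h5 := ler_wpM2l (mulr_ge0 (ltW z0) hd) m4.
have h6 : zs / 2 * (del / (zs + q) / 2) ^+ 2 * (A * E) <= z * (del / (zs + q) / 2) ^+ 2 * (A * E).
  apply: ler_wpM2r; first by apply: mulr_ge0; exact: ltW.
  exact: ler_wpM2r.
have -> : (z - zs) ^+ 2 = del ^+ 2 by rewrite /del; ring.
have h7 : zs / 2 * (del / (zs + q) / 2) ^+ 2 * (A * E) <= 2 * (M / zs * eps `^ (1 - alpha + 2 * gamma)).
  by move: h5 h6 hX; lra.
have eE : eps `^ (1 - alpha + 2 * gamma) = eps `^ (2 * gamma) * E.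
  by rewrite -powRD_pos//; congr (_ `^ _); ring.
rewrite eE in h7.
have h8 : del ^+ 2 * (zs * A) * E <= 2 * (4 * (zs + q) ^+ 2) * (2 * (M / zs) * eps `^ (2 * gamma)) * E.
  have q0 : 0 <= 2 * (4 * (zs + q) ^+ 2) by nneg; exact: ltW.
  have := ler_wpM2l q0 h7.
  have -> : 2 * (4 * (zs + q) ^+ 2) * (zs / 2 * (del / (zs + q) / 2) ^+ 2 * (A * E)) =
     del ^+ 2 * (zs * A) * E by field; rewrite gt_eqF.
  by move/le_trans; apply; rewrite le_eqVlt; apply/orP; left; apply/eqP; ring.
rewrite ler_pM2r// -ler_pdivlMr in h8; last exact: mulr_gt0.
apply: (le_trans h8); rewrite le_eqVlt; apply/orP; left; apply/eqP.
by field; rewrite !gt_eqF.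
Qed.

End Rates.

(** * Energy estimates for tight states *)

Section TightStates.
Context {R : realType}.
Variables alpha gamma zs q rho0 x CF : R.
Hypotheses (halpha : 0 <= alpha < 1) (hgamma : 0 < gamma < 1).
Hypotheses (hzs : 0 < zs) (hq : 0 < q) (hx : 0 < x < 2^-1).
Implicit Types (z eps S M r : R) (n : nat -> R) (l N : nat).

Let gt0 : 0 < gamma. Proof. by case/andP: hgamma. Qed.
Let glt1 : gamma < 1. Proof. by case/andP: hgamma. Qed.
Let x0 : 0 < x. Proof. by case/andP: hx. Qed.
Let alt1 : alpha < 1. Proof. by case/andP: halpha. Qed.

Local Notation omega := (omega alpha gamma zs q).
Local Notation weight z l := (l%:R `^ alpha * omega z l).
Local Notation term := (energy_term alpha gamma zs q).
Local Notation gap := (gap zs q).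
Local Notation density := (density alpha gamma zs q).
Local Notation l0 := (l0 x).
Local Notation low_energy := (low_energy alpha gamma zs q rho0 CF).

Variables rs Rt : R.
Hypothesis hrs : forall N, \sum_(1 <= l < N) l%:R * omega zs l <= rs.
Hypothesis hrho : rs < rho0.
Hypothesis hRt : 0 < Rt.
Local Notation tight := (tight rho0 rs Rt).
Local Notation c := ((rho0 - rs) / 4).
Let c0 : 0 < c. Proof. by apply: divr_gt0 => //; rewrite subr_gt0. Qed.

(** If n_1 - zs is at most K eps^gamma nothing is to be shown, as M >= 1. Otherwise the critical
    size m, beyond which growth wins, is at most of order 1/eps, with a factor so small that the
    energy bound leaves at most c of the mass between l0 and m. Mass c then lies beyond m, and
    [hardy_diss_above] applies. *)
Lemma n1_rate_above : exists2 C, 0 < C & small (fun eps => forall n M, low_energy eps n ->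
  tight eps n -> 1 <= M -> (D_eps alpha gamma zs q eps n <= M%:E)%E -> zs <= n 1%N ->
  (n 1%N - zs) ^+ 2 <= C * M * eps `^ (2 * gamma)).
Proof.
have [Ce Ce0 hCe] := @macro_energy R alpha gamma zs q rho0 x CF halpha hgamma hzs hq hx.
have [Cn Cn0 hCn] := @n1_near R alpha gamma zs q rho0 CF hgamma hzs hq.
(* Chosen so that the mass between l0 and m comes out as (2^gamma / 2) c, which is at most c. *)
set K := Ce * 4 * q / c; have K0 : 0 < K by posi.
set A := Rt `^ (alpha - 1) * c; have A0 : 0 < A by posi.
exists (K ^+ 2 + 2 * (8 * zs) ^+ 2 / (zs * A) / zs); first by posi.
have g20 : 0 < gamma / 2 by posi.
have zC : 0 < zs / Cn by posi.
set r0 := (2 * q / K) `^ gamma^-1; have r00 : 0 < r0 by posi.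
apply: (small_mono _ (small_and small_le1 (small_and (small_powR ltr01 r00) (small_and (small_powR g20 zC)
  (small_and hCe (@macro_mass R alpha gamma zs q rho0 x CF halpha hgamma hzs hq hx rs hrs hrho)))))).
move=> eps e0 [e1 [er [hn1 [hE hm]]]] n M hn [N NR hN] M1 hD zsz.
have n0 := low_energy_nonneg hn; have e01 : 0 < eps <= 1 by rewrite e0.
have lp := l0_gt0 x0 e01.
set del := n 1%N - zs; set z := n 1%N in zsz del *.
have M0 : 0 <= M by lra.
have p20 : 0 <= eps `^ (2 * gamma) by exact: powR_ge0.
have p2E : eps `^ (2 * gamma) = (eps `^ gamma) ^+ 2.
  by rewrite expr2 -powRD_pos//; congr (_ `^ _); ring.
have B0 : 0 <= 2 * (8 * zs) ^+ 2 / (zs * A) / zs by apply: ltW; posi.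
have [dK|dK] := leP del (K * eps `^ gamma).
  have d0 : 0 <= del by rewrite subr_ge0.
  apply: (@le_trans _ _ (K ^+ 2 * eps `^ (2 * gamma))).
    by rewrite p2E -exprMn lerXn2r// nnegrE//; nneg; exact: ltW.
  apply: ler_wpM2r => //; rewrite mulrDl.
  have K2 : 0 <= K ^+ 2 by exact: sqr_ge0.
  by have := ler_wpM2l K2 M1; have := mulr_ge0 B0 M0; lra.
have Kp : 0 < K * eps `^ gamma by posi.
have d0 : 0 < del by exact: lt_trans dK.
have dzs : del <= zs.
  have := hCn _ _ e01 hn; rewrite -/z -/del ger0_norm ?(ltW d0)// => /le_trans; apply.
  by rewrite mulrC -ler_pdivlMr.
have z0 : 0 < z by apply: lt_le_trans zsz.
(* The size from which on q l^(-gamma) <= del/2. *)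
pose m := (Num.truncn ((2 * q / del) `^ gamma^-1)).+1.
have y0 : 0 < (2 * q / del) `^ gamma^-1 by posi.
have qm : q * m%:R `^ (- gamma) <= del / 2.
  have : 2 * q / del <= m%:R `^ gamma.
    have -> : 2 * q / del = ((2 * q / del) `^ gamma^-1) `^ gamma.
      by rewrite -powRrM mulVf ?gt_eqF// powRr1//; apply: ltW; posi.
    apply: ge0_ler_powR; rewrite ?nnegrE ?ler0n ?powR_ge0//; first exact: ltW.
    exact: ltW (truncnS_gt _).
  rewrite powRN ler_pdivrMr// => h.
  by rewrite ler_pdivrMr ?powR_gt0// mulrC; lra.
have mr : m%:R <= 2 * (r0 / eps).
  have h1 : (2 * q / del) `^ gamma^-1 <= r0 / eps.
    have -> : r0 / eps = (2 * q / (K * eps `^ gamma)) `^ gamma^-1.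
      rewrite invfM mulrA powRM ?invr_ge0 ?powR_ge0//; last by apply: ltW; posi.
      by rewrite -powRN -powRrM mulNr divff ?gt_eqF// powR_inv1// ltW.
    apply: ge0_ler_powR; rewrite ?nnegrE ?invr_ge0 ?(ltW gt0)//; do ?[by apply: ltW; posi].
    by apply: ler_wpM2l; [apply: ltW; posi|rewrite lef_pV2 ?posrE// ltW].
  have h2 : 1 <= r0 / eps by rewrite ler_pdivlMr// mul1r; rewrite powRr1 ?(ltW e0)// in er.
  have : m%:R <= (2 * q / del) `^ gamma^-1 + 1 by rewrite /m -natr1 lerD2r truncn_le ltW.
  by lra.
have rg : r0 `^ gamma = 2 * q / K.
  by rewrite /r0 -powRrM mulVf ?gt_eqF// powRr1//; apply: ltW; posi.
(* The mass is l^gamma times l^(1-gamma) n_l; the first factor is at most (2 r0 / eps)^gamma, and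
   [macro_energy] bounds the sum of the second by Ce eps^gamma. *)
have mass_m : \sum_(l0 eps <= l < m) l%:R * n l <= c.
  apply: (@le_trans _ _ ((2 * (r0 / eps)) `^ gamma * (\sum_(l0 eps <= l < m) l%:R `^ (1 - gamma) * n l))).
    rewrite mulr_sumr !big_nat; apply: ler_sum => l /andP[ll lm].
    have lp' := leq_trans lp ll; have lR : 0 < l%:R :> R by rewrite ltr0n.
    rewrite mulrA; apply: ler_wpM2r; first exact: n0.
    have lE : l%:R = l%:R `^ gamma * l%:R `^ (1 - gamma) :> R.
      by rewrite -powRD_pos// addrC subrK powRr1// ltW.
    rewrite [leLHS]lE.
    apply: ler_wpM2r; first exact: powR_ge0.
    apply: ge0_ler_powR; rewrite ?nnegrE ?ler0n//; first exact: ltW.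
      by apply: ltW; posi.
    by apply: le_trans mr; rewrite ler_nat ltnW.
  have := hE _ hn m; have pos : 0 <= (2 * (r0 / eps)) `^ gamma by exact: powR_ge0.
  move/(ler_wpM2l pos) => /le_trans; apply.
  rewrite powRM//; last by apply: ltW; posi.
  rewrite powRM ?invr_ge0 ?(ltW e0) ?(ltW r00)// rg.
  rewrite (powR_invl _ e0).
  have -> : 2 `^ gamma * (2 * q / K * (eps `^ gamma)^-1) * (Ce * eps `^ gamma) =
     2 `^ gamma / 2 * c.
    by rewrite /K; field; rewrite !gt_eqF// ?subr_gt0// powR_gt0.
  rewrite ler_piMl ?(ltW c0)// ler_pdivrMr// mul1r -[leRHS]powRr1//.
  by rewrite ler_powR ?(ltW glt1)// ler1n.
have m1 := hm _ hn _ hN.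
have mp : (0 < m)%N by [].
have massm2 : c <= \sum_(m <= l < N) l%:R * n l.
  have : \sum_(l0 eps <= l < N) l%:R * n l <= \sum_(l0 eps <= l < m) l%:R * n l +
     \sum_(m <= l < N) l%:R * n l.
    have m0 a l : (0 < a)%N -> (a <= l)%N -> 0 <= l%:R * n l.
      by move=> ap al; apply: (states_mass_ge0 hn.1); exact: leq_trans al.
    have [lm|ml] := leqP (l0 eps) m.
      have [mN|Nm] := leqP m N; first by rewrite -(big_cat_nat lm mN).
      rewrite [X in _ + X]big_geq; last exact: ltnW.
      rewrite addr0; apply: sum_nat_nonneg_le; last exact: ltnW.
      by move=> l; exact: m0.
    rewrite [X in X + _]big_geq; last exact: ltnW.
    rewrite add0r; apply: sum_nat_nonneg_ge; last exact: ltnW.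
    by move=> l; exact: m0.
  by lra.
set E := eps `^ (1 - alpha); have E0 : 0 < E by exact: powR_gt0.
have AE : A * E <= \sum_(m <= l < N) l%:R `^ alpha * n l.
  apply: (le_trans _ (alpha_mass_ge halpha hRt e0 n0 mp NR)).
  rewrite (tight_scale alpha hRt e0) /A -mulrA [c * _]mulrC mulrA.
  by apply: ler_wpM2l => //; nneg; exact: ltW.
set Y := M / zs * eps `^ (1 - alpha + 2 * gamma).
have Y0 : 0 < Y by apply: mulr_gt0; [apply: divr_gt0 => //; lra|posi].
(* The summation goes on until the boundary term of the Hardy inequality is no larger than the
   dissipation bound Y. *)
have [N1 hN1] := states_mass_cvg0 hn.1 (divr_gt0 Y0 z0).
pose N2 := maxn N1 (maxn m N).
have key : del ^+ 2 / (8 * zs) ^+ 2 * (z * (A * E)) <= 2 * Y.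
  have := @hardy_diss_above R alpha gamma zs q halpha hgamma hzs hq n del m N2 n0 d0 dzs.
  rewrite -/z {1}/del addrC subrK => /(_ (lexx _) mp qm).
  rewrite !leq_max leqnn orbT => /(_ isT) h.
  rewrite -lee_fin; apply: le_trans (le_trans h _); last first.
    apply: (@le_trans _ _ (Y%:E + Y%:E)%E); last by rewrite -EFinD lee_fin; lra.
    apply: leeD; first exact: D_eps_partial.
    rewrite lee_fin mulrC -ler_pdivlMr//; apply: hN1.
    by rewrite leq_max leqnn.
  rewrite lee_fin; apply: ler_wpM2l; first by apply: ltW; posi.
  have -> : \sum_(m <= l < N2) z * l%:R `^ alpha * n l = z * \sum_(m <= l < N2) l%:R `^ alpha * n l.
    by rewrite mulr_sumr; apply: eq_bigr => l _; rewrite mulrA.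
  rewrite ler_pM2l//; apply: (le_trans AE); apply: sum_nat_nonneg_le.
    by move=> l ml; apply: mulr_ge0; [exact: powR_ge0|apply: n0; exact: leq_trans ml].
  by rewrite !leq_max leqnn !orbT.
have eE : eps `^ (1 - alpha + 2 * gamma) = eps `^ (2 * gamma) * E.
  by rewrite -powRD_pos//; congr (_ `^ _); ring.
have h1 : del ^+ 2 * (zs * A) * E <= 2 * (8 * zs) ^+ 2 * (M / zs) * eps `^ (2 * gamma) * E.
  have s8 : 0 < (8 * zs) ^+ 2 by posi.
  have := ler_wpM2l (ltW s8) key.
  have -> : (8 * zs) ^+ 2 * (del ^+ 2 / (8 * zs) ^+ 2 * (z * (A * E))) = del ^+ 2 * (z * (A * E)).
    by field; rewrite gt_eqF.
  have zz : del ^+ 2 * (zs * (A * E)) <= del ^+ 2 * (z * (A * E)).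
    by apply: ler_wpM2l; [exact: sqr_ge0|apply: ler_wpM2r => //; apply: ltW; posi].
  by rewrite /Y eE; move: zz; lra.
rewrite ler_pM2r// -ler_pdivlMr in h1; last by posi.
apply: (le_trans h1).
apply: (@le_trans _ _ (2 * (8 * zs) ^+ 2 / (zs * A) / zs * M * eps `^ (2 * gamma))).
  by rewrite le_eqVlt; apply/orP; left; apply/eqP; field; rewrite !gt_eqF.
have := mulr_ge0 (mulr_ge0 (sqr_ge0 K) M0) p20.
by move: (2 * _ / _ / _) => v; lra.
Qed.

Lemma n1_rate : exists2 C, 0 < C & small (fun eps => forall n M, low_energy eps n ->
  tight eps n -> 1 <= M -> (D_eps alpha gamma zs q eps n <= M%:E)%E ->
  `|n 1%N - zs| <= C * Num.sqrt M * eps `^ gamma).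
Proof.
have [C1 C10 h1] := n1_rate_above.
have [C2 C20 h2] := @n1_rate_below R alpha gamma zs q rho0 x CF halpha hgamma hzs hq hx rs Rt hrs hrho hRt.
exists (Num.sqrt (C1 + C2)); first by rewrite sqrtr_gt0 addr_gt0.
apply: (small_mono _ (small_and h1 h2)) => eps e0 {h1 h2}[h1 h2] n M hn ht M1 hD.
have M0 : 0 <= M by lra.
apply: norm_le_of_sqr; first by nneg.
have p20 : 0 <= eps `^ (2 * gamma) by exact: powR_ge0.
have -> : (Num.sqrt (C1 + C2) * Num.sqrt M * eps `^ gamma) ^+ 2 =
    (C1 + C2) * M * eps `^ (2 * gamma).
  rewrite !exprMn !sqr_sqrtr//; last by rewrite ltW// addr_gt0.
  by congr (_ * _); rewrite expr2 -powRD_pos//; congr (_ `^ _); ring.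
have [zz|zz] := leP (n 1%N) zs.
  apply: (le_trans (h2 _ _ hn ht hD zz)); apply: ler_wpM2r => //; apply: ler_wpM2r => //.
  by rewrite lerDr ltW.
apply: (le_trans (h1 _ _ hn ht M1 hD (ltW zz))); apply: ler_wpM2r => //; apply: ler_wpM2r => //.
by rewrite lerDl ltW.
Qed.

(** An identity up to the dropped term omega_l(zs) (exp(s l) - 1 - s l) >= 0, where s = ln(n_1 / zs)
    and omega_l(n_1) = omega_l(zs) exp(s l). *)
Lemma term_le_shift n l : nonneg n -> 0 < n 1%N -> (0 < l)%N ->
  term n l <= omega (n 1%N) l * psi (n l / omega (n 1%N) l) +
    ln (n 1%N / zs) * (l%:R * (n l - omega zs l)).
Proof.
move=> n0 z0 lp; set s := ln (n 1%N / zs).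
have ez : n 1%N = zs * expR s by rewrite /s lnK ?posrE ?divr_gt0// mulrC divfK// gt_eqF.
have w0 := @omega_gt0 R alpha gamma _ _ hzs hq _ _ hzs lp.
have w1 := @omega_gt0 R alpha gamma _ _ hzs hq _ _ z0 lp.
have wE : omega (n 1%N) l = omega zs l * expR (s * l%:R) by rewrite {1}ez omega_zexp.
have e2 := expR_taylor2_ge0 (s * l%:R).
have h := mulr_ge0 (ltW w0) e2.
rewrite /energy_term /psi.
have -> : omega zs l * (n l / omega zs l * ln (n l / omega zs l) - n l / omega zs l + 1) =
    n l * ln (n l / omega zs l) - n l + omega zs l by field; rewrite gt_eqF.
have -> : omega (n 1%N) l * (n l / omega (n 1%N) l * ln (n l / omega (n 1%N) l) -
     n l / omega (n 1%N) l + 1) =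
    n l * ln (n l / omega (n 1%N) l) - n l + omega (n 1%N) l by field; rewrite gt_eqF.
have -> : n l * ln (n l / omega zs l) = n l * ln (n l / omega (n 1%N) l) + n l * (s * l%:R).
  have := n0 _ lp; rewrite le_eqVlt => /predU1P[<-|nl0]; first by rewrite !mul0r addr0.
  rewrite !ln_div ?posrE// wE lnM ?posrE ?expR_gt0// expRK; ring.
by rewrite wE in w1 *; move: h; lra.
Qed.

(** [H_mic_bound] handles the energy relative to omega(n_1). The shift to omega(zs) costs |ln(n_1 /
    zs)| times the mass defect, eps^gamma times eps^(gamma/2), so a factor eps^(gamma/2) survives
    the scaling. *)
Lemma F_mic_bound : exists2 C, 0 < C & small (fun eps => forall n M, low_energy eps n ->
  tight eps n -> 1 <= M -> (D_eps alpha gamma zs q eps n <= M%:E)%E ->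
  0 <= F_mic alpha gamma zs q x eps n <=
    C * (M * eps `^ ((1 - x) * (1 - alpha + gamma)) + Num.sqrt M * eps `^ (gamma / 2))).
Proof.
have [C1 C10 h1] := n1_rate.
have [C2 C20 h2] := @micro_mass R alpha gamma zs q rho0 x CF halpha hgamma hzs hq hx.
have [C3 C30 h3] := @H_mic_bound R alpha gamma zs q rho0 x CF halpha hgamma hzs hq hx.
exists (C3 + zs * (2 / zs * C1) * C2); first by posi.
apply: (small_mono _ (small_and h1 (small_and h2 (small_and h3
  (@n1_window R alpha gamma zs q rho0 x CF hgamma hzs hq hx)))))
  => eps e0 {h1 h2 h3}[h1 [h2 [h3 h4]]] n M hn ht M1 hD.
have n0 := low_energy_nonneg hn; have M0 : 0 <= M by lra.
have [z1 _ _] := h4 _ hn.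
have z0 : 0 < n 1%N by apply: lt_le_trans z1; posi.
have p0 : 0 < eps `^ (- gamma) by exact: powR_gt0.
apply/andP; split.
  apply: mulr_ge0; first by apply: ltW; posi.
  rewrite big_nat; apply: sumr_ge0 => l /andP[lp _].
  exact: (@term_ge0 R alpha gamma zs q hzs hq).
set s := ln (n 1%N / zs).
(* n_1 >= zs/2 makes the logarithm Lipschitz with constant 2/zs. *)
have hs : `|s| <= 2 / zs * (C1 * Num.sqrt M * eps `^ gamma).
  have hd := h1 _ _ hn ht M1 hD.
  apply: le_trans (_ : 2 / zs * `|n 1%N - zs| <= _); last by rewrite ler_pM2l// divr_gt0.
  rewrite ler_norml; apply/andP; split.
    rewrite lerNl /s -lnV ?posrE ?divr_gt0// invf_div.
    apply: (le_trans (ln_le_subr1 (divr_gt0 hzs z0))).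
    rewrite lerBlDr ler_pdivrMr// mulrDl mul1r.
    have a0 : 0 <= 2 / zs * `|n 1%N - zs| by nneg; exact: ltW.
    have := ler_wpM2l a0 z1.
    have -> : 2 / zs * `|n 1%N - zs| * (zs / 2) = `|n 1%N - zs| by field; rewrite gt_eqF.
    by have := ler_norm (zs - n 1%N); rewrite distrC; lra.
  apply: (le_trans (ln_le_subr1 (divr_gt0 z0 hzs))).
  rewrite lerBlDr ler_pdivrMr// mulrDl mul1r.
  have -> : 2 / zs * `|n 1%N - zs| * zs = 2 * `|n 1%N - zs| by field; rewrite gt_eqF.
  by have := ler_norm (n 1%N - zs); have := normr_ge0 (n 1%N - zs); lra.
set H := \sum_(1 <= l < l0 eps) omega (n 1%N) l * psi (n l / omega (n 1%N) l).
have hH : H <= C3 * eps `^ (- (x * (1 - alpha + gamma))) * (M / zs * eps `^ (1 - alpha + 2 * gamma)).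
  rewrite -lee_fin.
  have -> : (H%:E = H_mic alpha gamma zs q x eps n (n 1%N))%E.
    rewrite /H /H_mic -sumEFin !big_nat; apply: eq_bigr => l /andP[lp _].
    by rewrite /entropy gt_eqF// omega_gt0.
  apply: (le_trans (h3 _ hn)); rewrite [leRHS]EFinM; apply: lee_wpmul2l.
    by rewrite lee_fin; nneg; exact: ltW.
  exact: D_eps_partial.
set T := \sum_(1 <= l < l0 eps) l%:R * (n l - omega zs l).
have hF : \sum_(1 <= l < l0 eps) term n l <= H + `|s| * `|T|.
  apply: (@le_trans _ _ (H + s * T)); last by rewrite lerD2l -normrM ler_norm.
  rewrite /H /T mulr_sumr -big_split/= !big_nat; apply: ler_sum => l /andP[lp _].
  exact: term_le_shift.
have hT := h2 _ hn; rewrite -/T in hT.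
have hsT := ler_pM (normr_ge0 _) (normr_ge0 _) hs hT.
rewrite /F_mic /F_scale.
apply: (@le_trans _ _ (zs * eps `^ (- gamma) * (C3 * eps `^ (- (x * (1 - alpha + gamma))) * (M / zs * eps `^ (1 - alpha + 2 * gamma)) + 2 / zs * (C1 * Num.sqrt M * eps `^ gamma) * (C2 * eps `^ (gamma / 2))))).
  by apply: ler_wpM2l; [apply: ltW; posi|move: hF hH hsT; lra].
have q1 : eps `^ (- gamma) * eps `^ gamma = 1 by rewrite -powRD_pos// addrC subrr powRr0.
have q2 : eps `^ (- gamma) * (eps `^ (- (x * (1 - alpha + gamma))) * eps `^ (1 - alpha + 2 * gamma)) =
    eps `^ ((1 - x) * (1 - alpha + gamma)).
  by rewrite -!powRD_pos//; congr (_ `^ _); ring.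
set e3 := eps `^ ((1 - x) * _) in q2 *.
have e30 : 0 <= e3 by exact: powR_ge0.
have -> : zs * eps `^ (- gamma) * (C3 * eps `^ (- (x * (1 - alpha + gamma))) * (M / zs * eps `^ (1 - alpha + 2 * gamma)) + 2 / zs * (C1 * Num.sqrt M * eps `^ gamma) * (C2 * eps `^ (gamma / 2))) =
  C3 * M * (eps `^ (- gamma) * (eps `^ (- (x * (1 - alpha + gamma))) * eps `^ (1 - alpha + 2 * gamma))) +
  zs * (2 / zs * C1) * C2 * Num.sqrt M * eps `^ (gamma / 2) * (eps `^ (- gamma) * eps `^ gamma).
  by field; rewrite gt_eqF.
rewrite q1 q2.
have b1 : 0 <= C3 * (Num.sqrt M * eps `^ (gamma / 2)) by nneg; exact: ltW.
have b2 : 0 <= zs * (2 / zs * C1) * C2 * (M * e3) by nneg; exact: ltW.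
by move: b1 b2; lra.
Qed.

(** By [n1_rate] the window for n_1 holds up to size r/eps, provided r^gamma sqrt(M) is small; this
    is the condition with [C0]. The Hardy inequality up to that size bounds the part far from
    equilibrium, and the equilibrium weights beyond l0 contribute O(eps^(gamma+1)). *)
Lemma small_clusters : exists2 C0, 0 < C0 & exists2 C, 0 < C &
  small (fun eps => forall n M r, low_energy eps n -> tight eps n -> 1 <= M ->
    (D_eps alpha gamma zs q eps n <= M%:E)%E -> 0 < r ->
    C0 * Num.sqrt M * r `^ gamma <= 1 -> forall N, N%:R <= r / eps ->
    \sum_(l0 eps <= l < N.+1) l%:R `^ (1 - gamma) * n l <=
    C * eps `^ gamma * (eps + r `^ (1 - alpha + gamma) * M)).
Proof.
have [C1 C10 h1] := n1_rate.
have [m [C2 C20 h2]] := tail_sum_small x0 (gamma + 1).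
have [C3 C30 h3] := @omega_decay R alpha gamma zs q halpha hgamma hzs hq m.+1.
have gp := @gap_gt0 R _ _ hzs hq.
exists (C1 / (q / 2)); first by posi.
set b := zs / 2 * (gap / 2) ^+ 2.
have b0 : 0 < b by apply: mulr_gt0; [|apply: exprn_gt0]; exact: divr_gt0.
exists (2 * (C3 * C2) + 2 / (b * zs)); first by posi.
apply: (small_mono _ (small_and h1 (small_and small_le1
  (@n1_window R alpha gamma zs q rho0 x CF hgamma hzs hq hx))))
  => eps e0 {h1}[h1 [e1 h4]] n M r hn ht M1 hD r0 hr N hN.
have n0 := low_energy_nonneg hn; have M0 : 0 <= M by lra.
have e01 : 0 < eps <= 1 by rewrite e0.
have lp := l0_gt0 x0 e01.
have [z1 _ _] := h4 _ hn.
have z0 : 0 < n 1%N by apply: lt_le_trans z1; posi.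
have g0 : 0 < eps `^ gamma by exact: powR_gt0.
case: N => [|N] in hN *.
  rewrite big_geq//; apply: mulr_ge0; first by nneg; exact: ltW.
  by nneg; exact: ltW.
(* N+1 may exceed r/eps, but the window is needed at N+1 only, where N is the original index
   decreased by one. *)
have zN : n 1%N <= zs + q / 2 * N.+1%:R `^ (- gamma).
  have hd := h1 _ _ hn ht M1 hD.
  have h5 : eps `^ gamma * (r `^ gamma)^-1 <= N.+1%:R `^ (- gamma).
    rewrite powRN -[eps `^ gamma]invrK -invfM lef_pV2 ?posrE ?powR_gt0//; last by rewrite mulr_gt0 ?invr_gt0 ?powR_gt0.
    rewrite -powRN -(mulN1r gamma) powRrM powR_inv1 ?(ltW e0)//.
    rewrite -powRM ?invr_ge0 ?(ltW e0) ?(ltW r0)//.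
    apply: ge0_ler_powR; rewrite ?nnegrE ?ler0n ?(ltW gt0)//; first by apply: ltW; apply: mulr_gt0; rewrite ?invr_gt0.
    by rewrite mulrC.
  have h6 : C1 * Num.sqrt M * r `^ gamma <= q / 2.
    have q20 : 0 < q / 2 by posi.
    have := ler_wpM2l (ltW q20) hr; rewrite mulr1.
    by have -> : q / 2 * (C1 / (q / 2) * Num.sqrt M * r `^ gamma) = C1 * Num.sqrt M * r `^ gamma by field; rewrite gt_eqF.
  have rg : 0 < r `^ gamma by exact: powR_gt0.
  rewrite -ler_pdivlMr// in h6.
  have h7 := ler_wpM2r (ltW g0) h6.
  have h8 := ler_wpM2l (ltW (divr_gt0 hq (ltr0Sn R 1))) h5.
  by have := ler_norm (n 1%N - zs); move: hd h7 h8; lra.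
set E := r `^ (1 - alpha + gamma); have E0 : 0 < E by exact: powR_gt0.
set S := \sum_(1 <= l < N.+2) weight (n 1%N) l * (l%:R `^ (- gamma)) ^+ 2 * (density n l - 1) ^+ 2.
have S0 l : (0 < l)%N -> 0 <= weight (n 1%N) l * (l%:R `^ (- gamma)) ^+ 2 * (density n l - 1) ^+ 2.
  by move=> lp'; do 2 (apply: mulr_ge0; last exact: sqr_ge0); rewrite ltW// weight_gt0.
have hS : b * S <= M / zs * eps `^ (1 - alpha + 2 * gamma).
  rewrite -lee_fin; apply: le_trans (@D_eps_partial R alpha gamma zs q hzs hq eps n M 1 N.+1 e0 n0 hD isT).
  apply: le_trans (hardy_diss_gap alpha hgamma hzs hq n0 z0 zN); rewrite lee_fin.
  apply: ler_wpM2r; first by rewrite /S big_nat; apply: sumr_ge0 => l /andP[lp' _]; exact: S0.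
  by apply: ler_wpM2r => //; exact: sqr_ge0.
apply: (@le_trans _ _ (2 * (C3 * (C2 * eps `^ (gamma + 1))) +
    2 * ((r / eps) `^ (1 - alpha + gamma) * S))).
  have := h2 _ e01 N.+2; move/(ler_wpM2l (ltW C30))/(ler_wpM2l (ler0n R 2)) => h.
  have S1 : \sum_(l0 eps <= l < N.+2) weight (n 1%N) l * (l%:R `^ (- gamma)) ^+ 2 * (density n l - 1) ^+ 2 <= S.
    exact: sum_nat_nonneg_ge.
  have re : 0 <= (r / eps) `^ (1 - alpha + gamma) by exact: powR_ge0.
  have {}S1 := ler_wpM2l (ler0n R 2) (ler_wpM2l re S1).
  apply: le_trans (lerD h S1); rewrite !mulr_sumr -big_split/= !big_nat.
  apply: ler_sum => l /andP[ll lN]; have lp' := leq_trans lp ll.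
  have lR : 0 < l%:R :> R by rewrite ltr0n.
  rewrite [in leLHS](density_sqr alpha gamma hzs hq n0 z0 lp').
  have w0 := @omega_gt0 R alpha gamma _ _ hzs hq _ _ z0 lp'.
  have wd : l%:R `^ (1 - gamma) * omega (n 1%N) l <= C3 * ((l%:R : R) ^+ m)^-1.
    have := h3 _ _ z0 zN l; rewrite lp' -ltnS lN => /(_ isT).
    rewrite ler_pdivlMr ?exprn_gt0// exprS mulrA => h'.
    rewrite ler_pdivlMr ?exprn_gt0//; apply: le_trans h'; apply: ler_wpM2r; first by nneg.
    rewrite mulrC; apply: ler_wpM2l; first exact: ltW.
    rewrite -[leRHS]powRr1// ler_powR ?ler1n//; move: gt0; lra.
  have we : l%:R `^ (1 - gamma) * omega (n 1%N) l <=
      (r / eps) `^ (1 - alpha + gamma) * (weight (n 1%N) l * (l%:R `^ (- gamma)) ^+ 2).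
    have -> : l%:R `^ (1 - gamma) * omega (n 1%N) l =
       l%:R `^ (1 - alpha + gamma) * (weight (n 1%N) l * (l%:R `^ (- gamma)) ^+ 2).
      have -> : 1 - gamma = alpha + (- gamma + (- gamma + (1 - alpha + gamma))) by ring.
      by rewrite !(powRD_pos _ _ lR); ring.
    apply: ler_wpM2r; first by apply: mulr_ge0; [rewrite ltW// weight_gt0|exact: sqr_ge0].
    apply: ge0_ler_powR; rewrite ?nnegrE ?ler0n//.
    - by move: alt1 gt0; lra.
    - by apply: ltW; posi.
    by apply: le_trans hN; rewrite ler_nat -ltnS.
  have v0 : 0 <= (density n l - 1) ^+ 2 by exact: sqr_ge0.
  have := ler_wpM2r v0 we; move: wd (mulr_ge0 (powR_ge0 (l%:R : R) (1 - gamma)) (ltW w0)).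
  have -> : l%:R `^ (1 - gamma) * (omega (n 1%N) l * density n l ^+ 2) =
     l%:R `^ (1 - gamma) * omega (n 1%N) l * density n l ^+ 2 by rewrite mulrA.
  set V := _ * (_ * _ ^+ 2) in we *.
  have -> : (r / eps) `^ (1 - alpha + gamma) * (weight (n 1%N) l * l%:R `^ (- gamma) ^+ 2 *
     (density n l - 1) ^+ 2) = V * (density n l - 1) ^+ 2 by rewrite /V; ring.
  move: (_ * omega _ _) (_ ^-1) V {we} => W v V wd W0 V0.
  (* Again u^2 <= 2 + 2 (u - 1)^2. *)
  have : 0 <= W * (density n l - 2) ^+ 2 by apply: mulr_ge0 => //; exact: sqr_ge0.
  by move: wd V0; rewrite !expr2; lra.
have eE : (r / eps) `^ (1 - alpha + gamma) * eps `^ (1 - alpha + 2 * gamma) = E * eps `^ gamma.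
  rewrite powRM ?invr_ge0 ?(ltW e0) ?(ltW r0)// -/E -mulrA; congr (_ * _).
  by rewrite -powR_inv1 ?(ltW e0)// -powRrM -powRD_pos//; congr (_ `^ _); ring.
have re : 0 <= (r / eps) `^ (1 - alpha + gamma) by exact: powR_ge0.
have hb : (r / eps) `^ (1 - alpha + gamma) * S <= E * eps `^ gamma * M / (b * zs).
  rewrite ler_pdivlMr; last by posi.
  have := ler_wpM2l re hS; move/(ler_wpM2r (ltW hzs)).
  have -> : (r / eps) `^ (1 - alpha + gamma) * (M / zs * eps `^ (1 - alpha + 2 * gamma)) * zs =
    (r / eps) `^ (1 - alpha + gamma) * eps `^ (1 - alpha + 2 * gamma) * M by field; rewrite gt_eqF.
  by rewrite eE; lra.
rewrite powRD_pos// powRr1 ?(ltW e0)//.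
have c1 : 0 <= 2 * (C3 * C2) * eps `^ gamma * (E * M) by nneg; exact: ltW.
have c2 : 0 <= 2 / (b * zs) * eps `^ gamma * eps by nneg; exact: ltW.
by move: hb c1 c2; lra.
Qed.

End TightStates.

(** * Propagation of tightness *)

Section WeakDerivative.
Context {R : realType}.
Implicit Types (s t h T : R).

(* [smoothstep] is a C^1 transition from 0 to 1 on [0, 1], with derivative [tent]. *)
Definition ramp (y : R) : R := y * Num.max y 0.

Lemma is_derive_ramp (y : R) : is_derive y 1 ramp (2 * Num.max y 0).
Proof.
have [y0|y0|->] := ltgtP y 0.
- apply: (@near_eq_is_derive _ _ _ (cst 0)).
    near=> z; have z0 : z <= 0 by near: z; apply: filterS (lt_nbhsl y0) => z /ltW.
    by rewrite /ramp /= max_r// mulr0.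
  by rewrite mulr0; exact: is_derive_cst.
- apply: (@near_eq_is_derive _ _ _ (fun z : R => z ^+ 2)).
    near=> z; have z0 : 0 <= z by near: z; apply: filterS (lt_nbhsr y0) => z /ltW.
    by rewrite /ramp /= max_l.
  by apply: is_derive_eq; rewrite /GRing.scale/=; ring.
have h : (fun k : R => k^-1 *: (ramp (k *: 1 + 0) - ramp 0)) k @[k --> 0^'] --> (2 * 0 : R).
  rewrite mulr0; apply/cvgrPdist_le => e e0; near=> k.
  have k0 : k != 0 by near: k; exact: nbhs_dnbhs_neq.
  rewrite sub0r normrN addr0 /ramp maxxx mulr0 subr0 /GRing.scale/= mulr1 mulKf//.
  have ke : `|k| <= e by near: k; apply: dnbhs0_le.
  by rewrite maxEle; case: ifPn => // _; rewrite normr0 ltW.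
split; first by apply/cvg_ex; eexists; exact: h.
by apply/cvg_lim.
Unshelve. all: by end_near. Qed.

Definition smoothstep (y : R) : R := 2 * (ramp y - 2 * ramp (y - 2^-1) + ramp (y - 1)).

Definition tent (y : R) : R :=
  4 * (Num.max y 0 - 2 * Num.max (y - 2^-1) 0 + Num.max (y - 1) 0).

Lemma smoothstep_le0 y : y <= 0 -> smoothstep y = 0.
Proof. by move=> y0; rewrite /smoothstep /ramp !max_r; lra. Qed.

Lemma smoothstep_ge1 y : 1 <= y -> smoothstep y = 1.
Proof. by move=> y0; rewrite /smoothstep /ramp !max_l; lra. Qed.

Lemma smoothstep_bound y : 0 <= smoothstep y <= 1.
Proof.
have [y0|y0] := leP y 0; first by rewrite smoothstep_le0//; lra.
have [y1|y1] := leP 1 y; first by rewrite smoothstep_ge1//; lra.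
rewrite /smoothstep /ramp (@max_l _ _ y)//; last exact: ltW.
rewrite (@max_r _ _ (y - 1)); last lra.
have [y2|y2] := leP y 2^-1.
  by rewrite max_r; [nra|lra].
by rewrite max_l; [nra|lra].
Qed.

Lemma tent_le0 y : y <= 0 -> tent y = 0.
Proof. by move=> y0; rewrite /tent !max_r; lra. Qed.

Lemma tent_ge1 y : 1 <= y -> tent y = 0.
Proof. by move=> y0; rewrite /tent !max_l; lra. Qed.

Lemma tent_ge0 y : 0 <= tent y.
Proof.
have [y0|y0] := leP y 0; first by rewrite tent_le0.
have [y1|y1] := leP 1 y; first by rewrite tent_ge1.
rewrite /tent (@max_l _ _ y)//; last exact: ltW.
rewrite (@max_r _ _ (y - 1)); last lra.
by have [y2|y2] := leP y 2^-1; [rewrite max_r; lra|rewrite max_l; lra].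
Qed.

Lemma is_derive_smoothstep s h t :
  is_derive t 1 (fun u : R => smoothstep ((u - s) / h)) (tent ((t - s) / h) / h).
Proof.
have aff b : is_derive t 1 (fun u : R => (u - s) / h - b) h^-1.
  by apply: is_derive_eq; rewrite /GRing.scale/=; ring.
have D b : is_derive t 1 (fun u : R => ramp ((u - s) / h - b))
    (2 * Num.max ((t - s) / h - b) 0 * h^-1).
  exact: (@is_derive1_comp _ ramp (fun u => (u - s) / h - b) t _ _ (is_derive_ramp _) (aff b)).
have D0 := D 0; rewrite subr0 in D0.
have -> : (fun u : R => smoothstep ((u - s) / h)) = (fun u : R =>
   2 * (ramp ((u - s) / h - 0) - 2 * ramp ((u - s) / h - 2^-1) + ramp ((u - s) / h - 1))).
  by apply/funext => u; rewrite /smoothstep subr0.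
have D1 := D 2^-1; have D2 := D 1.
by apply: is_derive_eq; rewrite /tent /GRing.scale/=; ring.
Qed.

Lemma continuous_tent s h : continuous (fun u : R => tent ((u - s) / h) / h).
Proof.
have aff b : continuous (fun u : R => (u - s) / h - b).
  move=> u; apply: cvgB; last exact: cvg_cst.
  by apply: cvgMl; apply: cvgB; [exact: cvg_id|exact: cvg_cst].
have M b : continuous (fun u : R => Num.max ((u - s) / h - b) 0).
  move=> u; apply: (@continuous_max _ _ (fun u : R => (u - s) / h - b) (cst 0)).
    exact: aff.
  exact: cst_continuous.
have -> : (fun u : R => tent ((u - s) / h) / h) = (fun u : R => 4 *
   (Num.max ((u - s) / h - 0) 0 - 2 * Num.max ((u - s) / h - 2^-1) 0 +
    Num.max ((u - s) / h - 1) 0) / h).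
  by apply/funext => u; rewrite /tent subr0.
move=> u; apply: cvgMl; apply: cvgMr; apply: cvgD; last exact: M.
by apply: cvgB; [exact: M|apply: cvgMr; exact: M].
Qed.

Let mu := @lebesgue_measure R.

Lemma within_integrable T (f : R -> R) : {within `[0, T], continuous f} ->
  mu.-integrable `]0, T[ (EFin \o f).
Proof.
move=> cf; have h : mu.-integrable `[0, T] (EFin \o f).
  by apply: continuous_compact_integrable => //; exact: segment_compact.
by apply: integrableS h => //; exact: subset_itv_oo_cc.
Qed.

(** The kernel is nonnegative, lives on [s, s+h] and has integral 1, since [smoothstep] is its
    primitive. *)
Lemma tent_average T s h e (G : R -> R) : 0 < s -> 0 < h -> s + h < T ->
  {within `[0, T], continuous G} ->
  (forall u, s <= u <= s + h -> `|G u - G s| <= e) ->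
  `|\int[mu]_(u in `]0, T[) (tent ((u - s) / h) / h * G u) - G s| <= e.
Proof.
move=> s0 h0 shT cG hG; set k := fun u : R => tent ((u - s) / h) / h.
have T0 : 0 < T by lra.
have k0 u : 0 <= k u by rewrite divr_ge0 ?tent_ge0// ltW.
have ck : {within `[0, T], continuous k}.
  by apply: continuous_subspaceT; exact: continuous_tent.
have mI : measurable (`]0, T[ : set R) by [].
have ik : mu.-integrable `]0, T[ (EFin \o k) by exact: within_integrable.
have ikG : mu.-integrable `]0, T[ (EFin \o (fun u => k u * G u)).
  by apply: within_integrable => u; apply: cvgM; [exact: ck|exact: cG].
have k1 : \int[mu]_(u in `]0, T[) k u = 1.
  have := @continuous_FTC2 R k (fun u => smoothstep ((u - s) / h)) 0 T T0 ck.
  rewrite smoothstep_ge1; last by rewrite ler_pdivlMr//; lra.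
  rewrite smoothstep_le0; last by rewrite pmulr_lle0 ?invr_gt0//; lra.
  rewrite sube0 => H; rewrite /Rintegral -(@integral_itv_bndoo _ _ _ _ true false); last first.
    exact: measurable_int ik.
  rewrite H//.
    have dS (u : R) : derivable (fun u : R => smoothstep ((u - s) / h)) u 1.
      by have [] := is_derive_smoothstep s h u.
    have cS (u : R) : {for u, continuous (fun u : R => smoothstep ((u - s) / h))}.
      by apply: differentiable_continuous; apply/derivable1_diffP.
    by split => [u _||]; [exact: dS|apply: cvg_at_right_filter; exact: cS|
      apply: cvg_at_left_filter; exact: cS].
  by move=> u _; rewrite derive1E; have [_ ->] := is_derive_smoothstep s h u.
have -> : G s = \int[mu]_(u in `]0, T[) (k u * G s).
  by rewrite RintegralZr// k1 mul1r.
have ikc c : mu.-integrable `]0, T[ (EFin \o (fun u => k u * c)).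
  by apply: within_integrable => u; apply: cvgM; [exact: ck|exact: cvg_cst].
have cD : {within `[0, T], continuous (fun u => k u * G u - k u * G s)}.
  move=> u; apply: cvgB; apply: cvgM; [exact: ck|exact: cG|exact: ck|exact: cvg_cst].
rewrite -RintegralB//; apply: (le_trans (le_normr_Rintegral _ _)) => //.
  exact: within_integrable cD.
rewrite -[leRHS]mul1r -k1 -RintegralZr//; apply: le_Rintegral => //.
  by apply: within_integrable => u; apply: cvg_norm; exact: cD.
move=> u _; rewrite -mulrBr normrM (ger0_norm (k0 u)).
have [u1|u1] := leP u s.
  by rewrite /k tent_le0 ?mul0r// pmulr_lle0 ?invr_gt0//; lra.
have [u2|u2] := leP (s + h) u.
  by rewrite /k tent_ge1 ?mul0r// ler_pdivlMr//; lra.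
apply: ler_wpM2l; first exact: k0.
by apply: hG; rewrite (ltW u1) (ltW u2).
Qed.

Lemma within_continuousP T (G : R -> R) : {within `[0, T], continuous G} ->
  forall s e, 0 <= s <= T -> 0 < e -> exists2 d : R, 0 < d &
    forall u, 0 <= u <= T -> `|u - s| < d -> `|G u - G s| <= e.
Proof.
move=> /subspace_continuousP cG s e sT e0.
have /cG : `[0, T]%classic s by rewrite /= in_itv.
move/cvgrPdist_le => /(_ e e0) [d /= d0 hd]; exists d => // u uT us.
have := hd u; rewrite /= distrC => /(_ us); rewrite in_itv/= => /(_ uT).
by rewrite distrC.
Qed.

(** The test function is the difference of two smooth steps, starting at s and at t: its modulus is
    at most 1, it vanishes near both ends of the interval, and its derivative averages G just after
    s minus just after t. *)
Let weak_oscillation_interior T (G H : R -> R) (B : R -> \bar R) (Delta : R) :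
  0 < T -> {within `[0, T], continuous G} ->
  measurable_fun `[0, T] H -> measurable_fun `[0, T] B ->
  (forall t, 0 <= t <= T -> (`|H t|%:E <= B t)%E) ->
  (\int[mu]_(t in `[0%R, T]) B t <= Delta%:E)%E ->
  (forall zeta, Cc1 `]0, T[ zeta ->
     \int[mu]_(t in `]0, T[) (derive1 zeta t * G t) =
     - \int[mu]_(t in `]0, T[) (zeta t * H t)) ->
  forall s t e, 0 < s < T -> 0 < t < T -> 0 < e -> `|G s - G t| <= Delta + 2 * e.
Proof.
move=> T0 cG mH mB HB BD weak s t e /andP[s0 sT] /andP[t0 tT] e0.
have sT' : 0 <= s <= T by rewrite !ltW.
have tT' : 0 <= t <= T by rewrite !ltW.
have [d1 d10 h1] := within_continuousP cG sT' e0.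
have [d2 d20 h2] := within_continuousP cG tT' e0.
set h := Num.min (Num.min (d1 / 2) (d2 / 2)) (Num.min ((T - s) / 2) ((T - t) / 2)).
have h0 : 0 < h by rewrite !lt_min !divr_gt0// subr_gt0.
have hd1 : h <= d1 / 2 by rewrite !ge_min lexx.
have hd2 : h <= d2 / 2 by rewrite !ge_min lexx ?orbT.
have hs : h <= (T - s) / 2 by rewrite !ge_min lexx ?orbT.
have ht : h <= (T - t) / 2 by rewrite !ge_min lexx ?orbT.
have shT : s + h < T by lra.
have thT : t + h < T by lra.
have As : `|\int[mu]_(u in `]0, T[) (tent ((u - s) / h) / h * G u) - G s| <= e.
  apply: tent_average => // u /andP[u1 u2]; apply: h1; first by apply/andP; split; lra.
  by rewrite ger0_norm; lra.
have At : `|\int[mu]_(u in `]0, T[) (tent ((u - t) / h) / h * G u) - G t| <= e.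
  apply: tent_average => // u /andP[u1 u2]; apply: h2; first by apply/andP; split; lra.
  by rewrite ger0_norm; lra.
pose zeta u := smoothstep ((u - s) / h) - smoothstep ((u - t) / h).
have dz (u : R) : is_derive u 1 (zeta : R -> R) (tent ((u - s) / h) / h - tent ((u - t) / h) / h).
  have := is_derive_smoothstep s h u; have := is_derive_smoothstep t h u => D1 D2.
  exact: is_deriveB.
have dzE : derive1 zeta = (fun u => tent ((u - s) / h) / h - tent ((u - t) / h) / h).
  by apply/funext => u; rewrite derive1E; have [_ ->] := dz u.
have cz : continuous (fun u => tent ((u - s) / h) / h - tent ((u - t) / h) / h).
  by move=> u; apply: cvgB; exact: continuous_tent.
have zC : Cc1 `]0, T[ zeta.
  split; [by move=> u; have [] := dz u|by rewrite dzE|].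
  have sub : closure [set u | zeta u != 0] `<=` `[Num.min s t, Num.max s t + h].
    rewrite closureE => u; apply; split; first exact: interval_closed.
    move=> v /=; apply: contraNT; rewrite in_itv/= negb_and -!ltNge => /orP[].
      rewrite lt_min => /andP[vs vt]; apply/eqP.
      by rewrite /zeta !smoothstep_le0 ?subrr// pmulr_lle0 ?invr_gt0//; lra.
    rewrite -ltrBrDr gt_max => /andP[vs vt]; apply/eqP.
    by rewrite /zeta !smoothstep_ge1 ?subrr// ler_pdivlMr//; lra.
  split.
    apply: (@subclosed_compact _ _ `[Num.min s t, Num.max s t + h]) => //.
      exact: closed_closure.
    exact: segment_compact.
  apply: (subset_trans sub) => u /=; rewrite !in_itv/= ge_min => /andP[u1 u2].
  apply/andP; split; first by case/orP: u1 => ?; lra.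
  by apply: (le_lt_trans u2); rewrite -ltrBrDr gt_max; apply/andP; split; lra.
have z1 u : `|zeta u| <= 1.
  have := smoothstep_bound ((u - s) / h); have := smoothstep_bound ((u - t) / h).
  by rewrite /zeta ler_norml; lra.
have mI : measurable (`]0, T[ : set R) by [].
have sI : `]0, T[ `<=` `[0, T] by exact: subset_itv_oo_cc.
have mz : measurable_fun `[0, T] zeta.
  apply: measurable_funTS; apply: continuous_measurable_fun => u.
  by apply: differentiable_continuous; apply/derivable1_diffP; have [] := dz u.
have mzH : measurable_fun `]0, T[ (fun u => zeta u * H u).
  by apply: (measurable_funS _ sI) => //; apply: measurable_funM.
have zHB u : u \in `]0, T[ -> (`|zeta u * H u|%:E <= B u)%E.
  move=> uI; have uT : 0 <= u <= T.
    by move: uI; rewrite in_itv/= => /andP[? ?]; rewrite !ltW.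
  apply: le_trans (HB _ uT); rewrite lee_fin normrM ler_piMl//.
have B0 u : 0 <= u <= T -> (0 <= B u)%E.
  by move=> uT; apply: le_trans (HB _ uT); rewrite lee_fin.
have intzH : (\int[mu]_(u in `]0%R, T[) `|zeta u * H u|%:E <= Delta%:E)%E.
  apply: le_trans BD; apply: (@le_trans _ _ (\int[mu]_(u in `]0%R, T[) B u)%E).
    apply: ge0_le_integral => //.
    - by apply/measurable_EFinP; exact: measurableT_comp.
    - exact: (measurable_funS _ sI).
  apply: ge0_subset_integral => // u; rewrite /= in_itv/=; exact: B0.
have izH : mu.-integrable `]0, T[ (EFin \o (fun u => zeta u * H u)).
  apply/integrableP; split; first exact/measurable_EFinP.
  exact: le_lt_trans intzH (ltry _).
have main : `|\int[mu]_(u in `]0, T[) (derive1 zeta u * G u)| <= Delta.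
  rewrite weak// normrN; apply: (le_trans (le_normr_Rintegral _ izH)) => //.
  rewrite -lee_fin fineK//; rewrite ge0_fin_numE; first exact: le_lt_trans intzH (ltry _).
  exact: integral_ge0.
have ik a : mu.-integrable `]0, T[ (EFin \o (fun u => tent ((u - a) / h) / h * G u)).
  have ck : {within `[0, T], continuous (fun u => tent ((u - a) / h) / h)}.
    by apply: continuous_subspaceT; exact: continuous_tent.
  by apply: within_integrable => u; apply: cvgM; [exact: ck|exact: cG].
have dzG : \int[mu]_(u in `]0, T[) (derive1 zeta u * G u) =
  \int[mu]_(u in `]0, T[) (tent ((u - s) / h) / h * G u) -
  \int[mu]_(u in `]0, T[) (tent ((u - t) / h) / h * G u).
  rewrite -RintegralB//; apply: eq_Rintegral => u _.
  by rewrite dzE mulrBl.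
rewrite dzG in main; move: main As At; rewrite !ler_norml.
by move: (Rintegral _ _ _) (Rintegral _ _ _) => I J; lra.
Qed.

(** Interior times come from compactly supported tests; continuity of G up to the boundary adds the
    end points, in particular the initial time. *)
Lemma weak_oscillation T (G H : R -> R) (B : R -> \bar R) (Delta : R) :
  0 < T -> {within `[0, T], continuous G} ->
  measurable_fun `[0, T] H -> measurable_fun `[0, T] B ->
  (forall t, 0 <= t <= T -> (`|H t|%:E <= B t)%E) ->
  (\int[mu]_(t in `[0%R, T]) B t <= Delta%:E)%E ->
  (forall zeta, Cc1 `]0, T[ zeta ->
     \int[mu]_(t in `]0, T[) (derive1 zeta t * G t) =
     - \int[mu]_(t in `]0, T[) (zeta t * H t)) ->
  forall s t, 0 <= s <= T -> 0 <= t <= T -> `|G s - G t| <= Delta.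
Proof.
move=> T0 cG mH mB HB BD weak s t sT tT; apply/ler_addgt0Pr => e e0.
have e4 : 0 < e / 4 by exact: divr_gt0.
have approx a : 0 <= a <= T -> exists2 b, 0 < b < T & `|G b - G a| <= e / 4.
  move=> aT; have [d d0 hd] := within_continuousP cG aT e4.
  set r := Num.min (d / 2) (T / 4).
  have r0 : 0 < r by rewrite lt_min !divr_gt0.
  have rd : r <= d / 2 by rewrite ge_min lexx.
  have rT : r <= T / 4 by rewrite ge_min lexx orbT.
  have [a2|a2] := leP a (T / 2).
    exists (a + r); first by apply/andP; split; lra.
    by apply: hd; [apply/andP; split; lra|rewrite ger0_norm; lra].
  exists (a - r); first by apply/andP; split; lra.
  by apply: hd; [apply/andP; split; lra|rewrite ler0_norm; lra].
have [s' s'T hs] := approx s sT; have [t' t'T ht] := approx t tT.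
have := weak_oscillation_interior T0 cG mH mB HB BD weak s'T t'T e4.
by move: hs ht; rewrite !ler_norml; lra.
Qed.

End WeakDerivative.

(** * The logarithmic mean *)

Section LambdaMean.
Context {R : realType}.
Implicit Types a b s : R.

Let mu := @lebesgue_measure R.

Lemma powR_interp_le a b s : 0 <= a -> 0 <= b -> 0 <= s <= 1 ->
  a `^ s * b `^ (1 - s) <= a + b.
Proof.
move=> a0 b0 /andP[s0 s1]; set m := Num.max a b.
have ma : a <= m by rewrite le_max lexx.
have mb : b <= m by rewrite le_max lexx orbT.
have mab : m <= a + b by rewrite ge_max lerDl lerDr a0 b0.
have m0 : 0 <= m by exact: le_trans ma.
have := m0; rewrite le_eqVlt => /predU1P[m00|m1].
  have -> : a = 0 by apply/le_anti; rewrite a0 m00 ma.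
  have -> : b = 0 by apply/le_anti; rewrite b0 m00 mb.
  have [->|sn] := eqVneq s 0; first by rewrite subr0 powRr1// mulr0 addr0.
  by rewrite powR0// mul0r addr0.
apply: le_trans mab; have mE : m = m `^ s * m `^ (1 - s).
  by rewrite -powRD_pos// addrC subrK powRr1.
rewrite [leRHS]mE.
by apply: ler_pM; rewrite ?powR_ge0//; apply: ge0_ler_powR; rewrite ?nnegrE// subr_ge0.
Qed.

Lemma measurable_powR2 d (T : measurableType d) (D : set T) (f g : T -> R) :
  measurable_fun D f -> measurable_fun D g -> measurable_fun D (fun t => f t `^ g t).
Proof.
move=> mf mg mD; rewrite /powR; apply: measurable_fun_if => //.
- exact: measurable_fun_eqr.
- apply: (measurable_funS mD) => //.
  have -> : (fun t => (g t == 0)%:R : R) = (fun t => if g t == 0 then 1 else 0).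
    by apply/funext => t; case: eqP.
  by apply: measurable_fun_if => //; exact: measurable_fun_eqr.
- apply: (measurable_funS mD) => //.
  apply: measurableT_comp => //; apply: measurable_funM => //.
  exact: measurableT_comp.
Qed.

Lemma Lambda_ge0 a b : 0 <= Lambda a b.
Proof. by apply: Rintegral_ge0 => s _; rewrite mulr_ge0 ?powR_ge0. Qed.

Lemma Lambda_le a b : 0 <= a -> 0 <= b -> Lambda a b <= a + b.
Proof.
move=> a0 b0; rewrite /Lambda /Rintegral.
have h : (\int[mu]_(s in `[0%R, 1%R]) (a `^ s * b `^ (1 - s))%:E <= (a + b)%:E)%E.
  apply: (@le_trans _ _ (\int[mu]_(s in `[0%R, 1%R]) (cst (a + b)%:E s))%E).
    apply: ge0_le_integral => //.
    - by move=> s _; rewrite lee_fin mulr_ge0 ?powR_ge0.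
    - apply/measurable_EFinP; apply: measurable_funM; apply: measurable_powR2 => //.
      exact: measurable_funB.
    - by move=> s; rewrite /= in_itv/= => sI; rewrite lee_fin; exact: powR_interp_le.
  rewrite integral_cst//= lebesgue_measure_itv/= lte_fin ltr01.
  by rewrite -EFinD subr0 mule1.
rewrite -lee_fin fineK// ge0_fin_numE; first exact: le_lt_trans h (ltry _).
by apply: integral_ge0 => s _; rewrite lee_fin mulr_ge0 ?powR_ge0.
Qed.

(** Tonelli on the plane: extending f and g by zero outside D makes the integrand measurable
    everywhere, and the indicator encodes the range of s. *)
Lemma measurable_Lambda (D : set R) (f g : R -> R) : measurable D ->
  measurable_fun D f -> measurable_fun D g ->
  measurable_fun D (fun t => Lambda (f t) (g t)).
Proof.
move=> mD mf mg.
pose F (u : R * R) : \bar R := (((f \_ D) u.1 `^ u.2 * (g \_ D) u.1 `^ (1 - u.2)) * \1_(`[0, 1]%classic) u.2)%:E.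
have mF : measurable_fun setT F.
  apply/measurable_EFinP; apply: measurable_funM; last first.
    by apply: measurableT_comp => //; exact: measurable_indic.
  have m1 : measurable_fun [set: R * R] (fun u => (f \_ D) u.1).
    by apply: measurableT_comp => //; apply/measurable_restrict => //; rewrite setTI.
  have m2 : measurable_fun [set: R * R] (fun u => (g \_ D) u.1).
    by apply: measurableT_comp => //; apply/measurable_restrict => //; rewrite setTI.
  apply: measurable_funM; apply: measurable_powR2 => //.
  exact: measurable_funB.
have F0 u : (0 <= F u)%E by rewrite lee_fin !mulr_ge0 ?powR_ge0.
have := @measurable_fun_fubini_tonelli_F _ _ _ _ _ mu F mF F0 => mI.
have : measurable_fun D (fun t => fine (fubini_F mu F t)).
  by apply: measurable_funTS; apply: measurableT_comp.
apply: eq_measurable_fun => t; rewrite inE => tD.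
rewrite /Lambda /Rintegral /fubini_F; congr fine.
rewrite [in RHS]integral_mkcond; apply: eq_integral => s _.
have fD : (f \_ D) t = f t by rewrite patchE mem_set.
have gD : (g \_ D) t = g t by rewrite patchE mem_set.
rewrite /F -[(t, s).1]/t -[(t, s).2]/s fD gD patchE indicE.
by case: ifPn => _; rewrite ?mulr1 ?mulr0.
Qed.

End LambdaMean.

(** * Mobility and tested fluxes *)

Section Action.
Context {R : realType}.
Variables alpha gamma zs q rho0 : R.
Hypotheses (halpha : 0 <= alpha < 1) (hgamma : 0 < gamma < 1).
Hypotheses (hzs : 0 < zs) (hq : 0 < q).
Implicit Types (n phi g : nat -> R) (l m N P : nat).

Let alt1 : alpha < 1. Proof. by case/andP: halpha. Qed.

Local Notation omega := (omega alpha gamma zs q).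
Local Notation mobility n l := (k_eq alpha gamma zs q l * n_hat alpha gamma zs q n l).
Local Notation K := (K alpha gamma zs q).
Local Notation K_partial := (K_partial alpha gamma zs q).

Let omega_pos l : (0 < l)%N -> 0 < omega zs l.
Proof. by move=> lp; apply: omega_gt0. Qed.

Lemma mobility_ge0 n l : (0 < l)%N -> 0 <= mobility n l.
Proof.
move=> lp; apply: mulr_ge0; last exact: Lambda_ge0.
have w1 := omega_pos (ltn0Sn 0); have wl := omega_pos lp.
have ra := @rate_a_gt0 R alpha l lp.
by rewrite /k_eq; nneg.
Qed.

(** A mean is at most the sum, so the mobility is at most the forward plus the backward flux. *)
Lemma mobility_le n l : nonneg n -> n 1%N <= rho0 -> (0 < l)%N ->
  mobility n l <= rho0 * (rate_a alpha l * n l) +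
    (zs + q) * (rate_a alpha l.+1 * n l.+1).
Proof.
move=> n0 n1 lp.
have w1 := omega_pos (ltn0Sn 0); have wl := omega_pos lp.
have wl1 := omega_pos (ltn0Sn l).
have ra := @rate_a_gt0 R alpha l lp.
have k0 : 0 <= k_eq alpha gamma zs q l by rewrite /k_eq; nneg.
have u0 : 0 <= n 1%N * n l / (omega zs 1 * omega zs l).
  by apply: divr_ge0; [apply: mulr_ge0; apply: n0|apply: mulr_ge0; exact: ltW].
have v0 : 0 <= n l.+1 / omega zs l.+1 by apply: divr_ge0; [exact: n0|exact: ltW].
apply: (le_trans (ler_wpM2l k0 (Lambda_le u0 v0))).
have kE : k_eq alpha gamma zs q l = rate_b alpha gamma zs q l.+1 * omega zs l.+1.
  have := @weightS R alpha gamma zs q hzs hq zs l lp.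
  by rewrite /k_eq omega1 /rate_b /rate_a => h; move: h; lra.
rewrite mulrDr; apply: lerD.
  have -> : k_eq alpha gamma zs q l * (n 1%N * n l / (omega zs 1 * omega zs l)) =
     n 1%N * (rate_a alpha l * n l) by rewrite /k_eq; field; rewrite !gt_eqF.
  by apply: ler_wpM2r => //; apply: mulr_ge0; [rewrite ltW// rate_a_gt0|exact: n0].
have -> : k_eq alpha gamma zs q l * (n l.+1 / omega zs l.+1) =
    rate_a alpha l.+1 * ((zs + q * l.+1%:R `^ (- gamma)) * n l.+1).
  by rewrite kE /rate_b /rate_a; field; rewrite gt_eqF.
have := @beta_le R gamma zs q hgamma hq l.+1 isT => hb.
rewrite [leRHS]mulrCA; apply: ler_wpM2l; first by rewrite ltW// rate_a_gt0.
by apply: ler_wpM2r => //; exact: n0.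
Qed.

Definition mobility_const : R := (rho0 + zs + q) * rho0.

Let rate_mass n l P : nonneg n -> (0 < P)%N -> (P <= l)%N ->
  rate_a alpha l * n l <= P%:R `^ (alpha - 1) * (l%:R * n l).
Proof.
move=> n0 Pp Pl; have lp := leq_trans Pp Pl; have lR : 0 < l%:R :> R by rewrite ltr0n.
rewrite mulrA; apply: ler_wpM2r; first exact: n0.
rewrite /rate_a (_ : l%:R `^ alpha = l%:R `^ (alpha - 1) * l%:R); last first.
  by rewrite -[X in _ * X]powRr1// -powRD_pos// subrK.
apply: ler_wpM2r => //; have -> : alpha - 1 = - (1 - alpha) by ring.
by apply: powRN_nonincreasing => //; rewrite subr_ge0 ltW.
Qed.

(** The rates are sublinear: l^alpha n_l is l^(alpha-1) times the mass in size l. Reactions among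
    sizes beyond P are therefore slow, which is what prevents escape of mass. *)
Lemma mobility_sum n P N : states rho0 n -> (0 < P)%N ->
  \sum_(P <= l < N) mobility n l <= mobility_const * P%:R `^ (alpha - 1).
Proof.
move=> hn Pp; have n0 : nonneg n by move=> l lp; exact: states_ge0 hn lp.
have r0 : 0 <= rho0 by apply: le_trans (states_le hn (ltn0Sn 0)); exact: n0.
set p := P%:R `^ _; have p0 : 0 <= p by exact: powR_ge0.
have m0 l : (P <= l)%N -> 0 <= l%:R * n l.
  by move=> Pl; apply: (states_mass_ge0 hn); exact: leq_trans Pl.
have [PN|NP] := leqP P N; last first.
  rewrite big_geq; last exact: ltnW.
  by rewrite /mobility_const; nneg; exact: ltW.
apply: (@le_trans _ _ (\sum_(P <= l < N) (rho0 * (p * (l%:R * n l)) +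
   (zs + q) * (p * (l.+1%:R * n l.+1))))).
  rewrite !big_nat; apply: ler_sum => l /andP[Pl _]; have lp := leq_trans Pp Pl.
  apply: (le_trans (mobility_le n0 (states_le hn (ltn0Sn 0)) lp)).
  apply: lerD; first by apply: ler_wpM2l => //; exact: rate_mass.
  apply: ler_wpM2l; first by nneg; exact: ltW.
  by apply: rate_mass => //; exact: leqW.
rewrite big_split/= -!mulr_sumr.
have h1 : \sum_(P <= l < N) l%:R * n l <= rho0.
  apply: le_trans (states_partial_le N hn); apply: sum_nat_nonneg_ge => //.
  by move=> l lp; apply: (states_mass_ge0 hn).
have h2 : \sum_(P <= l < N) l.+1%:R * n l.+1 <= rho0.
  apply: le_trans (states_partial_le N.+1 hn); rewrite -(big_add1 _ _ _ N.+1 xpredT (fun l => l%:R * n l)).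
  apply: sum_nat_nonneg_ge => //.
  by move=> l lp; apply: (states_mass_ge0 hn).
have h3 := ler_wpM2l r0 (ler_wpM2l p0 h1).
have zq0 : 0 <= zs + q by nneg; exact: ltW.
have h4 := ler_wpM2l zq0 (ler_wpM2l p0 h2).
by rewrite /mobility_const; move: h3 h4; lra.
Qed.

Let delta_sum (g : nat -> R) B k : (forall m, (B <= m)%N -> g m = 0) -> (0 < k)%N ->
  \sum_(1 <= m < B) g m * (m == k)%:R = g k.
Proof.
move=> gB kp; have [kB|Bk] := ltnP k B.
  rewrite (bigD1_seq k) ?mem_index_iota ?kp ?iota_uniq//= eqxx mulr1 big1 ?addr0// => m mk.
  by rewrite (negbTE mk) mulr0.
rewrite gB// big_nat big1// => m /andP[_ mB].
by rewrite (_ : (m == k) = false) ?mulr0//; apply/negbTE; rewrite neq_ltn (leq_trans mB).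
Qed.

(** As [g] has finite support, the sums over components and over reactions are exchanged at each
    finite stage, and the limit is taken component by component; absolute convergence is not
    involved. *)
Lemma K_test n phi g B : (forall m, (B <= m)%N -> g m = 0) ->
  (forall m, (1 <= m)%N -> cvgn (K_partial n phi m)) ->
  (\sum_(1 <= l < N) mobility n l * reaction_dot l phi * (g 1%N + g l - g l.+1)) @[N --> \oo]
    --> \sum_(1 <= m < B) g m * K n phi m.
Proof.
move=> gB hK.
have -> : (fun N => \sum_(1 <= l < N) mobility n l * reaction_dot l phi * (g 1%N + g l - g l.+1)) =
   (fun N => \sum_(1 <= m < B) g m * K_partial n phi m N).
  apply/funext => N; under [RHS]eq_bigr do rewrite /Defs.K_partial mulr_sumr.
  rewrite [RHS]exchange_big/= !big_nat; apply: eq_bigr => l /andP[lp _].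
  have -> : g 1%N + g l - g l.+1 = \sum_(1 <= m < B) g m * reaction l m.
    rewrite /reaction; under [RHS]eq_bigr do rewrite mulrBr mulrDr.
    by rewrite sumrB big_split/= !delta_sum.
  by rewrite mulr_sumr; apply: eq_bigr => m _; ring.
rewrite big_nat; under eq_fun do rewrite big_nat.
apply: cvg_big => [|m /andP[mp _]]; first exact: add_continuous.
by apply: cvgMr; exact: hK.
Qed.

(** Weighted Young inequality 2 v <= eta + v^2 / eta for v = |nabla phi|, summed against the
    mobility: the first part only sees the reactions l >= P, the second one is the action. [eta]
    remains free in order to balance them. *)
Lemma K_test_le n phi g B P (eta S : R) : states rho0 n ->
  (forall m, (B <= m)%N -> g m = 0) ->
  (forall m, (1 <= m)%N -> cvgn (K_partial n phi m)) -> (0 < P)%N ->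
  (forall l, (0 < l)%N -> `|g 1%N + g l - g l.+1| <= 2) ->
  (forall l, (0 < l)%N -> (l < P)%N -> g 1%N + g l - g l.+1 = 0) ->
  0 < eta -> (forall N, \sum_(1 <= l < N) mobility n l * `|nabla phi l| ^+ 2 <= S) ->
  `|\sum_(1 <= m < B) g m * K n phi m| <=
    eta * (mobility_const * P%:R `^ (alpha - 1)) + S / eta.
Proof.
move=> hn gB hK Pp g2 g0 eta0 hS.
have hlim := K_test gB hK.
apply: (ler_cvg_to (cvg_norm hlim) (cvg_cst _)); apply: nearW => N.
apply: (le_trans (ler_norm_sum _ _ _)).
have r0 : 0 <= rho0 by apply: le_trans (states_le hn (ltn0Sn 0)); exact: (states_ge0 hn).
apply: (@le_trans _ _ (\sum_(P <= l < N) eta * mobility n l +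
    \sum_(1 <= l < N) mobility n l * `|nabla phi l| ^+ 2 / eta)); last first.
  apply: lerD; first by rewrite -mulr_sumr; apply: ler_wpM2l (mobility_sum N hn Pp); exact: ltW.
  by rewrite -mulr_suml; apply: ler_wpM2r; [rewrite invr_ge0 ltW|exact: hS].
have step l : (0 < l)%N -> `|mobility n l * reaction_dot l phi * (g 1%N + g l - g l.+1)| <=
    (if (P <= l)%N then eta * mobility n l else 0) + mobility n l * `|nabla phi l| ^+ 2 / eta.
  move=> lp; have k0 := mobility_ge0 n lp.
  have -> : reaction_dot l phi = - nabla phi l by rewrite /reaction_dot /nabla; ring.
  rewrite 2!normrM normrN (ger0_norm k0); set v := `|nabla phi l|.
  have v0 : 0 <= v by exact: normr_ge0.
  have kv : 0 <= mobility n l * v ^+ 2 / eta.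
    by apply: divr_ge0; [nneg|exact: ltW].
  case: leqP => Pl; last by rewrite g0// normr0 mulr0 add0r.
  apply: (@le_trans _ _ (mobility n l * v * 2)).
    by apply: ler_wpM2l; [exact: mulr_ge0|exact: g2].
  have : 0 <= mobility n l * ((v - eta) ^+ 2 / eta).
    by apply: mulr_ge0 => //; apply: divr_ge0; [exact: sqr_ge0|exact: ltW].
  have -> : mobility n l * ((v - eta) ^+ 2 / eta) =
    mobility n l * v ^+ 2 / eta + eta * mobility n l - mobility n l * v * 2.
    by field; rewrite gt_eqF.
  by lra.
apply: (@le_trans _ _ (\sum_(1 <= l < N) ((if (P <= l)%N then eta * mobility n l else 0) +
   mobility n l * `|nabla phi l| ^+ 2 / eta))).
  by rewrite !big_nat; apply: ler_sum => l /andP[lp _]; exact: step.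
rewrite big_split/= lerD2r.
have [PN|NP] := leqP P N; last first.
  rewrite [leRHS]big_geq; last exact: ltnW.
  rewrite big_nat big1// => l /andP[_ lN].
  by rewrite leqNgt (ltn_trans lN NP).
rewrite (big_cat_nat Pp PN)/= [X in X + _]big_nat [X in X + _]big1 ?add0r.
  by rewrite !big_nat; apply: ler_sum => l /andP[-> _].
by move=> l /andP[_ lP]; rewrite leqNgt lP.
Qed.

End Action.

(** * Measurability in time *)

Section MeasurableDissipation.
Context {R : realType}.
Variable D : set R.
Hypothesis mD : measurable D.

Lemma measurable_sum_nat (f : nat -> R -> R) a b :
  (forall l, (a <= l < b)%N -> measurable_fun D (f l)) ->
  measurable_fun D (fun t => \sum_(a <= l < b) f l t).
Proof.
move=> mf; pose f' l := if (a <= l < b)%N then f l else cst 0.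
have -> : (fun t => \sum_(a <= l < b) f l t) = (fun t => \sum_(a <= l < b) f' l t).
  by apply/funext => t; rewrite !big_nat; apply: eq_bigr => l ll; rewrite /f' ll.
by apply: measurable_sum => l; rewrite /f'; case: ifPn => // ll; exact: mf.
Qed.

Lemma emeasurable_sum_nat (f : nat -> R -> \bar R) a b :
  (forall l, (a <= l < b)%N -> measurable_fun D (f l)) ->
  measurable_fun D (fun t => \sum_(a <= l < b) f l t)%E.
Proof.
move=> mf; pose f' l := if (a <= l < b)%N then f l else cst 0%E.
have -> : (fun t => \sum_(a <= l < b) f l t)%E = (fun t => \sum_(a <= l < b) f' l t)%E.
  by apply/funext => t; rewrite !big_nat; apply: eq_bigr => l ll; rewrite /f' ll.
by apply: emeasurable_sum => l; rewrite /f'; case: ifPn => // ll; exact: mf.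
Qed.

Lemma measurable_nneseries (f : nat -> R -> \bar R) k :
  (forall l, (k <= l)%N -> forall t, D t -> (0 <= f l t)%E) ->
  (forall l, (k <= l)%N -> measurable_fun D (f l)) ->
  measurable_fun D (fun t => (\sum_(k <= l <oo) f l t)%E).
Proof.
move=> f0 mf.
apply: (emeasurable_fun_cvg (fun N t => \sum_(k <= l < N) f l t)%E) => [N|t tD].
  by apply: emeasurable_sum_nat => l /andP[kl _]; exact: mf.
by apply: is_cvg_nneseries => l kl _; exact: f0.
Qed.

Lemma measurable_log_dissipation (f g : R -> R) :
  measurable_fun D f -> measurable_fun D g ->
  measurable_fun D (fun t => log_dissipation (f t) (g t)).
Proof.
move=> mf mg.
have f0 : measurable_fun D (fun t => f t == 0) by exact: measurable_fun_eqr.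
have g0 : measurable_fun D (fun t => g t == 0) by exact: measurable_fun_eqr.
have -> : (fun t => log_dissipation (f t) (g t)) = (fun t =>
   if f t == 0 then (if g t == 0 then 0%E else +oo%E)
   else (if g t == 0 then +oo%E else ((f t - g t) * (ln (f t) - ln (g t)))%:E)).
  by apply/funext => t; rewrite /log_dissipation; case: eqP; case: eqP.
have h : measurable_fun D (fun t => ((f t - g t) * (ln (f t) - ln (g t)))%:E).
  apply/measurable_EFinP; apply: measurable_funM; apply: measurable_funB => //;
    exact: measurableT_comp.
have mI (u : R -> bool) b : measurable_fun D u -> measurable (D `&` u @^-1` [set b]).
  by move=> mu; apply: mu.
have S (E : set R) (k : R -> \bar R) : measurable E -> E `<=` D -> measurable_fun D k -> measurable_fun E k.
  by move=> mE ED; exact: measurable_funS.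
apply: measurable_fun_if => //.
  apply: measurable_fun_if => //; first exact: mI.
  by apply: (measurable_funS mD) => //.
apply: measurable_fun_if => //; first exact: mI.
  by apply: (measurable_funS mD) => //.
by apply: (measurable_funS mD) => // t [[]].
Qed.

End MeasurableDissipation.

Section Curve.
Context {R : realType}.
Variables alpha gamma zs q rho0 T eps : R.
Hypotheses (halpha : 0 <= alpha < 1) (hgamma : 0 < gamma < 1).
Hypotheses (hzs : 0 < zs) (hq : 0 < q) (heps : 0 < eps).
Variables (n : R -> nat -> R) (w : R -> R -> R).
Hypothesis hcurve : rescaled_curve alpha gamma zs q rho0 T eps n w.
Implicit Types (l m N P : nat).

Local Notation mobility n l := (k_eq alpha gamma zs q l * n_hat alpha gamma zs q n l).
Local Notation lift := (lift_w gamma zs eps).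

Lemma curve_states t : 0 <= t <= T -> states rho0 (n t).
Proof. by case: hcurve => + _ _ _ _; apply. Qed.

Lemma curve_nonneg t : 0 <= t <= T -> nonneg (n t).
Proof. by move=> tT l lp; exact: states_ge0 (curve_states tT) lp. Qed.

Lemma curve_continuous l : (1 <= l)%N -> {within `[0, T], continuous (fun t => n t l)}.
Proof.
move=> lp; case: hcurve => _ /(_ l lp) hac _ _ _.
apply/subspace_continuousP => t; rewrite /= in_itv/= => tT.
apply/cvgrPdist_lt => e e0; have [d d0 hd] := hac e e0.
exists d => //= s ts0; rewrite in_itv/= => sT; have {ts0}ts : `|t - s| < d := ts0.
wlog st : s t tT sT ts / s <= t => [hw|].
  have [/hw|/ltW ts'] := leP s t; first exact.
  by rewrite distrC; apply: hw => //; rewrite distrC in ts.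
have := hd 1%N (fun=> s) (fun=> t); rewrite !big_ord1; apply.
- by move=> i _; case/andP: tT sT => ? ? /andP[? ?].
- by move=> i j /andP[ij]; rewrite ltnS leqn0 => /eqP j0; rewrite j0 in ij.
- by apply: le_lt_trans ts; exact: ler_norm.
Qed.

Lemma measurable_curve l : (1 <= l)%N -> measurable_fun `[0, T] (fun t => n t l).
Proof.
by move=> lp; apply: subspace_continuous_measurable_fun => //; exact: curve_continuous.
Qed.

Lemma measurable_mobility l : (1 <= l)%N -> measurable_fun `[0, T] (fun t => mobility (n t) l).
Proof.
move=> lp; apply: measurable_funM => //; apply: measurable_Lambda => //.
  apply: measurable_funM => //; apply: measurable_funM; exact: measurable_curve.
by apply: measurable_funM => //; exact: measurable_curve.
Qed.

Lemma measurable_lift l : measurable_fun `[0, T] (fun t => lift (w t) l).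
Proof.
apply: measurable_funM => //; apply: measurable_sum_nat => // j /andP[jp _].
by case: hcurve => _ _ + _ _; apply.
Qed.

Lemma measurable_K_eps m : (1 <= m)%N ->
  measurable_fun `[0, T] (fun t => K_eps alpha gamma zs q eps (n t) (w t) m).
Proof.
move=> mp; apply: measurable_funM => //.
apply: (@measurable_fun_cvg _ _ _ _ (fun N t => K_partial alpha gamma zs q (n t) (lift (w t)) m N)).
  move=> N; apply: measurable_sum_nat => // l /andP[lp _].
  apply: measurable_funM => //; apply: measurable_funM; first exact: measurable_mobility.
  by apply: measurable_funB; [apply: measurable_funD|]; exact: measurable_lift.
move=> t; rewrite /= in_itv/= => tT; case: hcurve => _ _ _ /(_ t tT) [hc _] _.
exact: hc.
Qed.

Lemma measurable_A_eps :
  measurable_fun `[0, T] (fun t => A_eps alpha gamma zs q eps (n t) (w t)).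
Proof.
apply: measurable_funeM; apply: measurable_nneseries => // l lp.
  by move=> t tT; rewrite lee_fin mulr_ge0 ?exprn_ge0//; exact: mobility_ge0.
apply/measurable_EFinP; apply: measurable_funM; first exact: measurable_mobility.
apply: measurable_funX; apply: measurableT_comp => //.
by apply: measurable_funB; [apply: measurable_funB|]; exact: measurable_lift.
Qed.

Lemma measurable_dissipation l : (1 <= l)%N ->
  measurable_fun `[0, T] (fun t => dissipation_term alpha gamma zs q (n t) l).
Proof.
move=> lp; apply: measurable_log_dissipation => //.
  apply: measurable_funM; last exact: measurable_curve.
  by apply: measurable_funM => //; exact: measurable_curve.
by apply: measurable_funM => //; exact: measurable_curve.
Qed.

Lemma measurable_D_eps :
  measurable_fun `[0, T] (fun t => D_eps alpha gamma zs q eps (n t)).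
Proof.
apply: measurable_funeM; apply: measurable_nneseries => // l lp; last exact: measurable_dissipation.
move=> t; rewrite /= in_itv/= => tT; apply: diss_ge0 => //; exact: curve_nonneg.
Qed.

Lemma measurable_D_mic x :
  measurable_fun `[0, T] (fun t => D_mic alpha gamma zs q x eps (n t)).
Proof.
apply: measurable_funeM; apply: emeasurable_sum_nat => // l /andP[lp _].
exact: measurable_dissipation.
Qed.

Let scale : R := eps `^ (- (1 - alpha + gamma)).

Lemma K_eps_test_le t (g : nat -> R) B P (eta : R) : 0 <= t <= T ->
  (forall m, (B <= m)%N -> g m = 0) -> (0 < P)%N ->
  (forall l, (0 < l)%N -> `|g 1%N + g l - g l.+1| <= 2) ->
  (forall l, (0 < l)%N -> (l < P)%N -> g 1%N + g l - g l.+1 = 0) -> 0 < eta ->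
  (`|\sum_(1 <= m < B) g m * K_eps alpha gamma zs q eps (n t) (w t) m|%:E <=
   (eps `^ (- (1 - alpha + gamma)) * (eta * (mobility_const zs q rho0 * P%:R `^ (alpha - 1))))%:E +
   (eps `^ (- (1 - alpha + gamma)) / (eta * D_scale alpha gamma zs eps))%:E *
     A_eps alpha gamma zs q eps (n t) (w t))%E.
Proof.
move=> tT gB Pp g2 g0 eta0.
have s0 : 0 < scale by exact: powR_gt0.
have d0 : 0 < D_scale alpha gamma zs eps by apply: divr_gt0 => //; exact: powR_gt0.
have hn := curve_states tT.
have term0 l : (1 <= l)%N -> 0 <= mobility (n t) l * `|nabla (lift (w t)) l| ^+ 2.
  by move=> lp; rewrite mulr_ge0 ?exprn_ge0//; exact: mobility_ge0.
rewrite -/scale /A_eps; set Ssum := (\sum_(1 <= l <oo) _)%E.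
have S0 : (0 <= Ssum)%E by apply: nneseries_ge0 => l lp _; rewrite lee_fin; exact: term0.
have c0 : 0 < scale / (eta * D_scale alpha gamma zs eps) by posi.
have hS : forall l, (1 <= l)%N -> (0%E <= (mobility (n t) l * `|nabla (lift (w t)) l| ^+ 2)%:E)%E.
  by move=> l lp; rewrite lee_fin; exact: term0.
(* If the action is infinite at this time, so is the right-hand side. *)
case E : Ssum S0 => [S| |]// S0; last first.
  by rewrite gt0_muley ?lte_fin// gt0_muley ?lte_fin// addey ?leey.
have hSN N : \sum_(1 <= l < N) mobility (n t) l * `|nabla (lift (w t)) l| ^+ 2 <= S.
  by apply: nneseriesr_partial_le => //; rewrite -/Ssum E.
have hK m : (1 <= m)%N -> cvgn (K_partial alpha gamma zs q (n t) (lift (w t)) m).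
  by move=> mp; case: hcurve => _ _ _ /(_ t tT) [hc _] _; exact: hc.
have := @K_test_le R alpha gamma zs q rho0 halpha hgamma hzs hq (n t) (lift (w t)) g B P eta S
  hn gB hK Pp g2 g0 eta0 hSN.
have -> : \sum_(1 <= m < B) g m * K_eps alpha gamma zs q eps (n t) (w t) m =
    scale * \sum_(1 <= m < B) g m * K alpha gamma zs q (n t) (lift (w t)) m.
  by rewrite mulr_sumr; apply: eq_bigr => m _; rewrite /K_eps mulrCA.
move=> h; rewrite -!EFinM -EFinD lee_fin normrM (gtr0_norm s0).
apply: (le_trans (ler_wpM2l (ltW s0) h)).
by rewrite le_eqVlt; apply/orP; left; apply/eqP; field; rewrite !gt_eqF.
Qed.

End Curve.

Lemma minn_double_l (l P : nat) : (l <= P)%N -> minn l (P.*2 - l) = l.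
Proof. by lia. Qed.

Lemma minn_double_r (l P : nat) : (P <= l)%N -> minn l (P.*2 - l) = (P.*2 - l)%N.
Proof. by lia. Qed.

(** * Mass transport along a curve of finite action *)

Section Transport.
Context {R : realType}.
Variables alpha gamma zs q rho0 T eps : R.
Hypotheses (halpha : 0 <= alpha < 1) (hgamma : 0 < gamma < 1).
Hypotheses (hzs : 0 < zs) (hq : 0 < q) (hT : 0 < T) (heps : 0 < eps).
Variables (n : R -> nat -> R) (w : R -> R -> R).
Hypothesis hcurve : rescaled_curve alpha gamma zs q rho0 T eps n w.
Variable CA : R.
Hypothesis hA : (int_A alpha gamma zs q T eps n w <= CA%:E)%E.
Implicit Types (l m N P : nat).

Let mu := @lebesgue_measure R.
Local Notation A_t := (fun t => A_eps alpha gamma zs q eps (n t) (w t)).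
Local Notation K_t m := (fun t => K_eps alpha gamma zs q eps (n t) (w t) m).

Let mIo : measurable (`]0, T[%classic : set (measurableTypeR R)). Proof. by []. Qed.

Let A_ge0 t : (0 <= A_t t)%E.
Proof.
apply: mule_ge0; first by rewrite lee_fin divr_ge0 ?powR_ge0// ltW.
apply: nneseries_ge0 => l lp _; rewrite lee_fin mulr_ge0 ?exprn_ge0//.
exact: mobility_ge0.
Qed.

Lemma integral_action_bound (c1 c2 : R) : 0 <= c1 -> 0 <= c2 ->
  (\int[mu]_(t in `[0%R, T]) (c1%:E + c2%:E * A_t t) <= (c1 * T + c2 * CA)%:E)%E.
Proof.
move=> c10 c20.
have mA := measurable_A_eps hzs hq hcurve.
rewrite ge0_integralD//; last 2 first.
- by move=> t _; apply: mule_ge0.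
- exact: measurable_funeM.
rewrite ge0_integralZl// integral_cst//= lebesgue_measure_itv/= lte_fin hT.
rewrite -EFinB subr0 -EFinM EFinD leeD2l// EFinM; exact: lee_wpmul2l.
Qed.

Lemma measurable_action_bound (c1 c2 : R) :
  measurable_fun `[0, T] (fun t => c1%:E + c2%:E * A_t t)%E.
Proof.
apply: emeasurable_funD => //; apply: measurable_funeM.
exact: (measurable_A_eps hzs hq hcurve).
Qed.

Lemma integrable_test_K (zeta : R -> R) m : Cc1 `]0, T[ zeta -> (1 <= m)%N ->
  mu.-integrable `]0, T[ (EFin \o (fun t => zeta t * K_t m t)).
Proof.
move=> [dz cz _] mp.
have cont_zeta : continuous zeta.
  by move=> t; apply: differentiable_continuous; apply/derivable1_diffP; exact: dz.
have [c _ hc] : exists2 c, c \in `[0, T] & forall t, t \in `[0, T] -> `|zeta t| <= `|zeta c|.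
  apply: EVT_max; first exact: ltW.
  by apply: continuous_subspaceT => t; apply: cvg_norm; exact: cont_zeta.
set Z := `|zeta c| in hc.
(* A unit test sequence turns [K_eps_test_le] into a bound on the single component m, integrable in
   time because the action is. *)
pose g l : R := (l == m)%:R.
have gB l : (m.+1 <= l)%N -> g l = 0.
  by rewrite /g; case: eqP => // ->; rewrite ltnn.
have g2 l : (0 < l)%N -> `|g 1%N + g l - g l.+1| <= 2.
  by rewrite /g => _; case: (1%N == m); case: (l == m); case: (l.+1 == m);
    rewrite /= ?mulr1n ?mulr0n ler_norml; lra.
set s := eps `^ (- (1 - alpha + gamma)); have s0 : 0 <= s by exact: powR_ge0.
have d0 : 0 < D_scale alpha gamma zs eps by apply: divr_gt0 => //; exact: powR_gt0.
pose c1 := Num.max 0 (s * (1 * (mobility_const zs q rho0 * 1%:R `^ (alpha - 1)))).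
pose c2 := s / (1 * D_scale alpha gamma zs eps).
have c10 : 0 <= c1 by rewrite le_max lexx.
have c20 : 0 <= c2 by rewrite /c2 mul1r divr_ge0// ltW.
have hK t : 0 <= t <= T -> (`|K_t m t|%:E <= c1%:E + c2%:E * A_t t)%E.
  move=> tT; have := @K_eps_test_le R alpha gamma zs q rho0 T eps halpha hgamma hzs hq heps n w
    hcurve t g m.+1 1 1 tT gB isT g2 _ ltr01.
  have -> : \sum_(1 <= k < m.+1) g k * K_eps alpha gamma zs q eps (n t) (w t) k = K_t m t.
    rewrite big_nat_recr//= {2}/g eqxx mul1r big_nat big1 ?add0r// => k /andP[_ km].
    by rewrite /g (ltn_eqF km) mul0r.
  move=> h; apply: le_trans (h _) _; first by case.
  by apply: leeD => //; rewrite lee_fin le_max lexx orbT.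
have mK := measurable_K_eps hcurve mp.
have mzK : measurable_fun `[0, T] (fun t => zeta t * K_t m t).
  by apply: measurable_funM => //; apply: measurable_funTS; exact: continuous_measurable_fun.
have h : mu.-integrable `[0, T] (EFin \o (fun t => zeta t * K_t m t)).
  apply/integrableP; split; first exact/measurable_EFinP.
  have := integral_action_bound (mulr_ge0 (normr_ge0 (zeta c)) c10) (mulr_ge0 (normr_ge0 (zeta c)) c20).
  move=> h; apply: le_lt_trans (ltry _); apply: le_trans h.
  apply: ge0_le_integral => //.
  - by apply: measurableT_comp => //; exact/measurable_EFinP.
  - exact: measurable_action_bound.
  move=> t; rewrite /= in_itv/= => tT; rewrite normrM EFinM.
  apply: (@le_trans _ _ (Z%:E * (c1%:E + c2%:E * A_t t))%E).
    by apply: lee_pmul; rewrite ?lee_fin//; [apply: hc; rewrite in_itv|exact: hK].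
  rewrite ge0_muleDr; [|by rewrite lee_fin|by apply: mule_ge0; [rewrite lee_fin|exact: A_ge0]].
  by rewrite muleA -!EFinM.
by apply: integrableS h => //; exact: subset_itv_oo_cc.
Qed.

(** Linearity of the weak equation; the induction carries the integrability of both integrands
    along, as additivity of real integrals requires it. *)
Lemma weak_curve_sum (g : nat -> R) B (zeta : R -> R) : Cc1 `]0, T[ zeta ->
  \int[mu]_(t in `]0, T[) (derive1 zeta t * \sum_(1 <= m < B) g m * n t m) =
  - \int[mu]_(t in `]0, T[) (zeta t * \sum_(1 <= m < B) g m * K_t m t).
Proof.
move=> hz; have [_ cz _] := hz.
have ia m : (1 <= m)%N -> mu.-integrable `]0, T[ (EFin \o (fun t => derive1 zeta t * n t m)).
  move=> mp; have cn := curve_continuous hcurve mp.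
  have cz' : {within `[0, T], continuous (derive1 zeta)} by exact: continuous_subspaceT.
  by apply: within_integrable => t; apply: cvgM; [exact: cz'|exact: cn].
have ib m : (1 <= m)%N -> mu.-integrable `]0, T[ (EFin \o (fun t => zeta t * K_t m t)).
  by move=> mp; exact: integrable_test_K.
have eqm m : (1 <= m)%N -> \int[mu]_(t in `]0, T[) (derive1 zeta t * n t m) =
   - \int[mu]_(t in `]0, T[) (zeta t * K_t m t).
  by move=> mp; case: hcurve => _ _ _ _ /(_ m mp zeta hz).
have intZ (c : R) (f : R -> R) : mu.-integrable `]0, T[ (EFin \o f) ->
  mu.-integrable `]0, T[ (EFin \o (fun t => c * f t)).
  by move=> hf; have := integrableZl mIo c hf; apply: eq_integrable.
suff : [/\ mu.-integrable `]0, T[ (EFin \o (fun t => derive1 zeta t * \sum_(1 <= m < B) g m * n t m)),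
   mu.-integrable `]0, T[ (EFin \o (fun t => zeta t * \sum_(1 <= m < B) g m * K_t m t)) &
   \int[mu]_(t in `]0, T[) (derive1 zeta t * \sum_(1 <= m < B) g m * n t m) =
   - \int[mu]_(t in `]0, T[) (zeta t * \sum_(1 <= m < B) g m * K_t m t)] by case.
have z (f : R -> R) (k : nat -> R -> R) B' : (B' <= 1)%N ->
    (fun t => f t * \sum_(1 <= m < B') k m t) = cst 0.
  by move=> B1; apply/funext => t; rewrite big_geq// mulr0.
have base B' : (B' <= 1)%N -> [/\
   mu.-integrable `]0, T[ (EFin \o (fun t => derive1 zeta t * \sum_(1 <= m < B') g m * n t m)),
   mu.-integrable `]0, T[ (EFin \o (fun t => zeta t * \sum_(1 <= m < B') g m * K_t m t)) &
   \int[mu]_(t in `]0, T[) (derive1 zeta t * \sum_(1 <= m < B') g m * n t m) =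
   - \int[mu]_(t in `]0, T[) (zeta t * \sum_(1 <= m < B') g m * K_t m t)].
  move=> B1; rewrite (z (derive1 zeta) (fun m t => g m * n t m))//.
  rewrite (z zeta (fun m t => g m * K_t m t))//.
  by rewrite Rintegral_cst// mul0r oppr0; split => //; exact: integrable0.
elim: B => [|[|B] IH]; [exact: base|exact: base|].
case: IH => i1 i2 e12.
have E1 : (fun t => derive1 zeta t * \sum_(1 <= m < B.+2) g m * n t m) =
  (fun t => derive1 zeta t * \sum_(1 <= m < B.+1) g m * n t m + g B.+1 * (derive1 zeta t * n t B.+1)).
  by apply/funext => t; rewrite big_nat_recr//= mulrDr; congr (_ + _); ring.
have E2 : (fun t => zeta t * \sum_(1 <= m < B.+2) g m * K_t m t) =
  (fun t => zeta t * \sum_(1 <= m < B.+1) g m * K_t m t + g B.+1 * (zeta t * K_t B.+1 t)).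
  by apply/funext => t; rewrite big_nat_recr//= mulrDr; congr (_ + _); ring.
have j1 := intZ (g B.+1) _ (ia B.+1 isT).
have j2 := intZ (g B.+1) _ (ib B.+1 isT).
rewrite E1 E2; split.
- by have := integrableD mIo i1 j1; apply: eq_integrable.
- by have := integrableD mIo i2 j2; apply: eq_integrable.
rewrite RintegralD// RintegralD// opprD e12; congr (_ + _).
by rewrite RintegralZl ?ia// RintegralZl ?ib// eqm// mulrN.
Qed.

(** The test sequence equals l up to P, so it sees all the initial mass there; it then descends to 0
    at 2 P, so it has finite support and stays below l. Turning back with slope -1 keeps the defect
    of each reaction at most 2. *)
Lemma curve_mass_transport P (eta : R) t : (0 < P)%N -> 0 < eta -> 0 <= t <= T ->
  \sum_(1 <= l < P.+1) l%:R * n 0 l -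
    (eps `^ (- (1 - alpha + gamma)) * (eta * (mobility_const zs q rho0 * P%:R `^ (alpha - 1))) * T +
     eps `^ (- (1 - alpha + gamma)) / (eta * D_scale alpha gamma zs eps) * CA)
  <= \sum_(1 <= l < P.*2) l%:R * n t l.
Proof.
move=> Pp eta0 tT.
(* The reactions with [l < P] do not change [\sum_l g l * n l], and only the slow
   ones with [l >= P] are left. *)
pose g l : R := (minn l (P.*2 - l))%:R.
have zT : 0 <= (0 : R) <= T by rewrite lexx ltW.
have gB l : (P.*2 <= l)%N -> g l = 0.
  by move=> h; rewrite /g (eqP (h : P.*2 - l == 0)%N) minn0.
have d0 : 0 < D_scale alpha gamma zs eps by apply: divr_gt0 => //; exact: powR_gt0.
have s0 : 0 < eps `^ (- (1 - alpha + gamma)) by exact: powR_gt0.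
have gd l : (0 < l)%N -> g 1%N + g l - g l.+1 =
    if (l < P)%N then 0 else if (l < P.*2)%N then 2 else 1.
  move=> lp; have g1 : g 1%N = 1 by rewrite /g minn_double_l.
  rewrite g1; case: ltnP => lP.
    by rewrite /g !minn_double_l// ?(ltnW lP)// -natr1; ring.
  case: ltnP => l2P; last by rewrite !gB ?subr0 ?addr0//; exact: leqW.
  rewrite /g !minn_double_r//; last exact: leqW.
  by rewrite -(subnSK l2P) -(natr1 (_ - _)); ring.
have H : `|\sum_(1 <= m < P.*2) g m * n 0 m - \sum_(1 <= m < P.*2) g m * n t m| <=
    eps `^ (- (1 - alpha + gamma)) * (eta * (mobility_const zs q rho0 * P%:R `^ (alpha - 1))) * T +
     eps `^ (- (1 - alpha + gamma)) / (eta * D_scale alpha gamma zs eps) * CA.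
  set c1 := eps `^ _ * _; set c2 := _ / (eta * _).
  have c10 : 0 <= c1.
    have r0 : 0 <= rho0.
      by apply: le_trans (states_le (curve_states hcurve zT) (ltn0Sn 0)); exact: (curve_nonneg hcurve).
    by rewrite /c1 /mobility_const; nneg; exact: ltW.
  have c20 : 0 <= c2 by apply: ltW; rewrite /c2; posi.
  apply: (@weak_oscillation R T (fun t => \sum_(1 <= m < P.*2) g m * n t m)
     (fun t => \sum_(1 <= m < P.*2) g m * K_t m t) (fun t => c1%:E + c2%:E * A_t t)%E) => //.
  - have -> : (fun t => \sum_(1 <= m < P.*2) g m * n t m) =
        (fun t => \sum_(1 <= m < P.*2 | (1 <= m)%N) g m * n t m).
      apply/funext => s; rewrite [LHS]big_nat_cond [RHS]big_nat_cond; apply: eq_bigl => m.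
      by case: (1 <= m)%N; rewrite ?andbF ?andbT.
    move=> s; apply: cvg_big => [|m mp]; first exact: add_continuous.
    by apply: cvgMr; exact: (curve_continuous hcurve mp).
  - apply: measurable_sum_nat => // m /andP[mp _]; apply: measurable_funM => //.
    exact: (measurable_K_eps hcurve).
  - exact: measurable_action_bound.
  - move=> s sT; apply: (K_eps_test_le halpha hgamma hzs hq heps hcurve sT) => //.
      by move=> l lp; rewrite gd//; case: ifP => _; [|case: ifP => _]; rewrite ger0_norm; lra.
    by move=> l lp lP; rewrite gd// lP.
  - exact: integral_action_bound.
  - by move=> zeta hz; exact: weak_curve_sum.
have h0 : \sum_(1 <= l < P.+1) l%:R * n 0 l <= \sum_(1 <= m < P.*2) g m * n 0 m.
  apply: (@le_trans _ _ (\sum_(1 <= m < P.+1) g m * n 0 m)).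
    rewrite !big_nat; apply: ler_sum => l /andP[lp lP].
    by rewrite /g minn_double_l.
  have P1 : (P.+1 <= P.*2)%N by rewrite -addnn -addn1 leq_add2l.
  apply: sum_nat_nonneg_le => // l lp.
  by rewrite mulr_ge0//; apply: (curve_nonneg hcurve).
have h1 : \sum_(1 <= m < P.*2) g m * n t m <= \sum_(1 <= l < P.*2) l%:R * n t l.
  rewrite !big_nat; apply: ler_sum => l /andP[lp lP]; apply: ler_wpM2r.
    exact: (curve_nonneg hcurve).
  by rewrite ler_nat geq_minl.
by move: H h0 h1; rewrite ler_norml; lra.
Qed.

End Transport.

(** * Empirical measures *)

Section EmpiricalMeasure.
Context {R : realType}.
Variable x : R.
Implicit Types (eps : R) (n : nat -> R) (l N : nat).

Local Notation l0 := (l0 x).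

Let atom eps n l : {measure set (measurableTypeR R) -> \bar R} :=
  mscale (NngNum (normr_ge0 (n l / eps))) (dirac (eps * l%:R : measurableTypeR R)).

(** Padding with null measures lets the series start at 0, the form in which integration against a
    series of measures is applied. *)
Let atom_from eps n l : {measure set (measurableTypeR R) -> \bar R} :=
  if (l0 eps <= l)%N then atom eps n l else mzero.

Let Pi_macE' eps n A : Pi_mac x eps n A = mseries (atom_from eps n) 0 A.
Proof.
rewrite /Pi_mac/= /mseries eseries_cond eseries_mkcond; apply: eq_eseriesr => l _ /=.
by rewrite /atom_from; case: ifP.
Qed.

Lemma integral_Pi_mac eps n (D : set (measurableTypeR R)) (f : R -> \bar R) :
  0 < eps -> nonneg n -> (1 <= l0 eps)%N -> measurable D -> measurable_fun D f ->
  (forall lam, D lam -> (0 <= f lam)%E) ->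
  (\int[Pi_mac x eps n]_(lam in D) f lam =
   \sum_(l0 eps <= l <oo) (n l / eps)%:E * (\d_(eps * l%:R)%R D * f (eps * l%:R)%R))%E.
Proof.
move=> e0 n0 lp mD mf f0.
rewrite (eq_measure_integral (mseries (atom_from eps n) 0)); last first.
  by move=> A _ _; exact: Pi_macE'.
rewrite ge0_integral_measure_series// [RHS]eseries_cond [RHS]eseries_mkcond.
apply: eq_eseriesr => l _; rewrite /atom_from /=; case: ifP => ll; last first.
  by rewrite integral_measure_zero.
rewrite /atom ge0_integral_mscale// integral_dirac//=.
by rewrite ger0_norm// divr_ge0 ?(ltW e0)//; apply: n0; exact: leq_trans ll.
Qed.

Lemma Pi_mac_tail eps n r (delta : R) a N : 0 < eps -> nonneg n -> (1 <= l0 eps)%N ->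
  0 <= r -> (\int[Pi_mac x eps n]_(lam in `[r, +oo[) lam%:E <= delta%:E)%E ->
  (l0 eps <= a)%N -> r <= eps * a%:R ->
  \sum_(a <= l < N) l%:R * n l <= delta.
Proof.
move=> e0 n0 lp r0 hI la ra; rewrite -lee_fin; apply: le_trans hI.
rewrite integral_Pi_mac//; last first.
  by move=> lam; rewrite /= in_itv/= andbT lee_fin => /(le_trans r0).
rewrite -sumEFin.
have t0 l : (l0 eps <= l)%N -> (0 <= (n l / eps)%:E * (\d_(eps * l%:R)%R `[r, +oo[ * (eps * l%:R)%:E))%E.
  move=> ll; apply: mule_ge0.
    by rewrite lee_fin divr_ge0 ?(ltW e0)//; apply: n0; exact: leq_trans ll.
  by apply: mule_ge0 => //; rewrite lee_fin mulr_ge0// ltW.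
apply: le_trans (nneseries_lim_ge N (fun l ll _ => t0 l ll)).
apply: (@le_trans _ _ (\sum_(a <= l < N) (n l / eps)%:E * (\d_(eps * l%:R)%R `[r, +oo[ * (eps * l%:R)%:E))%E).
  rewrite !big_nat; apply: lee_sum => l /andP[al _].
  rewrite diracE mem_set; last first.
    by rewrite /= in_itv/= andbT (le_trans ra)// ler_pM2l// ler_nat.
  rewrite mul1e -EFinM lee_fin le_eqVlt; apply/orP; left; apply/eqP.
  by field; rewrite gt_eqF.
have [aN|Na] := leqP a N; last first.
  rewrite (big_geq (ltnW Na)) big_nat; apply: sume_ge0 => l /andP[ll _]; exact: t0.
rewrite [leRHS](big_cat_nat la aN)/=; apply: leeDr.
by rewrite big_nat; apply: sume_ge0 => l /andP[ll _]; exact: t0.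
Qed.

Lemma Rintegral_Pi_mac eps n (f : R -> R) N : 0 < eps -> nonneg n -> (1 <= l0 eps)%N ->
  continuous f -> (forall lam, 0 <= f lam) -> (forall lam, N%:R * eps <= lam -> f lam = 0) ->
  \int[Pi_mac x eps n]_(lam in `]0, +oo[) f lam =
  \sum_(l0 eps <= l < N) n l / eps * f (eps * l%:R).
Proof.
move=> e0 n0 lp cf f0 fN; rewrite /Rintegral integral_Pi_mac//; last 2 first.
- apply/measurable_EFinP; apply: measurable_funTS.
  exact: continuous_measurable_fun.
- by move=> lam _; rewrite lee_fin.
have E l : (l0 eps <= l)%N -> ((n l / eps)%:E * (\d_(eps * l%:R)%R `]0%R, +oo[ * (f (eps * l%:R))%:E))%E =
   (n l / eps * f (eps * l%:R))%:E.
  move=> ll; rewrite diracE mem_set ?mul1e -?EFinM//.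
  by rewrite /= in_itv/= andbT mulr_gt0// ltr0n; exact: leq_trans ll.
have -> : (\sum_(l0 eps <= l <oo) (n l / eps)%:E * (\d_(eps * l%:R)%R `]0%R, +oo[ * (f (eps * l%:R))%:E))%E =
   (\sum_(l0 eps <= l < N) n l / eps * f (eps * l%:R))%:E.
  apply/cvg_lim => //; apply: cvg_near_cst; exists N => // M /= NM.
  rewrite -sumEFin; have [lN|Nl] := leqP (l0 eps) N.
    rewrite (big_cat_nat lN NM)/= [X in (_ + X)%E]big_nat [X in (_ + X)%E]big1 ?adde0.
      by rewrite !big_nat; apply: eq_bigr => l /andP[ll _]; exact: E.
    move=> l /andP[Nl _]; rewrite E ?(leq_trans lN)//.
    by rewrite fN ?mulr0// mulrC ler_pM2l// ler_nat.
  rewrite [RHS](big_geq (ltnW Nl)) big_nat big1// => l /andP[ll _].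
  rewrite E// fN ?mulr0// mulrC ler_pM2l// ler_nat.
  by apply: leq_trans ll; exact: ltnW.
by [].
Qed.

End EmpiricalMeasure.

Section UniformTightness.
Context {R : realType}.
Variables alpha gamma zs q rho0 T x epsbar : R.
Variables (n : R -> R -> nat -> R) (w : R -> R -> R -> R).
Hypotheses (halpha : 0 <= alpha < 1) (hgamma : 0 < gamma < 1).
Hypotheses (hzs : 0 < zs) (hq : 0 < q) (hT : 0 < T) (hx : 0 < x < 2^-1).
Hypothesis hepsbar : 0 < epsbar <= 1.
Hypothesis hcurve : forall eps, 0 < eps <= epsbar ->
  rescaled_curve alpha gamma zs q rho0 T eps (n eps) (w eps).
Variable CA : R.
Hypothesis hA : forall eps, 0 < eps <= epsbar ->
  (int_A alpha gamma zs q T eps (n eps) (w eps) <= CA%:E)%E.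
Hypothesis htight : forall delta : R, 0 < delta ->
    exists R0 : R, forall r : R, R0 <= r -> forall eps : R, 0 < eps <= epsbar ->
      (\int[Pi_mac x eps (n eps 0%R)]_(lam in `[r, +oo[) lam%:E <= delta%:E)%E.
Variable rs : R.
Hypothesis hrho : rs < rho0.

(** [curve_mass_transport] with P of order R1/eps and eta = nu eps^gamma: all powers of eps cancel
    in both error terms. First [nu] is taken large for the action term, then R1 large for the
    mobility term; each costs c/4, and the initial tail costs c/2. *)
Lemma curves_tight : exists2 Rt, 0 < Rt & forall eps, 0 < eps <= epsbar ->
  forall t, 0 <= t <= T -> tight rho0 rs Rt eps (n eps t).
Proof.
have [x0 x2] := andP hx; have [ga0 ga1] := andP hgamma; have [al0 al1] := andP halpha.
set c := (rho0 - rs) / 4; have c0 : 0 < c by apply: divr_gt0 => //; rewrite subr_gt0.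
have [R0 hR0] := htight (divr_gt0 c0 (ltr0Sn R 1)).
(* Makes the action term CA / (zs nu) at most c/4. *)
pose nu := (`|CA| + 1) / (zs * (c / 4)); have nu0 : 0 < nu.
  by apply: divr_gt0; [apply: ltr_wpDl|posi].
pose MC := `|mobility_const zs q rho0| + 1; have MC0 : 0 < MC by apply: ltr_wpDl.
pose kap := c / 4 / (nu * MC * T); have kap0 : 0 < kap by posi.
pose R1 := Num.max R0 (Num.max 1 (kap `^ (- (1 - alpha)^-1))).
have R1R0 : R0 <= R1 by rewrite le_max lexx.
have R11 : 1 <= R1 by rewrite !le_max lexx ?orbT.
have R10 : 0 < R1 by lra.
have R1k : R1 `^ (alpha - 1) <= kap.
  have k1 : kap `^ (- (1 - alpha)^-1) <= R1 by rewrite !le_max lexx ?orbT.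
  have -> : kap = (kap `^ (- (1 - alpha)^-1)) `^ (alpha - 1).
    rewrite -powRrM (_ : - (1 - alpha)^-1 * (alpha - 1) = 1) ?powRr1 ?(ltW kap0)//.
    by field; lra.
  have -> : alpha - 1 = - (1 - alpha) by ring.
  rewrite !(powRN _ (1 - alpha)) lef_pV2 ?posrE ?powR_gt0//.
  by apply: ge0_ler_powR; rewrite ?nnegrE ?powR_ge0 ?(ltW R10) ?subr_ge0 ?(ltW al1).
exists (4 * R1); first by posi.
move=> eps he t tT; have [e0 eb] := andP he; have [_ eb1] := andP hepsbar.
have e1 : eps <= 1 by lra.
have e01 : 0 < eps <= 1 by rewrite e0.
have zT : 0 <= (0 : R) <= T by rewrite lexx ltW.
have lp := l0_gt0 x0 e01.
pose y := R1 / eps; have y1 : 1 <= y by rewrite ler_pdivlMr//; lra.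
have y0 : 0 < y by lra.
pose P := (Num.truncn y).+1.
have yP : y <= P%:R by exact: ltW (truncnS_gt _).
have Py : P%:R <= 2 * y.
  have : (Num.truncn y)%:R <= y by rewrite truncn_le ltW.
  by rewrite /P -natr1; lra.
have hn0 := curve_states (hcurve he) zT.
have n0 := curve_nonneg (hcurve he) zT.
have init : rho0 - c / 2 <= \sum_(1 <= l < P.+1) l%:R * n eps 0 l.
  apply/ler_addgt0Pr => e e00; have [N0 hN0] := states_exhaust hn0 e00.
  have := hN0 (maxn N0 P.+1) (leq_maxl _ _).
  rewrite (big_cat_nat (_ : 1 <= P.+1)%N (leq_maxr _ _))//=.
  have := @Pi_mac_tail R x eps (n eps 0) R1 (c / 2) P.+1 (maxn N0 P.+1) e0 n0 lp (ltW R10) (hR0 R1 R1R0 _ he).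
  have lP : (l0 x eps <= P.+1)%N.
    apply: leqW; rewrite -(ler_nat R); apply: le_trans yP.
    apply: (le_trans (l0_le x eps)); apply: (@le_trans _ _ (eps `^ (- 1))).
      by apply: ger_powR; [rewrite e0|lra].
    by rewrite powR_inv1 ?(ltW e0)// /y ler_peMl// invr_ge0 ltW.
  have rP : R1 <= eps * P.+1%:R.
    rewrite mulrC -ler_pdivrMr//; apply: (le_trans yP); by rewrite ler_nat.
  by move=> /(_ lP rP); lra.
have := @curve_mass_transport R alpha gamma zs q rho0 T eps halpha hgamma hzs hq hT e0
  (n eps) (w eps) (hcurve he) CA (hA he) P (eps `^ gamma * nu) t isT _ tT.
have en0 : 0 < eps `^ gamma * nu by posi.
move=> /(_ en0); set S2 := \sum_(_ <= _ < P.*2) _.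
have p1 : P%:R `^ (alpha - 1) <= R1 `^ (alpha - 1) * eps `^ (1 - alpha).
  rewrite -tight_scale//; have -> : alpha - 1 = - (1 - alpha) by ring.
  rewrite !(powRN _ (1 - alpha)) lef_pV2 ?posrE ?powR_gt0// ?ltr0n//.
  by apply: ge0_ler_powR; rewrite ?nnegrE ?ler0n ?(ltW y0) ?subr_ge0 ?(ltW al1).
have pw : eps `^ (- (1 - alpha + gamma)) * (eps `^ gamma * eps `^ (1 - alpha)) = 1.
  by rewrite -!powRD_pos// -[RHS](powRr0 eps); congr (_ `^ _); ring.
have t1 : eps `^ (- (1 - alpha + gamma)) *
   (eps `^ gamma * nu * (mobility_const zs q rho0 * P%:R `^ (alpha - 1))) * T <= c / 4.
  have s0 : 0 <= eps `^ (- (1 - alpha + gamma)) by exact: powR_ge0.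
  have P0 : 0 <= P%:R `^ (alpha - 1) :> R by exact: powR_ge0.
  apply: (@le_trans _ _ (eps `^ (- (1 - alpha + gamma)) *
    (eps `^ gamma * nu * (MC * (kap * eps `^ (1 - alpha)))) * T)).
    apply: ler_wpM2r; first exact: ltW.
    apply: ler_wpM2l => //; apply: ler_wpM2l; first exact: ltW.
    apply: (@le_trans _ _ (MC * P%:R `^ (alpha - 1))).
      by apply: ler_wpM2r => //; have := ler_norm (mobility_const zs q rho0); rewrite /MC; lra.
    apply: ler_wpM2l; first exact: ltW.
    apply: (le_trans p1); apply: ler_wpM2r => //; exact: powR_ge0.
  have -> : eps `^ (- (1 - alpha + gamma)) *
    (eps `^ gamma * nu * (MC * (kap * eps `^ (1 - alpha)))) * T =
    (eps `^ (- (1 - alpha + gamma)) * (eps `^ gamma * eps `^ (1 - alpha))) * (kap * (nu * MC * T)) by ring.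
  have nz : nu * MC * T != 0 by apply: lt0r_neq0; posi.
  by rewrite pw mul1r /kap divfK.
have t2 : eps `^ (- (1 - alpha + gamma)) / (eps `^ gamma * nu * D_scale alpha gamma zs eps) * CA <= c / 4.
  have gg : eps `^ (1 - alpha + 2 * gamma) = eps `^ gamma * (eps `^ gamma * eps `^ (1 - alpha)).
    by rewrite -!powRD_pos//; congr (_ `^ _); ring.
  have -> : eps `^ (- (1 - alpha + gamma)) / (eps `^ gamma * nu * D_scale alpha gamma zs eps) * CA =
    (eps `^ (- (1 - alpha + gamma)) * (eps `^ gamma * eps `^ (1 - alpha))) * (CA / (zs * nu)).
    by rewrite /D_scale gg; field; rewrite !gt_eqF// powR_gt0.
  rewrite pw mul1r ler_pdivrMr; last by posi.
  have -> : c / 4 * (zs * nu) = `|CA| + 1.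
    by rewrite /nu; field; rewrite !gt_eqF.
  by have := ler_norm CA; lra.
move=> h; exists P.*2.
  have -> : 4 * R1 / eps = 4 * y by rewrite /y mulrA.
  by rewrite -muln2 natrM; lra.
by rewrite -/c -/S2; move: h init t1 t2; lra.
Qed.

End UniformTightness.

(** * Diagonal extraction *)

Section Diagonal.
Context {R : realType}.
Let mu := @lebesgue_measure R.

Lemma increasing_choice (Q : nat -> nat -> Prop) :
  (forall j, exists N, forall k, (N <= k)%N -> Q j k) ->
  exists sigma : nat -> nat, {homo sigma : i j / (i < j)%N} /\ forall j, Q j (sigma j).
Proof.
move=> /choice[N hN].
pose sigma := fix s j := if j is i.+1 then maxn (s i).+1 (N i.+1) else N 0%N.
exists sigma; split.
  apply: homo_ltn => [i j k|j]; first exact: ltn_trans.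
  by rewrite /= leq_max ltnSn.
by case=> [|j]; apply: hN => //=; rewrite leq_maxr.
Qed.

Variables (T : R) (Dk : nat -> R -> \bar R) (X : nat -> nat -> R -> R).
Variables (Xl : nat -> R -> R) (B : nat -> R) (CD : R) (Q : nat -> nat -> Prop).
Hypothesis mD : forall k, measurable_fun `[0, T] (Dk k).
Hypothesis D0 : forall k t, 0 <= t <= T -> (0 <= Dk k t)%E.
Hypothesis DC : forall k, (\int[mu]_(t in `[0%R, T]) Dk k t <= CD%:E)%E.
Hypothesis mX : forall j k, measurable_fun `[0, T] (X j k).
Hypothesis XB : forall j k t, 0 <= t <= T -> `|X j k t| <= B j.
Hypothesis Xcvg : forall j t, 0 <= t <= T -> X j k t @[k --> \oo] --> Xl j t.
Hypothesis hQ : forall j, exists N, forall k, (N <= k)%N -> Q j k.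

Let mI : measurable (`[0, T]%classic : set (measurableTypeR R)). Proof. by []. Qed.

Let mXl j : measurable_fun `[0, T] (Xl j).
Proof.
apply: (measurable_fun_cvg (mX j)) => t; rewrite /= in_itv/= => tT; exact: Xcvg.
Qed.

Let Xdiff j k := (fun t => `|X j k t - Xl j t|%:E : \bar R).

Let mdiff j k : measurable_fun `[0, T] (Xdiff j k).
Proof.
by apply/measurable_EFinP; apply: measurableT_comp => //; exact: measurable_funB.
Qed.

Let L1_cvg j (e : R) : 0 < e -> exists N, forall k, (N <= k)%N ->
  (\int[mu]_(t in `[0%R, T]) Xdiff j k t <= e%:E)%E.
Proof.
move=> e0.
have hc : mu.-integrable `[0, T] (cst (B j)%:E).
  have : mu.-integrable `[0, T] (EFin \o cst (B j)).
    by apply: continuous_compact_integrable; [exact: segment_compact|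
      apply: continuous_subspaceT; exact: cst_continuous].
  by apply: eq_integrable.
have mf k : measurable_fun `[0, T] (EFin \o X j k) by exact/measurable_EFinP.
have ml : measurable_fun `[0, T] (EFin \o Xl j) by exact/measurable_EFinP.
have [] := @dominated_convergence _ _ R mu (`[0, T]%classic) mI (fun k => EFin \o X j k) (EFin \o Xl j) (cst (B j)%:E) mf ml _ hc _.
- apply: aeW => t; rewrite /= in_itv/= => tT.
  apply/fine_cvgP; split; first exact: nearW.
  exact: Xcvg.
- by apply: aeW => t k; rewrite /= in_itv/= => tT; rewrite lee_fin; exact: XB.
move=> _ + _ => h.
have /fine_cvgP[[N1 _ h1] /cvgrPdist_le/(_ e e0)[N2 _ h2]] := h.
exists (maxn N1 N2) => k; rewrite geq_max => /andP[k1 k2].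
have := h2 k k2; have := h1 k k1; rewrite /= => fin.
rewrite sub0r normrN => hh.
rewrite (_ : Xdiff j k = (fun t => `|(X j k t)%:E - (Xl j t)%:E|)%E)//.
by rewrite -(fineK fin) lee_fin; apply: le_trans hh; exact: ler_norm.
Qed.

(* [Dk k] is bounded in L^1 only. Along a fast subsequence the sum over [j] of
   [2^-j * Dk (sigma j) + 2^j * |X j (sigma j) - Xl j|] has a finite integral, hence
   it is finite almost everywhere; [s] is its value at [t]. *)
Lemma diagonal_ae : exists sigma : nat -> nat,
  [/\ {homo sigma : i j / (i < j)%N}, forall j, Q j (sigma j) &
   {ae mu, forall t, 0 < t < T -> exists2 s : R, 0 <= s & forall j,
     (Dk (sigma j) t <= (2 ^+ j * s)%:E)%E /\ `|X j (sigma j) t - Xl j t| <= 2 ^- j * s}].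
Proof.
(* The rate 4^-j leaves a summable 2^-j after multiplication by 2^j. *)
have hQ' j : exists N, forall k, (N <= k)%N -> Q j k /\
    (\int[mu]_(t in `[0%R, T]) Xdiff j k t <= (4 ^- j)%:E)%E.
  have [N1 h1] := hQ j; have [|N2 h2] := @L1_cvg j (4 ^- j); first by rewrite invr_gt0 exprn_gt0.
  exists (maxn N1 N2) => k; rewrite geq_max => /andP[k1 k2].
  by split; [exact: h1|exact: h2].
have [sigma [hs hP]] := increasing_choice hQ'.
exists sigma; split => //; first by move=> j; have [] := hP j.
pose g j t : \bar R := ((2 ^- j)%:E * Dk (sigma j) t + (2 ^+ j)%:E * Xdiff j (sigma j) t)%E.
have p0 j : 0 <= (2 : R) ^- j by rewrite invr_ge0 exprn_ge0.
have q0 j : 0 <= (2 : R) ^+ j by rewrite exprn_ge0.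
have d0 j t : (0 <= Xdiff j (sigma j) t)%E by rewrite lee_fin.
have g0 j t : `[0, T]%classic t -> (0 <= g j t)%E.
  rewrite /= in_itv/= => tT; apply: adde_ge0; apply: mule_ge0; rewrite ?lee_fin//.
  exact: D0.
have mg j : measurable_fun `[0, T] (g j).
  by apply: emeasurable_funD; apply: measurable_funeM => //; exact: mdiff.
have ig j : (\int[mu]_(t in `[0%R, T]) g j t <= ((CD + 1) * 2 ^- j)%:E)%E.
  have u1 t : `[0, T]%classic t -> (0 <= Dk (sigma j) t)%E by rewrite /= in_itv/=; exact: D0.
  have u2 t : `[0, T]%classic t -> (0 <= Xdiff j (sigma j) t)%E by [].
  have v1 t : `[0, T]%classic t -> (0 <= (2 ^- j)%:E * Dk (sigma j) t)%E.
    by move=> tI; apply: mule_ge0; [rewrite lee_fin|exact: u1].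
  have v2 t : `[0, T]%classic t -> (0 <= (2 ^+ j)%:E * Xdiff j (sigma j) t)%E.
    by move=> tI; apply: mule_ge0; [rewrite lee_fin|exact: u2].
  have w1 : measurable_fun `[0, T] (fun t => (2 ^- j)%:E * Dk (sigma j) t)%E.
    exact: measurable_funeM.
  have w2 : measurable_fun `[0, T] (fun t => (2 ^+ j)%:E * Xdiff j (sigma j) t)%E.
    by apply: measurable_funeM; exact: mdiff.
  rewrite (ge0_integralD mu mI v1 w1 v2 w2).
  rewrite (ge0_integralZl mu mI (mD (sigma j)) u1); last by rewrite lee_fin.
  rewrite (ge0_integralZl mu mI (mdiff j (sigma j)) u2); last by rewrite lee_fin.
  rewrite mulrDl EFinD; apply: leeD.
    by rewrite mulrC EFinM; apply: lee_wpmul2l => //; rewrite lee_fin.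
  have [_ h] := hP j; apply: le_trans (lee_wpmul2l _ h) _; first by rewrite lee_fin.
  have e4 : (4 : R) ^- j = 2 ^- j * 2 ^- j.
    by rewrite -invfM -exprMn; congr (_ ^- _); rewrite -natrM.
  by rewrite -EFinM lee_fin mul1r e4 mulrA divff ?mul1r// expf_neq0.
have CD0 : 0 <= CD.
  rewrite -lee_fin; apply: le_trans (DC 0); apply: integral_ge0 => t.
  by rewrite /= in_itv/=; exact: D0.
have iS : (\int[mu]_(t in `[0%R, T]) (\sum_(0 <= j <oo) g j t) < +oo)%E.
  rewrite integral_nneseries//; apply: (@le_lt_trans _ _ (\sum_(0 <= j <oo) ((CD + 1) * 2 ^- j)%:E)%E).
    apply: lee_nneseries => j *; last exact: ig.
    by apply: integral_ge0; exact: g0.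
  apply: (@le_lt_trans _ _ ((CD + 1) * 2)%:E); last exact: ltry.
  apply: lime_le.
    by apply: is_cvg_nneseries => j _ _; rewrite lee_fin mulr_ge0// addr_ge0.
  apply: nearW => N; rewrite sumEFin lee_fin -mulr_sumr; apply: ler_wpM2l.
    by rewrite addr_ge0.
  suff : \sum_(0 <= j < N) (2 : R) ^- j = 2 - 2 * 2 ^- N.
    by move=> ->; rewrite lerBlDr lerDl mulr_ge0.
  elim: N => [|N IH]; first by rewrite big_geq// expr0 invr1; ring.
  by rewrite big_nat_recr//= IH exprS invfM; field; rewrite expf_neq0.
have mS : measurable_fun `[0, T] (fun t => \sum_(0 <= j <oo) g j t)%E.
  by apply: measurable_nneseries => // l _ t; exact: g0.
have iS' : mu.-integrable `[0, T] (fun t => \sum_(0 <= j <oo) g j t)%E.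
  apply/integrableP; split => //; apply: le_lt_trans iS.
  rewrite le_eqVlt; apply/orP; left; apply/eqP; apply: eq_integral => t.
  by rewrite inE => tI; rewrite gee0_abs//; apply: nneseries_ge0 => j _ _; exact: g0.
have := integrable_ae mI iS'; apply: filterS => t /= + /andP[t0 tT].
have tI : 0 <= t <= T by rewrite !ltW.
rewrite in_itv/= => /(_ tI) fin.
have tI' : `[0, T]%classic t by rewrite /= in_itv.
have gle j : (g j t <= \sum_(0 <= j <oo) g j t)%E.
  apply: le_trans (nneseries_lim_ge j.+1 (fun i _ _ => g0 i t tI')).
  rewrite big_nat_recr//=; apply: leeDr; rewrite big_nat; apply: sume_ge0 => i _; exact: g0.
set S := (\sum_(0 <= j <oo) g j t)%E in fin gle *.
have S0 : (0 <= S)%E by apply: nneseries_ge0 => j _ _; exact: g0.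
exists (fine S); first exact: fine_ge0.
move=> j; have := gle j; rewrite -(fineK fin) => h.
have a0 : (0 <= (2 ^- j)%:E * Dk (sigma j) t)%E by apply: mule_ge0; [rewrite lee_fin|exact: D0].
have b0 : (0 <= (2 ^+ j)%:E * Xdiff j (sigma j) t)%E by apply: mule_ge0; rewrite ?lee_fin.
have pj : 0 < (2 : R) ^+ j by rewrite exprn_gt0.
split.
  have h1 : ((2 ^- j)%:E * Dk (sigma j) t <= (fine S)%:E)%E.
    by apply: le_trans h; apply: leeDl.
  have := lee_wpmul2l (_ : 0 <= (2 ^+ j)%:E)%E h1; rewrite lee_fin => /(_ (q0 j)).
  by rewrite muleA -!EFinM mulfV ?gt_eqF// mul1e.
have h2 : ((2 ^+ j)%:E * Xdiff j (sigma j) t <= (fine S)%:E)%E.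
  by apply: le_trans h; apply: leeDr.
by rewrite -EFinM lee_fin -ler_pdivlMl// in h2.
Qed.

End Diagonal.

(** * Truncated macroscopic energies *)

Section Cutoff.
Context {R : realType}.
Implicit Types (r s a lam : R).

(** For r <= s a trapezoid: 0 up to r/2, 1 on [r, s], 0 from 2 s on, linear in between. *)
Definition plateau r s lam : R :=
  Num.max 0 (Num.min 1 (Num.min (2 * lam / r - 1) (2 - lam / s))).

(* The maximum with [r / 2] keeps the power continuous up to and below 0, without
   changing the product. *)
Definition cutoff_pow a r s lam : R := Num.max lam (r / 2) `^ a * plateau r s lam.

Lemma plateau_ge0 r s lam : 0 <= plateau r s lam.
Proof. by rewrite le_max lexx. Qed.

Lemma plateau_le1 r s lam : plateau r s lam <= 1.
Proof. by rewrite ge_max ler01/= ge_min lexx. Qed.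

Lemma cutoff_ge0 a r s lam : 0 <= cutoff_pow a r s lam.
Proof. by rewrite mulr_ge0 ?powR_ge0// plateau_ge0. Qed.

Lemma cutoff_low a r s lam : 0 < r -> lam <= r / 2 -> cutoff_pow a r s lam = 0.
Proof.
move=> r0 h; rewrite /cutoff_pow /plateau [Num.max 0 _]max_l ?mulr0//.
by rewrite 2!ge_min subr_le0 ler_pdivrMr// (_ : 2 * lam <= 1 * r) ?orbT//; lra.
Qed.

Lemma cutoff_high a r s lam : 0 < s -> 2 * s <= lam -> cutoff_pow a r s lam = 0.
Proof.
move=> s0 h; rewrite /cutoff_pow /plateau [Num.max 0 _]max_l ?mulr0//.
by rewrite 2!ge_min (subr_le0 (lam / s)) ler_pdivlMr// h !orbT.
Qed.

Lemma cutoff_le a r s lam : 0 < r -> 0 < lam -> cutoff_pow a r s lam <= lam `^ a.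
Proof.
move=> r0 l0; have [h|h] := leP lam (r / 2); first by rewrite cutoff_low// powR_ge0.
rewrite /cutoff_pow max_l ?(ltW h)//; apply: ler_piMr; first exact: powR_ge0.
exact: plateau_le1.
Qed.

Lemma cutoff_eq a r s lam : 0 < r -> 0 < s -> r <= lam <= s -> cutoff_pow a r s lam = lam `^ a.
Proof.
move=> r0 s0 /andP[h1 h2]; rewrite /cutoff_pow max_l; last lra.
rewrite /plateau max_r; last first.
  rewrite !le_min ler01/= subr_ge0 ler_pdivlMr// subr_ge0 ler_pdivrMr//.
  by apply/andP; split; lra.
rewrite min_l ?mulr1// le_min lerBrDr ler_pdivlMr// lerBrDl -lerBrDr ler_pdivrMr//.
by apply/andP; split; lra.
Qed.

Lemma cutoff_mono a r s r' s' lam : 0 < r' -> r' <= r -> 0 < s -> s <= s' -> 0 < lam ->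
  cutoff_pow a r s lam <= cutoff_pow a r' s' lam.
Proof.
move=> r0 rr s0 ss l0; have r0' : 0 < r by lra.
have [h|h] := leP lam (r / 2); first by rewrite cutoff_low// cutoff_ge0.
rewrite /cutoff_pow !max_l; try lra.
apply: ler_wpM2l; first exact: powR_ge0.
rewrite /plateau ge_max le_max lexx/= le_max; apply/orP; right.
rewrite !le_min !ge_min lexx/=; apply/andP; split; apply/orP; right; apply/orP; [left|right].
  rewrite lerD2r; apply: ler_wpM2l; first lra.
  by rewrite lef_pV2 ?posrE.
rewrite lerD2l lerN2; apply: ler_wpM2l; first exact: ltW.
by rewrite lef_pV2 ?posrE//; lra.
Qed.

(** Away from 0 the power is dominated by the linear function, so truncated energies are controlled
    by the mass alone. *)
Lemma cutoff_le_linear a r s lam : a <= 1 -> 0 < r -> 0 < lam ->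
  cutoff_pow a r s lam <= lam * (r / 2) `^ (a - 1).
Proof.
move=> a1 r0 l0; have [h|h] := leP lam (r / 2).
  by rewrite cutoff_low// mulr_ge0 ?powR_ge0// ltW.
apply: (le_trans (cutoff_le a s r0 l0)).
rewrite -{1}(subrKC 1 a) (powRD_pos 1 _ l0) powRr1 ?(ltW l0)// ler_pM2l//.
have -> : a - 1 = - (1 - a) by ring.
have r20 : 0 < r / 2 by exact: divr_gt0.
rewrite !(powRN _ (1 - a)) lef_pV2 ?posrE ?powR_gt0//.
by apply: ge0_ler_powR; rewrite ?nnegrE ?subr_ge0 ?(ltW h) ?(ltW l0) ?(ltW r20).
Qed.

Lemma cutoff_continuous a r s : 0 < r -> continuous (cutoff_pow a r s).
Proof.
move=> r0 u; apply: cvgM.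
  have r20 : 0 < r / 2 by exact: divr_gt0.
  have m0 : 0 < Num.max u (r / 2) by rewrite lt_max r20 orbT.
  have c1 : {for Num.max u (r / 2), continuous (fun v : R => v `^ a)}.
    apply: differentiable_continuous; apply/derivable1_diffP.
    by have [] := is_derive1_powR a m0.
  apply: (@continuous_comp _ _ _ (fun v : R => Num.max v (r / 2)) (fun v => v `^ a)) => //.
  apply: (@continuous_max _ _ id (cst (r / 2))); first exact: cvg_id.
  exact: cst_continuous.
have cA : continuous (fun v : R => 2 * v / r - 1).
  by move=> v; apply: cvgB; [apply: cvgMl; apply: cvgMr; exact: cvg_id|exact: cvg_cst].
have cB : continuous (fun v : R => 2 - v / s).
  by move=> v; apply: cvgB; [exact: cvg_cst|apply: cvgMl; exact: cvg_id].
have cC v : {for v, continuous (fun v : R => Num.min (2 * v / r - 1) (2 - v / s))}.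
  by apply: continuous_min; [exact: cA|exact: cB].
have cD v : {for v, continuous (fun v : R => Num.min 1 (Num.min (2 * v / r - 1) (2 - v / s)))}.
  by apply: (@continuous_min _ _ (cst 1)); [exact: cst_continuous|exact: cC].
exact: (@continuous_max _ _ (cst 0) _ u (@cst_continuous _ _ _ _) (cD u)).
Qed.

Lemma cutoff_Cc0 a r s : 0 < r -> 0 < s -> Cc0 `]0, +oo[ (cutoff_pow a r s).
Proof.
move=> r0 s0; split; first exact: cutoff_continuous.
have sub : closure [set u | cutoff_pow a r s u != 0] `<=` `[r / 2, 2 * s].
  rewrite closureE => u; apply; split; first exact: interval_closed.
  move=> v /=; apply: contraNT; rewrite in_itv/= negb_and -!ltNge => /orP[|] h; apply/eqP.
    by rewrite cutoff_low// ltW.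
  by rewrite cutoff_high// ltW.
split.
  apply: (@subclosed_compact _ _ `[r / 2, 2 * s]) => //; first exact: closed_closure.
  exact: segment_compact.
apply: (subset_trans sub) => u /=; rewrite !in_itv/= andbT => /andP[h _].
by apply: lt_le_trans h; exact: divr_gt0.
Qed.

Variable nu : {measure set (measurableTypeR R) -> \bar R}.
Hypothesis hnu : radon_on_Rplus nu.

Let mRp : measurable (`]0, +oo[%classic : set (measurableTypeR R)).
Proof. by []. Qed.

Lemma measurable_cutoff a r s : 0 < r ->
  measurable_fun (`]0, +oo[%classic : set (measurableTypeR R)) (fun u => (cutoff_pow a r s u)%:E).
Proof.
move=> r0; apply/measurable_EFinP; apply: measurable_funTS.
by apply: continuous_measurable_fun; exact: cutoff_continuous.
Qed.

Lemma cutoff_integral_fin a r s : 0 <= a -> 0 < r -> 0 < s ->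
  (\int[nu]_(u in `]0%R, +oo[) (cutoff_pow a r s u)%:E)%E =
  (\int[nu]_(u in `]0, +oo[) cutoff_pow a r s u)%:E.
Proof.
move=> a0 r0 s0; rewrite /Rintegral fineK//.
set K := (`[r / 2, 2 * s]%classic : set (measurableTypeR R)).
have mK : measurable K by exact: measurable_itv.
have K0 : K `<=` `]0, +oo[.
  move=> u; rewrite /K /= !in_itv/= andbT => /andP[h _].
  by apply: lt_le_trans h; exact: divr_gt0.
have fK : (nu K < +oo)%E by apply: hnu => //; exact: segment_compact.
have m1 : measurable_fun (`]0, +oo[%classic : set (measurableTypeR R)) (fun u => (\1_K u : R)%:E).
  by apply/measurable_EFinP; exact: measurable_indic.
rewrite ge0_fin_numE; last by apply: integral_ge0 => u _; rewrite lee_fin cutoff_ge0.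
apply: (@le_lt_trans _ _ (\int[nu]_(u in `]0%R, +oo[) (((2 * s) `^ a)%:E * (\1_K u)%:E))%E).
  apply: ge0_le_integral => //.
  - by move=> u _; rewrite lee_fin cutoff_ge0.
  - exact: measurable_cutoff.
  - by apply: measurable_funeM; exact: m1.
  move=> u; rewrite /= in_itv/= andbT => u0; rewrite -EFinM lee_fin indicE.
  case: (boolP (u \in K)) => uK.
    rewrite mulr1; apply: (le_trans (cutoff_le a s r0 u0)).
    move: uK; rewrite inE /K /= in_itv/= => /andP[_ us].
    by apply: ge0_ler_powR; rewrite ?nnegrE ?(ltW u0)// mulr_ge0// ltW.
  rewrite mulr0 le_eqVlt; apply/orP; left; apply/eqP.
  move: uK; rewrite notin_setE /K /= in_itv/= => /negP; rewrite negb_and -!ltNge.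
  by move=> /orP[|] h; [rewrite cutoff_low// ltW|rewrite cutoff_high// ltW].
rewrite ge0_integralZl//; last by rewrite lee_fin powR_ge0.
rewrite integral_indic// setIidl//.
by apply: lte_mul_pinfty => //; rewrite lee_fin powR_ge0.
Qed.

(** Monotone convergence, hence valid in the extended reals: the full energy is not known to be
    finite here. *)
Lemma cutoff_integral_cvg a (r s : nat -> R) :
  (forall j, 0 < r j) -> (forall j, 0 < s j) -> (forall j, r j.+1 <= r j) ->
  (forall j, s j <= s j.+1) ->
  (forall lam, 0 < lam -> exists j, forall k, (j <= k)%N -> r k <= lam <= s k) ->
  (\int[nu]_(u in `]0%R, +oo[) (cutoff_pow a (r j) (s j) u)%:E)%E @[j --> \oo] -->
  (\int[nu]_(u in `]0%R, +oo[) (u `^ a)%:E)%E.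
Proof.
move=> r0 s0 rr ss h.
have := @cvg_monotone_convergence _ _ R nu (`]0, +oo[%classic) mRp
  (fun j u => (cutoff_pow a (r j) (s j) u)%:E) (fun j => measurable_cutoff a (s j) (r0 j)).
have f0 j (u : R) : `]0, +oo[%classic u -> (0 <= (cutoff_pow a (r j) (s j) u)%:E)%E.
  by move=> _; rewrite lee_fin cutoff_ge0.
have fm (u : R) : `]0, +oo[%classic u ->
    {homo (fun j => (cutoff_pow a (r j) (s j) u)%:E) : i j / (i <= j)%N >-> (i <= j)%E}.
  rewrite /= in_itv/= andbT => u0; apply: homo_leq => [//|i j k|j].
    exact: le_trans.
  by rewrite lee_fin; apply: cutoff_mono.
move=> /(_ f0 fm).
rewrite (_ : (\int[nu]_(x in `]0%R, +oo[) limn _)%E = (\int[nu]_(u in `]0%R, +oo[) (u `^ a)%:E)%E)//.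
apply: eq_integral => u; rewrite inE /= in_itv/= andbT => u0.
apply/cvg_lim => //; apply: cvg_near_cst; have [j hj] := h u u0.
by exists j => // k /= jk; rewrite cutoff_eq// hj.
Qed.

End Cutoff.

Section CutoffEnergy.
Context {R : realType}.
Variables gamma rho0 x : R.
Hypothesis hgamma : 0 < gamma < 1.
Implicit Types (eps r s : R) (n : nat -> R) (l N : nat).

Let gt0 : 0 < gamma. Proof. by case/andP: hgamma. Qed.

Local Notation l0 := (l0 x).
Local Notation f r s := (cutoff_pow (1 - gamma) r s).
Local Notation cut_energy eps n r s := (\int[Pi_mac x eps n]_(lam in `]0, +oo[) f r s lam).

Let scaled eps l : 0 < eps -> (0 < l)%N ->
  (eps * l%:R) `^ (1 - gamma) / eps = eps `^ (- gamma) * l%:R `^ (1 - gamma).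
Proof.
move=> e0 lp; rewrite powRM ?(ltW e0)// powRD_pos// powRr1 ?(ltW e0)//.
by field; rewrite gt_eqF.
Qed.

Lemma cutoff_energyE eps n r s N : 0 < eps -> nonneg n -> (0 < l0 eps)%N -> 0 < r -> 0 < s ->
  2 * s <= N%:R * eps ->
  cut_energy eps n r s = \sum_(l0 eps <= l < N) n l / eps * f r s (eps * l%:R).
Proof.
move=> e0 n0 lp r0 s0 hN; apply: Rintegral_Pi_mac => //.
- exact: cutoff_continuous.
- by move=> lam; exact: cutoff_ge0.
by move=> lam h; apply: cutoff_high => //; exact: le_trans h.
Qed.

Lemma cutoff_energy_le eps n r s N : 0 < eps -> nonneg n -> (0 < l0 eps)%N ->
  0 < r -> 0 < s -> 2 * s <= N%:R * eps ->
  cut_energy eps n r s <= eps `^ (- gamma) * \sum_(l0 eps <= l < N) l%:R `^ (1 - gamma) * n l.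
Proof.
move=> e0 n0 lp r0 s0 hN; rewrite (cutoff_energyE e0 n0 lp r0 s0 hN) mulr_sumr.
rewrite !big_nat; apply: ler_sum => l /andP[ll _]; have lp' := leq_trans lp ll.
have -> : eps `^ (- gamma) * (l%:R `^ (1 - gamma) * n l) =
    n l / eps * (eps * l%:R) `^ (1 - gamma).
  by rewrite mulrA -scaled//; ring.
apply: ler_wpM2l.
  by rewrite divr_ge0 ?n0// ltW.
by apply: cutoff_le => //; rewrite mulr_gt0// ltr0n.
Qed.

(** Sizes up to K go to the middle sum; where r <= eps l <= s the cutoff is exact; where eps l > s,
    (eps l)^(-gamma) <= s^(-gamma) leaves the mass, at most rho0. *)
Lemma cutoff_energy_ge eps n r s N K : 0 < eps -> states rho0 n -> (0 < l0 eps)%N ->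
  0 < r -> 0 < s -> r / eps < K.+1%:R ->
  eps `^ (- gamma) * \sum_(l0 eps <= l < N) l%:R `^ (1 - gamma) * n l <=
  cut_energy eps n r s + eps `^ (- gamma) * \sum_(l0 eps <= l < K.+1) l%:R `^ (1 - gamma) * n l +
    s `^ (- gamma) * rho0.
Proof.
move=> e0 hn lp r0 s0 hK.
have n0 : nonneg n by move=> l l1; exact: states_ge0 hn l1.
have e0' := powR_gt0 (- gamma) e0.
have s0' := powR_ge0 s (- gamma).
pose m := (Num.truncn (2 * s / eps)).+1.
(* Large enough to contain the support of the cutoff and the sizes up to K. *)
pose N' := (N + (m + K.+1))%N.
have hN' : 2 * s <= N'%:R * eps.
  rewrite -ler_pdivrMr//; apply: (le_trans (ltW (truncnS_gt _))).
  by rewrite ler_nat /N' -/m; exact: leq_trans (leq_addr _ _) (leq_addl _ _).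
have t0 l : (0 < l)%N -> 0 <= l%:R `^ (1 - gamma) * n l.
  by move=> l1; rewrite mulr_ge0 ?powR_ge0 ?n0.
apply: (@le_trans _ _ (eps `^ (- gamma) * \sum_(l0 eps <= l < N') l%:R `^ (1 - gamma) * n l)).
  apply: ler_wpM2l; first exact: ltW.
  by apply: sum_nat_nonneg_le; [move=> l ll; apply: t0; exact: leq_trans ll|exact: leq_addr].
rewrite (cutoff_energyE e0 n0 lp r0 s0 hN').
have hKN : (K.+1 <= N')%N by rewrite /N' addnA leq_addl.
rewrite (big_nat_widen _ _ _ _ _ hKN)/= [Y in _ + _ * Y + _]big_mkcond/=.
have mass : \sum_(l0 eps <= l < N') l%:R * n l <= rho0.
  apply: le_trans (states_partial_le N' hn).
  by apply: sum_nat_nonneg_ge => // l l1; rewrite mulr_ge0 ?n0.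
apply: le_trans (lerD (lexx _) (ler_wpM2l s0' mass)).
rewrite !mulr_sumr -!big_split/= !big_nat; apply: ler_sum => l /andP[ll lN].
have lp' := leq_trans lp ll; have lR : 0 < l%:R :> R by rewrite ltr0n.
have u0 : 0 < eps * l%:R by exact: mulr_gt0.
have A0 : 0 <= n l / eps * f r s (eps * l%:R).
  by rewrite mulr_ge0 ?cutoff_ge0// divr_ge0 ?n0// ltW.
have C0 : 0 <= s `^ (- gamma) * (l%:R * n l) by rewrite !mulr_ge0// n0.
case: ltnP => lK.
  by rewrite -addrA [leRHS]addrCA lerDl addr_ge0.
rewrite mulr0 addr0.
have rl : r <= eps * l%:R.
  rewrite mulrC -ler_pdivrMr//; apply: (le_trans (ltW hK)); by rewrite ler_nat.
have [ls|sl] := leP (eps * l%:R) s.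
  have -> : eps `^ (- gamma) * (l%:R `^ (1 - gamma) * n l) = n l / eps * f r s (eps * l%:R).
    by rewrite cutoff_eq ?rl// mulrA -scaled//; ring.
  by rewrite lerDl.
apply: ler_wpDl => //; rewrite !mulrA; apply: ler_wpM2r; first exact: n0.
have -> : eps `^ (- gamma) * l%:R `^ (1 - gamma) = (eps * l%:R) `^ (- gamma) * l%:R.
  rewrite powRD_pos// powRr1 ?ler0n// powRM ?ltW//; first ring.
apply: ler_wpM2r; first exact: ltW.
rewrite !powRN lef_pV2 ?posrE ?powR_gt0//.
by apply: ge0_ler_powR; rewrite ?nnegrE ?ltW.
Qed.

(** A bound independent of eps and time: the dominating constant for the convergence in L^1(0,T). *)
Lemma cutoff_energy_bound eps n r s : 0 < eps -> states rho0 n -> (0 < l0 eps)%N ->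
  0 < r -> 0 < s -> 0 <= cut_energy eps n r s <= rho0 * (r / 2) `^ (- gamma).
Proof.
move=> e0 hn lp r0 s0; have n0 : nonneg n by move=> l l1; exact: states_ge0 hn l1.
pose N := (Num.truncn (2 * s / eps)).+1.
have hN : 2 * s <= N%:R * eps by rewrite -ler_pdivrMr//; exact: ltW (truncnS_gt _).
rewrite (cutoff_energyE e0 n0 lp r0 s0 hN) big_nat; apply/andP; split.
  apply: sumr_ge0 => l /andP[ll _]; rewrite mulr_ge0 ?cutoff_ge0// divr_ge0 ?(ltW e0)// n0//.
  exact: leq_trans ll.
have mass : \sum_(l0 eps <= l < N) l%:R * n l <= rho0.
  apply: le_trans (states_partial_le N hn).
  by apply: sum_nat_nonneg_ge => // l l1; rewrite mulr_ge0 ?n0.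
apply: (le_trans _ (ler_wpM2r (powR_ge0 _ _) mass)).
rewrite mulr_suml big_nat; apply: ler_sum => l /andP[ll _]; have lp' := leq_trans lp ll.
have u0 : 0 < eps * l%:R by rewrite mulr_gt0// ltr0n.
have a1 : 1 - gamma <= 1 by move: gt0; lra.
have := cutoff_le_linear s a1 r0 u0.
have -> : 1 - gamma - 1 = - gamma by ring.
have c0 : 0 <= n l / eps by rewrite divr_ge0 ?n0// ltW.
move/(ler_wpM2l c0)/le_trans; apply.
by rewrite le_eqVlt; apply/orP; left; apply/eqP; field; rewrite gt_eqF.
Qed.

End CutoffEnergy.

(** * Two-sided bounds on the macroscopic energy *)

Section MacroscopicSqueeze.
Context {R : realType}.
Variables alpha gamma zs q rho0 x CF : R.
Hypotheses (halpha : 0 <= alpha < 1) (hgamma : 0 < gamma < 1).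
Hypotheses (hzs : 0 < zs) (hq : 0 < q) (hx : 0 < x < 2^-1).
Implicit Types (eps r s M : R) (n : nat -> R) (l N : nat).

Let glt1 : gamma < 1. Proof. by case/andP: hgamma. Qed.
Let x0 : 0 < x. Proof. by case/andP: hx. Qed.

Local Notation omega := (omega alpha gamma zs q).
Local Notation term := (energy_term alpha gamma zs q).
Local Notation l0 := (l0 x).
Local Notation low_energy := (low_energy alpha gamma zs q rho0 CF).

Variables rs Rt : R.
Hypothesis hrs : forall N, \sum_(1 <= l < N) l%:R * omega zs l <= rs.
Hypothesis hrho : rs < rho0.
Hypothesis hRt : 0 < Rt.
Local Notation tight := (tight rho0 rs Rt).
Local Notation cut_energy eps n r s :=
  (\int[Pi_mac x eps n]_(lam in `]0, +oo[) cutoff_pow (1 - gamma) r s lam).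

Let scaled_series_le (f : nat -> R) (a : nat) (c U : R) : 0 < c ->
  (forall l, (a <= l)%N -> 0 <= f l) ->
  (forall N, c * \sum_(a <= l < N) f l <= U) ->
  (c%:E * \sum_(a <= l <oo) (f l)%:E <= U%:E)%E.
Proof.
move=> c0 f0 h; rewrite -lee_pdivlMl// -EFinM; apply: lime_le.
  by apply: is_cvg_nneseries => l al _; rewrite lee_fin f0.
by apply: nearW => N; rewrite sumEFin lee_fin ler_pdivlMl.
Qed.

Let scaled_series_ge (f : nat -> R) (a : nat) (c L : R) N : 0 < c ->
  (forall l, (a <= l)%N -> 0 <= f l) ->
  L <= c * \sum_(a <= l < N) f l ->
  (L%:E <= c%:E * \sum_(a <= l <oo) (f l)%:E)%E.
Proof.
move=> c0 f0 h; rewrite -lee_pdivrMl// -EFinM.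
apply: (@le_trans _ _ (\sum_(a <= l < N) f l)%:E).
  by rewrite lee_fin ler_pdivrMl.
rewrite -sumEFin; apply: nneseries_lim_ge => l al _; by rewrite lee_fin f0.
Qed.

(** The order of quantifiers is the point: the threshold for eps depends on [eta] only, so M, r and
    s can be chosen afterwards, at each time separately. *)
Lemma F_mac_squeeze : exists2 C0, 0 < C0 & exists2 C, 0 < C & forall eta, 0 < eta ->
  small (fun eps => forall n M r s, low_energy eps n -> tight eps n -> 1 <= M ->
    (D_eps alpha gamma zs q eps n <= M%:E)%E -> 0 < r -> 0 < s ->
    C0 * Num.sqrt M * r `^ gamma <= 1 ->
    ((q / (1 - gamma) * cut_energy eps n r s - eta)%:E <=
       F_mac alpha gamma zs q x eps n)%E /\
    (F_mac alpha gamma zs q x eps n <=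
       (q / (1 - gamma) * (cut_energy eps n r s + C * (eps + r `^ (1 - alpha + gamma) * M) +
          s `^ (- gamma) * rho0) + eta)%:E)%E).
Proof.
have [C0 C00 [C Cp h1]] := @small_clusters R alpha gamma zs q rho0 x CF halpha hgamma hzs hq hx rs Rt hrs hrho hRt.
exists C0 => //; exists C => // eta eta0.
have h2 := @F_mac_approx R alpha gamma zs q rho0 x CF halpha hgamma hzs hq hx eta eta0.
apply: (small_mono _ (small_and small_le1 (small_and h1 h2))).
move=> eps e0 [e1 [{}h1 {}h2]] n M r s hg ht M1 hD r0 s0 hM.
have lp : (0 < l0 eps)%N by apply: l0_gt0 => //; rewrite e0.
have n0 := low_energy_nonneg hg; have hn : states rho0 n by case: hg.
have p0 := powR_gt0 (- gamma) e0.
have c0 : 0 < F_scale gamma zs eps by exact: mulr_gt0.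
have k0 : 0 < q / (1 - gamma) by apply: divr_gt0 => //; rewrite subr_gt0.
have t0 l : (l0 eps <= l)%N -> 0 <= term n l.
  by move=> ll; apply: term_ge0 => //; exact: leq_trans ll.
split.
  pose N := (Num.truncn (2 * s / eps)).+1.
  have hN : 2 * s <= N%:R * eps by rewrite -ler_pdivrMr//; exact: ltW (truncnS_gt _).
  apply: (@scaled_series_ge _ _ _ _ N c0 t0).
  have := ler_wpM2l (ltW k0) (cutoff_energy_le gamma e0 n0 lp r0 s0 hN).
  by have := h2 n hg N; rewrite ler_norml /F_scale mulrA => /andP[a _]; move: a; lra.
apply: (scaled_series_le c0 t0) => N.
pose K := Num.truncn (r / eps).
have K1 : r / eps < K.+1%:R by exact: truncnS_gt.
have K2 : K%:R <= r / eps by rewrite truncn_le ltW// divr_gt0.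
have hC := h1 n M r hg ht M1 hD r0 hM K K2.
have hG := cutoff_energy_ge hgamma N e0 hn lp r0 s0 K1.
have := h2 n hg N; rewrite ler_norml /F_scale => /andP[_].
have {}hC : eps `^ (- gamma) * \sum_(l0 eps <= l < K.+1) l%:R `^ (1 - gamma) * n l <=
    C * (eps + r `^ (1 - alpha + gamma) * M).
  apply: (le_trans (ler_wpM2l (ltW p0) hC)).
  rewrite powRN le_eqVlt; apply/orP; left; apply/eqP.
  by field; rewrite gt_eqF// powR_gt0.
have {}hG : eps `^ (- gamma) * \sum_(l0 eps <= l < N) l%:R `^ (1 - gamma) * n l <=
    cut_energy eps n r s + C * (eps + r `^ (1 - alpha + gamma) * M) + s `^ (- gamma) * rho0.
  by apply: (le_trans hG); rewrite lerD2r lerD2l.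
have := ler_wpM2l (ltW k0) hG; rewrite !(mulrA (q / (1 - gamma)) (eps `^ _)).
lra.
Qed.

End MacroscopicSqueeze.

(** * Quasistationarity integrated in time *)

Section SmallClusterEntropy.
Context {R : realType}.
Variables alpha gamma zs q rho0 T x CF epsbar : R.
Hypotheses (halpha : 0 <= alpha < 1) (hgamma : 0 < gamma < 1).
Hypotheses (hzs : 0 < zs) (hq : 0 < q) (hx : 0 < x < 2^-1).
Variables (n : R -> R -> nat -> R) (w : R -> R -> R -> R).
Hypothesis hepsbar : 0 < epsbar <= 1.
Hypothesis hcurve : forall eps, 0 < eps <= epsbar ->
  rescaled_curve alpha gamma zs q rho0 T eps (n eps) (w eps).
Hypothesis hgood : forall eps, 0 < eps <= epsbar -> forall t, 0 <= t <= T ->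
  low_energy alpha gamma zs q rho0 CF eps (n eps t).
Implicit Types (eps t : R) (l : nat).

Let mu := @lebesgue_measure R.
Local Notation l0 := (l0 x).
Local Notation omega := (omega alpha gamma zs q).

Lemma entropyE (a b : R) : 0 <= a -> 0 < b ->
  entropy a b = (a * (ln a - ln b) - a + b)%:E.
Proof.
move=> a0 b0; rewrite /entropy gt_eqF//; congr (_%:E); rewrite /psi.
move: a0; rewrite le_eqVlt => /predU1P[<-|a0]; first by rewrite !mul0r; ring.
rewrite ln_div ?posrE//; field; exact: lt0r_neq0.
Qed.

Lemma entropy_ge0 (a b : R) : 0 <= a -> 0 < b -> (0 <= entropy a b)%E.
Proof.
move=> a0 b0; rewrite /entropy gt_eqF// lee_fin mulr_ge0 ?(ltW b0)//.
by apply: psi_ge0; rewrite divr_ge0// ltW.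
Qed.

Let measurable_H_mic eps : 0 < eps <= epsbar ->
  (forall t, 0 <= t <= T -> 0 < n eps t 1%N) ->
  measurable_fun `[0, T] (fun t => H_mic alpha gamma zs q x eps (n eps t) (n eps t 1%N)).
Proof.
move=> e0 n1; apply: emeasurable_sum_nat => // l /andP[lp _].
have mc m : (0 < m)%N -> measurable_fun `[0, T] (fun t => n eps t m).
  by move=> mp; exact: (measurable_curve (hcurve e0) mp).
have mw : measurable_fun `[0, T] (fun t => omega (n eps t 1%N) l).
  by apply: measurable_funM => //; apply: measurable_funX; exact: mc.
apply: (@eq_measurable_fun _ _ _ _ _ (fun t => (n eps t l * (ln (n eps t l) - ln (omega (n eps t 1%N) l)) - n eps t l + omega (n eps t 1%N) l)%:E)).
  move=> t; rewrite inE /= in_itv/= => tT; rewrite entropyE//.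
    by apply: (curve_nonneg (hcurve e0) tT).
  by apply: omega_gt0 => //; exact: n1.
apply/measurable_EFinP; apply: measurable_funD => //; apply: measurable_funB => //; last exact: mc.
apply: measurable_funM; first exact: mc.
by apply: measurable_funB; apply: measurableT_comp => //; exact: mc.
Qed.

(** [H_mic_bound] at each time; dividing by the scale of D^eps adds 1 - alpha + 2 gamma to the
    exponent -x (1 - alpha + gamma). *)
Lemma integral_H_mic_le : exists C eps1 : R, 0 < eps1 <= epsbar /\
  forall eps, 0 < eps < eps1 ->
    (\int[mu]_(t in `[0%R, T]) H_mic alpha gamma zs q x eps (n eps t) (n eps t 1%N)
     <= (C * eps `^ (gamma + (1 - x) * (1 - alpha + gamma)))%:E *
        \int[mu]_(t in `[0%R, T]) D_mic alpha gamma zs q x eps (n eps t))%E.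
Proof.
have [C C0 h1] := @H_mic_bound R alpha gamma zs q rho0 x CF halpha hgamma hzs hq hx.
have h2 := @n1_window R alpha gamma zs q rho0 x CF hgamma hzs hq hx.
have [e1 e10 h] := small_and h1 h2.
have eb0 : 0 < epsbar by case/andP: hepsbar.
exists (C / zs), (Num.min e1 epsbar); split.
  by rewrite lt_min e10 eb0 ge_min lexx orbT.
move=> eps; rewrite lt_min => /and3P[e0 ee1 eeb].
have eb : 0 < eps <= epsbar by rewrite e0 ltW.
have [{}h1 {}h2] : _ /\ _ := h eps (introT andP (conj e0 ee1)).
have n1 t : 0 <= t <= T -> 0 < n eps t 1%N.
  move=> tT; have [a _ _] := h2 _ (hgood eb tT).
  by apply: lt_le_trans a; exact: divr_gt0.
have s0 : 0 < D_scale alpha gamma zs eps by apply: divr_gt0 => //; exact: powR_gt0.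
have D0 t : `[0, T]%classic t -> (0 <= D_mic alpha gamma zs q x eps (n eps t))%E.
  rewrite /= in_itv/= => tT; apply: mule_ge0; first by rewrite lee_fin ltW.
  rewrite big_nat; apply: sume_ge0 => l /andP[lp _]; apply: diss_ge0 => //.
  exact: curve_nonneg (hcurve eb) _ tT.
have c0 : 0 <= C / zs * eps `^ (gamma + (1 - x) * (1 - alpha + gamma)).
  by rewrite mulr_ge0 ?powR_ge0// divr_ge0// ltW.
rewrite -ge0_integralZl//; last first.
  exact: measurable_D_mic (hcurve eb) x.
apply: ge0_le_integral => //.
- move=> t; rewrite /= in_itv/= => tT; rewrite /H_mic big_nat; apply: sume_ge0 => l /andP[lp _].
  apply: entropy_ge0; first exact: (curve_nonneg (hcurve eb) tT).
  by apply: omega_gt0 => //; exact: n1.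
- exact: measurable_H_mic.
- by apply: measurable_funeM; exact: measurable_D_mic (hcurve eb) x.
move=> t; rewrite /= in_itv/= => tT.
apply: (le_trans (h1 _ (hgood eb tT))).
rewrite /D_mic muleA -EFinM le_eqVlt; apply/orP; left; apply/eqP; congr (_%:E * _)%E.
rewrite /D_scale -[(_ `^ (1 - alpha + 2 * gamma))^-1]powRN.
have -> : - (x * (1 - alpha + gamma)) =
   gamma + (1 - x) * (1 - alpha + gamma) + - (1 - alpha + 2 * gamma) by ring.
rewrite powRD_pos//; field; exact: lt0r_neq0.
Qed.

End SmallClusterEntropy.

(** * Convergence of the energies *)

Section Scales.
Context {R : realType}.
Variable gamma : R.
Hypothesis hgamma : 0 < gamma < 1.
Implicit Types j : nat.

Let gt0 : 0 < gamma. Proof. by case/andP: hgamma. Qed.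

(* Chosen so that [inner_scale j `^ gamma = 4^-j] beats a dissipation of order [2^j]
   and [outer_scale j `^ (- gamma) = 2^-j]. *)
Definition inner_scale j : R := (2 ^- j) `^ (2 / gamma).
Definition outer_scale j : R := (2 ^- j) `^ (- gamma^-1).

Lemma dyadic_gt0 j : 0 < (2 : R) ^- j.
Proof. by rewrite invr_gt0 exprn_gt0. Qed.

Lemma dyadic_le1 j : (2 : R) ^- j <= 1.
Proof. by rewrite invf_le1 ?exprn_gt0// exprn_ege1// ler1n. Qed.

Lemma dyadicS_le j : (2 : R) ^- j.+1 <= 2 ^- j.
Proof. by rewrite lef_pV2 ?posrE ?exprn_gt0// exprS ler_peMl ?exprn_ge0// ler1n. Qed.

Lemma dyadic_cvg0 : (2 : R) ^- j @[j --> \oo] --> 0.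
Proof.
have -> : (fun j => (2 : R) ^- j) = (fun j => 2^-1 ^+ j).
  by apply/funext => j; rewrite exprVn.
by apply: cvg_expr; rewrite ger0_norm ?invr_ge0// invf_lt1// ltr1n.
Qed.

Lemma dyadic_small (c : R) : 0 < c -> exists N, forall j, (N <= j)%N -> 2 ^- j <= c.
Proof.
move=> c0; have /cvgrPdist_le/(_ c c0)[N _ h] := dyadic_cvg0.
exists N => j Nj; have := h j Nj; rewrite /= sub0r normrN; apply: le_trans.
exact: ler_norm.
Qed.

Lemma inner_scale_gt0 j : 0 < inner_scale j.
Proof. exact: powR_gt0 (dyadic_gt0 j). Qed.

Lemma outer_scale_gt0 j : 0 < outer_scale j.
Proof. exact: powR_gt0 (dyadic_gt0 j). Qed.

Lemma inner_scale_le1 j : inner_scale j <= 1.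
Proof.
have -> : 1 = 1 `^ (2 / gamma) :> R by rewrite powR1.
apply: ge0_ler_powR; rewrite ?nnegrE ?(ltW (dyadic_gt0 _))//.
- by rewrite ltW// divr_gt0.
- exact: dyadic_le1.
Qed.

Lemma inner_scale_powR j : inner_scale j `^ gamma = 2 ^- j * 2 ^- j.
Proof.
by rewrite -powRrM divfK ?gt_eqF// -expr2 (powR_mulrn 2) ?(ltW (dyadic_gt0 _)).
Qed.

Lemma outer_scale_powR j : outer_scale j `^ (- gamma) = 2 ^- j.
Proof.
by rewrite -powRrM mulrNN mulVf ?gt_eqF// powRr1// ltW// dyadic_gt0.
Qed.

Lemma inner_scaleS j : inner_scale j.+1 <= inner_scale j.
Proof.
apply: ge0_ler_powR; rewrite ?nnegrE ?(ltW (dyadic_gt0 _))//.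
- by rewrite ltW// divr_gt0.
- exact: dyadicS_le.
Qed.

Lemma outer_scaleS j : outer_scale j <= outer_scale j.+1.
Proof.
rewrite /outer_scale !powRN lef_pV2 ?posrE ?powR_gt0 ?dyadic_gt0//.
apply: ge0_ler_powR; rewrite ?nnegrE ?(ltW (dyadic_gt0 _))//.
- by rewrite ltW// invr_gt0.
- exact: dyadicS_le.
Qed.

Lemma scales_exhaust (lam : R) : 0 < lam ->
  exists N, forall j, (N <= j)%N -> inner_scale j <= lam <= outer_scale j.
Proof.
move=> l0; have c0 : 0 < Num.min (lam `^ (gamma / 2)) (lam `^ (- gamma)).
  by rewrite lt_min !powR_gt0.
have [N hN] := dyadic_small c0; exists N => j /hN; rewrite le_min => /andP[h1 h2].
apply/andP; split.
  have -> : lam = (lam `^ (gamma / 2)) `^ (2 / gamma).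
    rewrite -powRrM (_ : gamma / 2 * (2 / gamma) = 1) ?powRr1 ?ltW//.
    by field; rewrite gt_eqF.
  by apply: ge0_ler_powR; rewrite ?nnegrE ?powR_ge0 ?(ltW (dyadic_gt0 j))// ltW// divr_gt0.
have -> : lam = (lam `^ (- gamma)) `^ (- gamma^-1).
  by rewrite -powRrM mulrNN mulfV ?gt_eqF// powRr1 ?ltW.
rewrite /outer_scale (powRN (2 ^- j)) (powRN (lam `^ _)).
rewrite lef_pV2 ?posrE ?powR_gt0 ?dyadic_gt0//.
by apply: ge0_ler_powR; rewrite ?nnegrE ?powR_ge0 ?(ltW (dyadic_gt0 j))// invr_ge0 ltW.
Qed.

End Scales.

Lemma linear_band_ge (R : realType) (k s B d u v : R) : 0 <= k -> 0 <= B -> 0 <= d ->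
  - (d * s) <= u - v -> k * v + - (k * (s + B) + 1) * d <= k * u - d.
Proof.
by move=> k0 B0 d0 /(ler_wpM2l k0); have := mulr_ge0 (mulr_ge0 k0 B0) d0; lra.
Qed.

Lemma linear_band_le (R : realType) (k s B d u v : R) : 0 <= k -> u - v <= d * s ->
  k * (u + B * d) + d <= k * v + (k * (s + B) + 1) * d.
Proof. by move=> k0 /(ler_wpM2l k0); lra. Qed.

Section EnergyConvergence.
Context {R : realType}.
Variables alpha gamma zs q rho0 T x CF epsbar rs Rt CD : R.
Hypotheses (halpha : 0 <= alpha < 1) (hgamma : 0 < gamma < 1).
Hypotheses (hzs : 0 < zs) (hq : 0 < q) (hx : 0 < x < 2^-1).
Variables (n : R -> R -> nat -> R) (w : R -> R -> R -> R).
Hypothesis hepsbar : 0 < epsbar <= 1.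
Hypothesis hcurve : forall eps, 0 < eps <= epsbar ->
  rescaled_curve alpha gamma zs q rho0 T eps (n eps) (w eps).
Hypothesis hgood : forall eps, 0 < eps <= epsbar -> forall t, 0 <= t <= T ->
  low_energy alpha gamma zs q rho0 CF eps (n eps t).
Hypothesis hD : forall eps, 0 < eps <= epsbar ->
  (int_D alpha gamma zs q T eps (n eps) <= CD%:E)%E.
Hypothesis hrs : forall N, \sum_(1 <= l < N) l%:R * omega alpha gamma zs q zs l <= rs.
Hypothesis hrho : rs < rho0.
Hypothesis hRt : 0 < Rt.
Hypothesis htight : forall eps, 0 < eps <= epsbar -> forall t, 0 <= t <= T ->
  tight rho0 rs Rt eps (n eps t).
Variables (e : nat -> R) (nu : R -> {measure set (measurableTypeR R) -> \bar R}).
Hypothesis he : forall k, 0 < e k <= epsbar.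
Hypothesis he0 : e k @[k --> \oo] --> 0.
Hypothesis hnu : forall t, 0 <= t <= T -> radon_on_Rplus (nu t).
Hypothesis hcvg : forall t, 0 <= t <= T -> forall f : R -> R, Cc0 `]0, +oo[ f ->
  \int[Pi_mac x (e k) (n (e k) t)]_(lam in `]0, +oo[) f lam @[k --> \oo]
    --> \int[nu t]_(lam in `]0, +oo[) f lam.
Implicit Types (eps t s : R) (j k l : nat).

Let mu := @lebesgue_measure R.
Let gt0 : 0 < gamma. Proof. by case/andP: hgamma. Qed.
Let glt1 : gamma < 1. Proof. by case/andP: hgamma. Qed.
Let e0 k : 0 < e k. Proof. by case/andP: (he k). Qed.
Let e1 k : 0 < e k <= 1.
Proof. by rewrite e0; case/andP: (he k) hepsbar => _ a /andP[_]; exact: le_trans. Qed.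
Let lp k : (0 < l0 x (e k))%N.
Proof. by apply: l0_gt0 (e1 k); case/andP: hx. Qed.

Let r := inner_scale gamma.
Let S := outer_scale gamma.
Let r0 j : 0 < r j. Proof. exact: inner_scale_gt0. Qed.
Let S0 j : 0 < S j. Proof. exact: outer_scale_gt0. Qed.
Let f j := cutoff_pow (1 - gamma) (r j) (S j).
Let X j k t := \int[Pi_mac x (e k) (n (e k) t)]_(lam in `]0, +oo[) f j lam.
Let Xl j t := \int[nu t]_(lam in `]0, +oo[) f j lam.

Let mX j k : measurable_fun `[0, T] (X j k).
Proof.
pose N := (Num.truncn (2 * S j / e k)).+1.
have hN : 2 * S j <= N%:R * e k by rewrite -ler_pdivrMr//; exact: ltW (truncnS_gt _).
apply: (@eq_measurable_fun _ _ _ _ _ (fun t => \sum_(l0 x (e k) <= l < N)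
    n (e k) t l / e k * f j (e k * l%:R))).
  move=> t; rewrite inE /= in_itv/= => tT.
  by rewrite /X (cutoff_energyE gamma (e0 k) (curve_nonneg (hcurve (he k)) tT) (lp k) (r0 j) (S0 j) hN).
apply: measurable_sum_nat => // l /andP[ll _].
have l1 := leq_trans (lp k) ll.
by apply: measurable_funM => //; apply: measurable_funM => //; exact: (measurable_curve (hcurve (he k)) l1).
Qed.

(** The index N depends on j only, uniformly in t and s: the subsequence is chosen before s, the
    random-looking size of the dissipation at time t, is known. *)
Let squeeze_constants : exists2 C0, 0 < C0 & exists2 C, 0 < C &
  forall j, exists N, forall k, (N <= k)%N ->
  forall t s, 0 <= t <= T -> 0 <= s -> C0 * (s + 1) * 2 ^- j <= 1 ->
  (D_eps alpha gamma zs q (e k) (n (e k) t) <= (2 ^+ j * s)%:E)%E ->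
  [/\ `|F_mic alpha gamma zs q x (e k) (n (e k) t)| <= C * (s + 1) * 2 ^- j,
    ((q / (1 - gamma) * X j k t - 2 ^- j)%:E <= F_mac alpha gamma zs q x (e k) (n (e k) t))%E &
    (F_mac alpha gamma zs q x (e k) (n (e k) t) <=
     (q / (1 - gamma) * (X j k t + (C * (s + 2) + rho0) * 2 ^- j) + 2 ^- j)%:E)%E].
Proof.
have [C0 C00 [C1 C10 h1]] := @F_mac_squeeze R alpha gamma zs q rho0 x CF halpha hgamma hzs hq hx rs Rt hrs hrho hRt.
have [C2 C20 h2] := @F_mic_bound R alpha gamma zs q rho0 x CF halpha hgamma hzs hq hx rs Rt hrs hrho hRt.
exists C0 => //; exists (C1 + 2 * C2); first by rewrite addr_gt0// mulr_gt0.
move=> j; have d0 := @dyadic_gt0 R j; have d1 := @dyadic_le1 R j.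
set d := 2 ^- j in d0 d1 *.
have dd0 : 0 < d * d by exact: mulr_gt0.
have k0 : 0 < (1 - x) * (1 - alpha + gamma).
  by case/andP: halpha hx gt0 => ? ? /andP[? ?] ?; apply: mulr_gt0; lra.
have g20 : 0 < gamma / 2 by exact: divr_gt0.
have small_d : small (fun eps => eps <= d) by exists d => // eps /andP[_ /ltW].
have [eta eta0 h] := small_and (h1 d d0) (small_and h2 (small_and small_d
  (small_and (small_powR k0 dd0) (small_powR g20 dd0)))).
have /cvgrPdist_lt/(_ eta eta0)[N _ hN] := he0.
exists N => k Nk t s tT s0 hs hDs.
have ek : 0 < e k < eta.
  by rewrite e0; apply: le_lt_trans (hN k Nk); rewrite sub0r normrN ler_norm.
have {h} [q1 [q2 [q3 [q4 q5]]]] := h _ ek.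
(* 2^j (s + 1): at least 1 and above the dissipation. With r_j^gamma = 4^-j the smallness condition
   of [F_mac_squeeze] becomes C0 (s + 1) 2^-j <= 1. *)
pose M := (s + 1) / d.
have M1 : 1 <= M by rewrite ler_pdivlMr// mul1r; lra.
have hDM : (D_eps alpha gamma zs q (e k) (n (e k) t) <= M%:E)%E.
  apply: (le_trans hDs); rewrite lee_fin /M /d invrK mulrC.
  by apply: ler_wpM2r; [exact: exprn_ge0|lra].
have sM : Num.sqrt M <= M.
  rewrite -[leRHS]sqr_sqrtr ?(le_trans ler01)// expr2 ler_peMl ?sqrtr_ge0//.
  by rewrite -sqrtr1 ler_sqrt// (le_trans ler01).
have sM0 := sqrtr_ge0 M.
have Md : M * (d * d) = (s + 1) * d by rewrite /M; field; rewrite gt_eqF.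
have rg : r j `^ gamma = d * d by exact: inner_scale_powR.
have hM : C0 * Num.sqrt M * r j `^ gamma <= 1.
  rewrite rg; apply: le_trans hs; rewrite -mulrA -[leRHS]mulrA; apply: ler_wpM2l; first exact: ltW.
  by rewrite -Md; apply: ler_wpM2r => //; exact: ltW.
have ht := htight (he k) tT; have hg := hgood (he k) tT.
have [l1 l2] := q1 _ M (r j) (S j) hg ht M1 hDM (r0 j) (S0 j) hM.
split.
- have /andP[a b] := q2 _ M hg ht M1 hDM; rewrite ger0_norm//; apply: (le_trans b).
  apply: (@le_trans _ _ (C2 * (M * (d * d) + M * (d * d)))).
    apply: ler_wpM2l; first exact: ltW.
    have M0 : 0 <= M by exact: le_trans M1.
    by apply: lerD; apply: ler_pM => //; exact: powR_ge0.
  have : 0 <= C1 * ((s + 1) * d) by rewrite !mulr_ge0// ?addr_ge0// ltW.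
  by rewrite Md; lra.
- exact: l1.
apply: (le_trans l2); rewrite lee_fin lerD2r; apply: ler_wpM2l.
  by rewrite divr_ge0 ?(ltW hq)// subr_ge0 ltW.
have Sg : S j `^ (- gamma) = d by exact: outer_scale_powR.
rewrite -addrA; apply: lerD; first exact: lexx.
rewrite Sg mulrDl; apply: lerD; last by rewrite mulrC.
have rd : r j `^ (1 - alpha + gamma) <= d * d.
  rewrite -rg powRD_pos ?r0// ler_piMl ?powR_ge0//.
  have : r j `^ (1 - alpha) <= 1 `^ (1 - alpha).
    apply: ge0_ler_powR; rewrite ?nnegrE ?(ltW (r0 j))//; last exact: inner_scale_le1.
    by rewrite subr_ge0 ltW//; case/andP: halpha.
  by rewrite powR1.
have M0 : 0 <= M by exact: le_trans M1.
have h1' : e k + r j `^ (1 - alpha + gamma) * M <= (s + 2) * d.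
  have := ler_wpM2r M0 rd; rewrite [leRHS]mulrC Md => /(lerD q3)/le_trans; apply.
  by rewrite le_eqVlt; apply/orP; left; apply/eqP; ring.
have c0 : 0 <= (s + 2) * d by rewrite mulr_ge0// ?addr_ge0// ltW.
apply: (le_trans (ler_wpM2l (ltW C10) h1')); rewrite -[leRHS]mulrA.
by apply: ler_wpM2r => //; rewrite lerDl mulr_ge0// ltW.
Qed.

(** The squeeze is fed to [diagonal_ae] as the property that holds for late indices. At almost every
    t all errors become multiples of 2^-j, and the truncated limits increase to the full energy. *)
Lemma energies_converge : exists sigma : nat -> nat,
  {homo sigma : i j / (i < j)%N} /\
  {ae mu, forall t, 0 < t < T ->
    F_mic alpha gamma zs q x (e (sigma k)) (n (e (sigma k)) t) @[k --> \oo] --> 0 /\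
    (F_mac alpha gamma zs q x (e (sigma k)) (n (e (sigma k)) t)
      @[k --> \oo] --> E_mac gamma q (nu t))%E}.
Proof.
have [C0 C00 [C Cp hQ]] := squeeze_constants.
have [|||||||sigma [hs hsq hae]] := @diagonal_ae R T
  (fun k t => D_eps alpha gamma zs q (e k) (n (e k) t)) X Xl
  (fun j => rho0 * (r j / 2) `^ (- gamma)) CD
  (fun j k => forall t s, 0 <= t <= T -> 0 <= s -> C0 * (s + 1) * 2 ^- j <= 1 ->
  (D_eps alpha gamma zs q (e k) (n (e k) t) <= (2 ^+ j * s)%:E)%E ->
  [/\ `|F_mic alpha gamma zs q x (e k) (n (e k) t)| <= C * (s + 1) * 2 ^- j,
    ((q / (1 - gamma) * X j k t - 2 ^- j)%:E <= F_mac alpha gamma zs q x (e k) (n (e k) t))%E &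
    (F_mac alpha gamma zs q x (e k) (n (e k) t) <=
     (q / (1 - gamma) * (X j k t + (C * (s + 2) + rho0) * 2 ^- j) + 2 ^- j)%:E)%E]).
- by move=> k; exact: (measurable_D_eps hzs hq (hcurve (he k))).
- move=> k t tT; apply: mule_ge0; first by rewrite lee_fin divr_ge0 ?powR_ge0// ltW.
  apply: nneseries_ge0 => l l1 _; apply: diss_ge0 => //.
  exact: (curve_nonneg (hcurve (he k)) tT).
- by move=> k; exact: hD (he k).
- exact: mX.
- move=> j k t tT.
  have /andP[a b] := cutoff_energy_bound hgamma (e0 k) (curve_states (hcurve (he k)) tT) (lp k) (r0 j) (S0 j).
  by rewrite ger0_norm.
- by move=> j t tT; apply: hcvg => //; exact: cutoff_Cc0.
- exact: hQ.
exists sigma; split => //; apply: (@filterS _ _ (ae_filter_ringOfSetsType mu) _ _ _ hae) => t h tT; have [s s0 {}h] := h tT.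
have {}tT : 0 <= t <= T by case/andP: tT => ? ?; rewrite !ltW.
set kap := q / (1 - gamma) in hsq.
have kap0 : 0 < kap by apply: divr_gt0 => //; rewrite subr_gt0.
have c0 : 0 < C0 * (s + 1) by rewrite mulr_gt0// ltr_pwDr.
have c1 : 0 < C * (s + 1) by rewrite mulr_gt0// ltr_pwDr.
have ic0 : 0 < (C0 * (s + 1))^-1 by rewrite invr_gt0.
(* Only now, with t and hence s fixed, does the smallness condition select the admissible j. *)
have [N hN] := @dyadic_small R (C0 * (s + 1))^-1 ic0.
have {}hsq j : (N <= j)%N -> [/\ `|F_mic alpha gamma zs q x (e (sigma j)) (n (e (sigma j)) t)| <= C * (s + 1) * 2 ^- j,
    ((kap * X j (sigma j) t - 2 ^- j)%:E <= F_mac alpha gamma zs q x (e (sigma j)) (n (e (sigma j)) t))%E &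
    (F_mac alpha gamma zs q x (e (sigma j)) (n (e (sigma j)) t) <=
     (kap * (X j (sigma j) t + (C * (s + 2) + rho0) * 2 ^- j) + 2 ^- j)%:E)%E].
  move=> Nj; apply: hsq => //; last by have [] := h j.
  by rewrite mulrC -ler_pdivlMr// mul1r; exact: hN.
split.
  apply/cvgrPdist_le => eta eta0.
  have [N' hN'] := @dyadic_small R (eta / (C * (s + 1))) (divr_gt0 eta0 c1).
  exists (maxn N N') => // j /=; rewrite geq_max => /andP[j1 j2].
  have [a _ _] := hsq j j1; rewrite sub0r normrN; apply: (le_trans a).
  by rewrite mulrC -ler_pdivlMr//; exact: hN'.
(* Collects the distance of X from its limit (s 2^-j), the squeeze error and the additive 2^-j. *)
pose err := kap * (s + (C * (s + 2) + rho0)) + 1.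
have Xl_cvg : (Xl j t)%:E @[j --> \oo] --> (\int[nu t]_(u in `]0%R, +oo[) (u `^ (1 - gamma))%:E)%E.
  have g1 : 0 <= 1 - gamma by rewrite subr_ge0 ltW.
  have := @cutoff_integral_cvg R (nu t) (1 - gamma) r S r0 S0 (inner_scaleS hgamma)
    (outer_scaleS hgamma) (scales_exhaust hgamma).
  by under eq_fun do rewrite (cutoff_integral_fin (hnu tT) g1 (r0 _) (S0 _)).
have main_cvg := cvgeZl (isT : kap%:E \is a fin_num) Xl_cvg.
have err_cvg (c : R) : (c * 2 ^- j)%:E @[j --> \oo] --> (0 : \bar R)%E.
  apply/fine_cvgP; split; first exact: nearW.
  by rewrite -(mulr0 c); apply: cvgMr; exact: dyadic_cvg0.
have lim_cvg (c : R) : (kap%:E * (Xl j t)%:E + (c * 2 ^- j)%:E)%E @[j --> \oo] -->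
    (E_mac gamma q (nu t)).
  rewrite -[E_mac _ _ _]adde0; apply: cvgeD => //.
  by rewrite fin_num_adde_defl.
apply: (squeeze_cvge _ (lim_cvg (- err)) (lim_cvg err)).
exists N => // j /= Nj; have [_ a b] := hsq j Nj; have [_] := h j.
rewrite ler_norml => /andP[d1 d2].
have d0 := ltW (@dyadic_gt0 R j).
have B0 : 0 <= C * (s + 2) + rho0.
  apply: addr_ge0; first by rewrite mulr_ge0 ?addr_ge0// ltW.
  by apply: ltW; apply: le_lt_trans hrho; have := hrs 0%N; rewrite big_geq.
apply/andP; split.
  by apply: le_trans a; rewrite -EFinM -EFinD lee_fin; exact: linear_band_ge (ltW kap0) B0 d0 d1.
by apply: (le_trans b); rewrite -EFinM -EFinD lee_fin; exact: linear_band_le (ltW kap0) d2.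
Qed.

End EnergyConvergence.

Theorem theorem2p5 (R : realType) (alpha gamma zs q rho0 T x epsbar : R)
  (n : R -> R -> nat -> R) (w : R -> R -> R -> R)
  (halpha : 0 <= alpha < 1) (hgamma : 0 < gamma < 1)
  (hzs : 0 < zs) (hq : 0 < q)
  (hrho : (rho_s alpha gamma zs q < rho0%:E)%E)
  (hT : 0 < T) (hx : 0 < x < 2^-1) (hepsbar : 0 < epsbar <= 1)
  (hcurves : finite_action_family alpha gamma zs q rho0 T epsbar n w)
  (hJ : exists CJ : R, forall eps : R, 0 < eps <= epsbar ->
    (J_eps alpha gamma zs q T eps (n eps) (w eps) <= CJ%:E)%E)
  (htight : forall delta : R, 0 < delta ->
    exists R0 : R, forall r : R, R0 <= r -> forall eps : R, 0 < eps <= epsbar ->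
      (\int[Pi_mac x eps (n eps 0%R)]_(lam in `[r, +oo[) lam%:E <= delta%:E)%E) :
  (exists C eps1 : R, 0 < eps1 <= epsbar /\
    forall eps : R, 0 < eps < eps1 ->
      (\int[lebesgue_measure]_(t in `[0%R, T])
         H_mic alpha gamma zs q x eps (n eps t) (n eps t 1%N)
       <= (C * eps `^ (gamma + (1 - x) * (1 - alpha + gamma)))%:E *
          \int[lebesgue_measure]_(t in `[0%R, T])
            D_mic alpha gamma zs q x eps (n eps t))%E)
  /\
  (forall (e : nat -> R)
          (nu : R -> {measure set (measurableTypeR R) -> \bar R}),
    (forall k, 0 < e k <= epsbar) ->
    e k @[k --> \oo] --> 0 ->
    (forall t, 0 <= t <= T -> radon_on_Rplus (nu t)) ->
    (forall t, 0 <= t <= T -> forall f : R -> R, Cc0 `]0, +oo[ f ->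
      \int[Pi_mac x (e k) (n (e k) t)]_(lam in `]0, +oo[) f lam @[k --> \oo]
        --> \int[nu t]_(lam in `]0, +oo[) f lam) ->
    exists sigma : nat -> nat,
      {homo sigma : i j / (i < j)%N} /\
      {ae lebesgue_measure, forall t : R, 0 < t < T ->
        F_mic alpha gamma zs q x (e (sigma k)) (n (e (sigma k)) t)
          @[k --> \oo] --> 0 /\
        (F_mac alpha gamma zs q x (e (sigma k)) (n (e (sigma k)) t)
          @[k --> \oo] --> E_mac gamma q (nu t))%E}).
Proof.
have [hcurve [C hC]] := hcurves.
have hgood eps : 0 < eps <= epsbar -> forall t, 0 <= t <= T ->
    low_energy alpha gamma zs q rho0 C eps (n eps t).
  move=> he t tT; have [h _ _] := hC eps he.
  by split; [exact: curve_states (hcurve eps he) t tT|exact: h].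
have w0 l : (1 <= l)%N -> 0 <= l%:R * omega alpha gamma zs q zs l.
  by move=> l1; rewrite mulr_ge0// ltW//; apply: omega_gt0.
have rs0 : (0 <= rho_s alpha gamma zs q)%E.
  by apply: nneseries_ge0 => l l1 _; rewrite lee_fin; exact: w0.
have rs_fin : rho_s alpha gamma zs q \is a fin_num.
  by rewrite ge0_fin_numE//; apply: lt_trans hrho _; exact: ltry.
(* The critical mass is a real number because it is nonnegative and below rho0. *)
pose rs := fine (rho_s alpha gamma zs q).
have rsE : rho_s alpha gamma zs q = rs%:E by rewrite fineK.
have hrs N : \sum_(1 <= l < N) l%:R * omega alpha gamma zs q zs l <= rs.
  by apply: nneseriesr_partial_le; [exact: w0|rewrite -rsE].
have rs_lt : rs < rho0 by rewrite -lte_fin -rsE.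
have hA eps : 0 < eps <= epsbar -> (int_A alpha gamma zs q T eps (n eps) (w eps) <= C%:E)%E.
  by move=> he; have [] := hC eps he.
have hD eps : 0 < eps <= epsbar -> (int_D alpha gamma zs q T eps (n eps) <= C%:E)%E.
  by move=> he; have [] := hC eps he.
have [Rt Rt0 ht] := curves_tight halpha hgamma hzs hq hT hx hepsbar hcurve hA htight rs_lt.
split; first exact: (integral_H_mic_le halpha hgamma hzs hq hx hepsbar hcurve hgood).
move=> e nu he he0 hnu hcvg.
exact: (energies_converge halpha hgamma hzs hq hx hepsbar hcurve hgood hD hrs rs_lt Rt0 ht he he0 hnu hcvg).
Qed.
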